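(* Let $\mathcal A_\alpha$, $\alpha\in(0,1]$, be the global attractors of the Navier-Stokes-Voigt equations and $\mathcal A_w$ the weak attractor of the three-dimensional Navier-Stokes equations. Assume that $$\lim_{\alpha\to0}\max\left\{\mathrm{dist}_{\mathbb H}(\mathcal A_\alpha,\mathcal A_w),\mathrm{dist}_{\mathbb H}(\mathcal A_w,\mathcal A_\alpha)\right\}=0.$$ Then the weak attractor $\mathcal A_w$ of the Navier-Stokes equations is strong.
   Context: Setting: $\Omega\subset\mathbb R^3$ is a bounded domain with $C^2$ boundary. $\mathcal V=\{u\in C_0^\infty(\Omega,\mathbb R^3):\operatorname{div}u=0\}$; $\mathbb H$ is the closure of $\mathcal V$ in $L^2(\Omega)^3$, with norm $|\cdot|$ and scalar product $\langle\cdot,\cdot\rangle$; $\mathbb V$ is the closure of $\mathcal V$ in $H^1(\Omega)^3$, with dual $\mathbb V^*$ (duality also written $\langle\cdot,\cdot\rangle$); $P:L^2(\Omega)^3\to\mathbb H$ is the Leray orthogonal projection; $A=-P\Delta$ is the Stokes operator with domain $H^2(\Omega)^3\cap\mathbb V$, self-adjoint and strictly positive, with first eigenvalue $\lambda_1>0$; $\|u\|=|\nabla u|=|A^{1/2}u|$ for $u\in\mathbb V=\mathrm{dom}(A^{1/2})$; $B(u,v)=P[(u\cdot\nabla)v]$. Fix $\nu>0$ and $g=Pf\in\mathbb H$ independent of time. Voigt model: for $\alpha\in(0,1]$, $\mathbb V_\alpha=\mathbb V$ with norm $\|u\|_{\mathbb V_\alpha}^2=|u|^2+\alpha^2\|u\|^2$.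 The equation $\dot u+\alpha^2A\dot u+\nu Au+B(u,u)=g$, $u(0)=u_0$, is known to generate a strongly continuous semigroup $S_\alpha(t):\mathbb V_\alpha\to\mathbb V_\alpha$. Its global attractor $\mathcal A_\alpha$ is the unique compact subset of $\mathbb V_\alpha$ with $S_\alpha(t)\mathcal A_\alpha=\mathcal A_\alpha$ for all $t\ge0$ that attracts every bounded subset of $\mathbb V_\alpha$ in the Hausdorff semidistance of $\mathbb V_\alpha$ as $t\to\infty$. Navier-Stokes: consider $\dot u+\nu Au+B(u,u)=g$, $u(0)=u_0$. A Leray-Hopf weak solution is $u:[0,\infty)\to\mathbb H$ with (i) $u\in L^\infty_{loc}(0,\infty;\mathbb H)\cap L^2_{loc}(0,\infty;\mathbb V)$; (ii) $\dot u\in L^{4/3}_{loc}(0,\infty;\mathbb V^* )$; (iii) $t\mapsto\langle u(t),v\rangle$ continuous on $[0,\infty)$ for every $v\in\mathbb H$; (iv) for all $0\le s\le t$ and $v\in\mathbb V$, $\langle u(t),v\rangle+\nu\int_s^t\langle Au,v\rangle d\tau+\int_s^t\langle B(u,u),v\rangle d\tau=\langle u(s),v\rangle+\int_s^t\langle g,v\rangle d\tau$; (v) for every $T>0$ and every nonnegative $\psi\in C_0^\infty((0,T))$, $-\frac12\int_0^T|u|^2\psi'\,dt+\nu\int_0^T\|u\|^2\psi\,dt\le\int_0^T\langle g,u\rangle\psi\,dt$. A solution on $(-\infty,\infty)$ is a function $u:\mathbb R\to\mathbb H$ such that $u(s+\cdot)|_{[0,\infty)}$ is a Leray-Hopf weak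 solution for every $s\in\mathbb R$. The multivalued semiflow is $S(t)u_0=\{u(t):u$ is a Leray-Hopf weak solution with $u(0)=u_0\}$, and $\mathbb B_0=\left\{w\in\mathbb H:|w|^2\le\frac{2(1+\lambda_1)|g|^2}{\nu^2\lambda_1^2}\right\}$. For a metric $d$ (subscript $w$: a metric $d_w$ inducing the weak topology of $\mathbb H$ on bounded sets; subscript $\mathbb H$: the norm metric of $\mathbb H$), $\mathrm{dist}(B,C)=\sup_{b\in B}\inf_{c\in C}d(b,c)$. The weak attractor $\mathcal A_w$ is known to exist: it is the unique weakly compact set $\mathcal A_w\subset\mathbb B_0$, equal to the weak $\omega$-limit set of $\mathbb B_0$, with $\lim_{t\to\infty}\mathrm{dist}_w(S(t)\mathbb B_0,\mathcal A_w)=0$, and $\mathcal A_w=\{u(0):u$ is a solution on $(-\infty,\infty)$ with $u(t)\in\mathbb B_0$ for all $t\in\mathbb R\}$. ''$\mathcal A_w$ is strong'' means that $\mathcal A_w$ is the strong attractor of $S(t)$, i.e. $\mathcal A_w$ is strongly compact in $\mathbb H$ and $\lim_{t\to\infty}\mathrm{dist}_{\mathbb H}(S(t)\mathbb B_0,\mathcal A_w)=0$; it is a known result from the literature that this is equivalent to $\mathcal A_w$ being strongly compact in $\mathbb H$, and also equivalent to all solutions on the weak global attractor (solutions on $(-\infty,\infty)$ with values in $\mathbb B_0$) being strongly continuous in $\mathbb H$. *)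

(* Defs.v *)
From HB Require Import structures.
From mathcomp Require Import all_boot all_order all_algebra.
From mathcomp Require Import all_classical all_reals all_analysis measurable_realfun.

Set Implicit Arguments.
Unset Strict Implicit.
Unset Printing Implicit Defensive.

Import Order.TTheory GRing.Theory Num.Theory.
Import numFieldNormedType.Exports.

Local Open Scope classical_set_scope.
Local Open Scope ring_scope.

Notation E3 R := (R * R * R)%type.
Notation vfield R := ('I_3 -> E3 R -> R).
Notation tfield R := ('I_3 -> 'I_3 -> E3 R -> R).

Definition ecoord {R : realType} (i : 'I_3) (x : E3 R) : R :=
  match val i with 0%N => x.1.1 | 1%N => x.1.2 | _ => x.2 end.

Definition evec {R : realType} (i : 'I_3) : E3 R :=
  ((val i == 0%N)%:R, (val i == 1%N)%:R, (val i == 2%N)%:R).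

Definition partial {R : realType} (i : 'I_3) (f : E3 R -> R) : E3 R -> R :=
  fun x => 'D_(evec i) f x.

Fixpoint Ck {R : realType} (n : nat) (f : E3 R -> R) : Prop :=
  if n is m.+1 then
    continuous f /\
    forall i, (forall x, derivable f x (evec i)) /\ Ck m (partial i f)
  else continuous f.

Definition smooth {R : realType} (f : E3 R -> R) : Prop := forall n, Ck n f.

(** [C_0^oo(Om)], as functions on the whole space *)
Definition test_fun {R : realType} (Om : set (E3 R)) (f : E3 R -> R) : Prop :=
  [/\ smooth f, compact (closure [set x | f x != 0])
    & closure [set x | f x != 0] `<=` Om].

(** [C_0^oo(I)] for an open set [I] of times *)
Definition test_time {R : realType} (I : set R) (psi : R -> R) : Prop :=
  [/\ forall n t, derivable (derive1n n psi) t 1,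
      compact (closure [set t | psi t != 0])
    & closure [set t | psi t != 0] `<=` I].

(** Near each boundary point, [Om] lies strictly on one side of the graph of a
    C^2 function [gam] of two of the coordinates: [gam] does not depend on the
    coordinate [i], and the sign [(-1) ^+ s] selects the side.  For an open set
    the topological boundary is [closure Om `\` Om]. *)
Definition C2_boundary {R : realType} (Om : set (E3 R)) : Prop :=
  forall x0, (closure Om `\` Om) x0 ->
  exists (i : 'I_3) (s : bool) (gam : E3 R -> R),
    [/\ Ck 2 gam,
        forall x t, gam (x + t *: evec i) = gam x
      & \forall x \near x0, Om x <-> gam x < (-1) ^+ s * ecoord i x].

Definition bounded_C2_domain {R : realType} (Om : set (E3 R)) : Prop :=
  [/\ open Om, connected Om, Om !=set0, bounded_set Om & C2_boundary Om].

(** Vector fields are functions on all of R^3 of which only the restriction to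
    [Om], up to equality almost everywhere ([aeqv]), matters.  Equalities of
    sets of fields are therefore expressed by [aeqvset]. *)

Definition vol {R : realType} :=
  (@lebesgue_measure R \x @lebesgue_measure R \x @lebesgue_measure R)%E.

Definition aeqv {R : realType} (Om : set (E3 R)) (u v : vfield R) : Prop :=
  forall i, {ae vol, forall x, Om x -> u i x = v i x}.

Definition aeqvset {R : realType} (Om : set (E3 R)) (A B : set (vfield R)) : Prop :=
  (forall a, A a -> exists2 b, B b & aeqv Om a b) /\
  (forall b, B b -> exists2 a, A a & aeqv Om a b).

Definition L2s {R : realType} (Om : set (E3 R)) (f : E3 R -> R) : Prop :=
  measurable_fun Om f /\ vol.-integrable Om (fun x => (f x ^+ 2)%:E).

Definition L2v {R : realType} (Om : set (E3 R)) (u : vfield R) : Prop :=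
  forall i, L2s Om (u i).

Definition scalev {R : realType} (a : R) (u : vfield R) : vfield R :=
  fun i x => a * u i x.

Definition inner {R : realType} (Om : set (E3 R)) (u v : vfield R) : R :=
  \int[vol]_(x in Om) (\sum_i u i x * v i x).

Definition innerT {R : realType} (Om : set (E3 R)) (G K : tfield R) : R :=
  \int[vol]_(x in Om) (\sum_i \sum_j G i j x * K i j x).

Definition normH {R : realType} (Om : set (E3 R)) (u : vfield R) : R :=
  Num.sqrt (inner Om u u).

Definition cgrad {R : realType} (u : vfield R) : tfield R :=
  fun i j => partial j (u i).

Definition solenoidal {R : realType} (Om : set (E3 R)) : set (vfield R) :=
  [set u | (forall i, test_fun Om (u i)) /\
           forall x, \sum_i partial i (u i) x = 0].

Definition spaceH {R : realType} (Om : set (E3 R)) : set (vfield R) :=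
  [set u | L2v Om u /\
    forall e, 0 < e -> exists2 phi, solenoidal Om phi & normH Om (u - phi) < e].

Definition weak_partial {R : realType} (Om : set (E3 R)) (j : 'I_3)
    (f g : E3 R -> R) : Prop :=
  [/\ L2s Om f, L2s Om g & forall phi, test_fun Om phi ->
    (\int[vol]_(x in Om) (f x * partial j phi x) =
      - \int[vol]_(x in Om) (g x * phi x))%R].

(** [u] is in [H^1(Om)^3] with weak gradient [G] ([G i j] is the [j]-th
    derivative of [u i]), and is a limit in [H^1(Om)^3] of elements of
    [solenoidal Om]. *)
Definition Vgrad {R : realType} (Om : set (E3 R)) (u : vfield R) (G : tfield R) : Prop :=
  (forall i j, weak_partial Om j (u i) (G i j)) /\
  forall e, 0 < e -> exists2 phi, solenoidal Om phi &
    inner Om (u - phi) (u - phi) + innerT Om (G - cgrad phi) (G - cgrad phi) < e ^+ 2.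

Definition spaceV {R : realType} (Om : set (E3 R)) : set (vfield R) :=
  [set u | exists G, Vgrad Om u G].

(** The weak gradient of [u] in [spaceV Om], which is unique almost everywhere
    in [Om]; the value outside of [spaceV Om] is irrelevant. *)
Definition grad {R : realType} (Om : set (E3 R)) (u : vfield R) : tfield R :=
  xget (fun _ _ _ => 0) [set G | Vgrad Om u G].

(** [<A u, v>] for [u], [v] in [spaceV Om], [A] being extended to an operator
    from V to its dual; [bilinA Om u u] is [||u||^2]. *)
Definition bilinA {R : realType} (Om : set (E3 R)) (u v : vfield R) : R :=
  innerT Om (grad Om u) (grad Om v).

(** [<B(u, v), w>] for [u], [v], [w] in [spaceV Om] *)
Definition trilinB {R : realType} (Om : set (E3 R)) (u v w : vfield R) : R :=
  \int[vol]_(x in Om) (\sum_i \sum_j u j x * grad Om v i j x * w i x).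

(** The norm of [V_a]; [normV Om 1] is the [H^1] norm. *)
Definition normV {R : realType} (Om : set (E3 R)) (a : R) (u : vfield R) : R :=
  Num.sqrt (inner Om u u + a ^+ 2 * bilinA Om u u).

Definition leray_proj {R : realType} (Om : set (E3 R)) (f h : vfield R) : Prop :=
  spaceH Om h /\ forall v, spaceH Om v -> inner Om (f - h) v = 0.

(** [u] is in [H^2(Om)^3] with Laplacian [L] *)
Definition laplacian {R : realType} (Om : set (E3 R)) (u L : vfield R) : Prop :=
  forall i, exists (g : 'I_3 -> E3 R -> R) (h : 'I_3 -> 'I_3 -> E3 R -> R),
    [/\ forall j, weak_partial Om j (u i) (g j),
        forall j k, weak_partial Om k (g j) (h j k)
      & forall x, L i x = \sum_j h j j x].

Definition stokes {R : realType} (Om : set (E3 R)) (u w : vfield R) : Prop :=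
  spaceV Om u /\ exists2 L, laplacian Om u L & leray_proj Om (- L) w.

Definition stokes_eigenvalue {R : realType} (Om : set (E3 R)) (l : R) : Prop :=
  exists2 u, normH Om u != 0 & stokes Om u (scalev l u).

Definition first_stokes_eigenvalue {R : realType} (Om : set (E3 R)) (l : R) : Prop :=
  stokes_eigenvalue Om l /\ forall m, stokes_eigenvalue Om m -> l <= m.

(** Neighborhoods relative to the subset [X] for the (pseudo)metric [d] *)
Definition metric_nbhs {R : realType} {T : Type} (X : set T) (d : T -> T -> R) (p : T) :
    set_system T :=
  [set U | exists2 e, 0 < e & forall q, X q -> d p q < e -> U q].

(** Neighborhoods relative to H in the weak topology of H *)
Definition weak_nbhs {R : realType} (Om : set (E3 R)) (p : vfield R) :
    set_system (vfield R) :=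
  [set U | exists (n : nat) (v : 'I_n -> vfield R) (e : R),
    [/\ 0 < e, forall k, spaceH Om (v k)
      & forall q, spaceH Om q ->
          (forall k, `|inner Om q (v k) - inner Om p (v k)| < e) -> U q]].

(** The library's [compact], unfolded, for the neighborhoods [nb]; the spaces
    considered here do not carry one canonical topology. *)
Definition compact_for {T : Type} (nb : T -> set_system T) (K : set T) : Prop :=
  forall F : set_system T, ProperFilter F -> F K ->
  exists2 p, K p & forall U W, F U -> nb p W -> U `&` W !=set0.

(** The supremum over [B] is taken in [[0, +oo]], so it is 0 if [B] is empty. *)
Definition hdist {R : realType} {T : Type} (d : T -> T -> R) (B C : set T) : \bar R :=
  ereal_sup (0%E |` [set ereal_inf [set (d b c)%:E | c in C] | b in B]).

Definition distH {R : realType} (Om : set (E3 R)) (u v : vfield R) : R :=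
  normH Om (u - v).

Definition distV {R : realType} (Om : set (E3 R)) (a : R) (u v : vfield R) : R :=
  normV Om a (u - v).

Definition ballH {R : realType} (Om : set (E3 R)) (r : R) : set (vfield R) :=
  [set w | spaceH Om w /\ normH Om w <= r].

Record weak_metric {R : realType} (Om : set (E3 R))
    (dw : vfield R -> vfield R -> R) : Prop := WeakMetric {
  wm_ge0 : forall u v, spaceH Om u -> spaceH Om v -> 0 <= dw u v;
  wm_eq0 : forall u v, spaceH Om u -> spaceH Om v -> dw u v = 0 <-> aeqv Om u v;
  wm_sym : forall u v, spaceH Om u -> spaceH Om v -> dw u v = dw v u;
  wm_triangle : forall u v w, spaceH Om u -> spaceH Om v -> spaceH Om w ->
    dw u w <= dw u v + dw v w;
  wm_weak : forall r p U, ballH Om r p ->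
    (exists2 W, weak_nbhs Om p W & W `&` ballH Om r `<=` U) <->
    metric_nbhs (ballH Om r) dw p U }.

Definition simple_time_fun {R : realType} {E : zmodType} (X : set E) (s : R -> E) : Prop :=
  exists (n : nat) (B : 'I_n -> set R) (c : 'I_n -> E),
    [/\ forall k, measurable (B k), forall k, X (c k)
      & forall t, s t = \sum_(k < n) (if t \in B k then c k else 0)].

Definition strongly_measurable {R : realType} {E : zmodType} (I : set R) (X : set E)
    (N : E -> \bar R) (u : R -> E) : Prop :=
  exists s : nat -> R -> E, (forall n, simple_time_fun X (s n)) /\
    {ae lebesgue_measure, forall t, I t -> N (s n t - u t) @[n --> \oo] --> 0%E}.

Definition dualV {R : realType} (Om : set (E3 R)) : set (vfield R -> R) :=
  [set F | (forall a u v, spaceV Om u -> spaceV Om v ->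
              F (scalev a u + v) = a * F u + F v) /\
           exists C, forall v, spaceV Om v -> `|F v| <= C * normV Om 1 v].

Definition dual_norm {R : realType} (Om : set (E3 R)) (F : vfield R -> R) : \bar R :=
  ereal_sup [set `|F v|%:E | v in [set v | spaceV Om v /\ normV Om 1 v <= 1]].

(** Local integrability on the time half-line is meant on [(0, T)] for all [T];
    given the other clauses this is equivalent to integrability on the compact
    subintervals of the open half-line. *)
Record leray_hopf {R : realType} (Om : set (E3 R)) (nu : R) (g : vfield R)
    (u : R -> vfield R) : Prop := LerayHopf {
  lh_H : forall t, 0 <= t -> spaceH Om (u t);
  lh_LooH : forall T, 0 < T ->
    strongly_measurable `]0, T[ (spaceH Om) (fun w => (normH Om w)%:E) u /\
    exists M, {ae lebesgue_measure, forall t, 0 < t < T -> normH Om (u t) <= M};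
  lh_L2V : forall T, 0 < T ->
    [/\ {ae lebesgue_measure, forall t, 0 < t < T -> spaceV Om (u t)},
        strongly_measurable `]0, T[ (spaceV Om) (fun w => (normV Om 1 w)%:E) u
      & lebesgue_measure.-integrable `]0, T[ (fun t => (normV Om 1 (u t) ^+ 2)%:E)];
  lh_dt : exists F : R -> vfield R -> R,
    (forall T, 0 < T ->
      [/\ {ae lebesgue_measure, forall t, 0 < t < T -> dualV Om (F t)},
          strongly_measurable `]0, T[ (dualV Om) (dual_norm Om) F
        & lebesgue_measure.-integrable `]0, T[
            (fun t => dual_norm Om (F t) `^ (4%:R / 3%:R))%E]) /\
    (forall v psi, spaceV Om v -> test_time `]0, +oo[ psi ->
      (\int[lebesgue_measure]_(t in `]0, +oo[) (inner Om (u t) v * derive1 psi t) =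
        - \int[lebesgue_measure]_(t in `]0, +oo[) (F t v * psi t))%R);
  lh_wcont : forall v, spaceH Om v ->
    {within `[0, +oo[, continuous (fun t => inner Om (u t) v)};
  lh_weak : forall s t v, 0 <= s -> s <= t -> spaceV Om v ->
    (inner Om (u t) v
      + nu * \int[lebesgue_measure]_(tau in `[s, t]) bilinA Om (u tau) v
      + \int[lebesgue_measure]_(tau in `[s, t]) trilinB Om (u tau) (u tau) v =
    inner Om (u s) v + \int[lebesgue_measure]_(tau in `[s, t]) inner Om g v)%R;
  lh_energy : forall T psi, 0 < T -> test_time `]0, T[ psi -> (forall t, 0 <= psi t) ->
    (- (1 / 2%:R) *
        \int[lebesgue_measure]_(t in `]0, T[) (normH Om (u t) ^+ 2 * derive1 psi t)
      + nu * \int[lebesgue_measure]_(t in `]0, T[) (bilinA Om (u t) (u t) * psi t) <=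
    \int[lebesgue_measure]_(t in `]0, T[) (inner Om g (u t) * psi t))%R }.

Definition complete_solution {R : realType} (Om : set (E3 R)) (nu : R) (g : vfield R)
    (u : R -> vfield R) : Prop :=
  forall s, leray_hopf Om nu g (fun t => u (s + t)).

(** [S(t) D], the union of the [S(t) u0] for [u0] in [D] *)
Definition ns_flow {R : realType} (Om : set (E3 R)) (nu : R) (g : vfield R)
    (t : R) (D : set (vfield R)) : set (vfield R) :=
  [set w | exists u, [/\ leray_hopf Om nu g u, D (u 0) & w = u t]].

Definition B0 {R : realType} (Om : set (E3 R)) (nu l1 : R) (g : vfield R) :
    set (vfield R) :=
  [set w | spaceH Om w /\
    normH Om w ^+ 2 <= 2%:R * (1 + l1) * normH Om g ^+ 2 / (nu ^+ 2 * l1 ^+ 2)].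

Definition weak_omega_limit {R : realType} (Om : set (E3 R)) (nu : R) (g : vfield R)
    (D : set (vfield R)) : set (vfield R) :=
  [set p | spaceH Om p /\ forall s U, 0 <= s -> weak_nbhs Om p U ->
    exists2 t, s <= t & ns_flow Om nu g t D `&` U !=set0].

(** Since [dw] is only tied to the weak topology on bounded sets, the attraction
    property includes that [S(t) B0] stays in a bounded set for large [t]
    ([wa_bounded]); this is part of [B0] being an absorbing set. *)
Record weak_attractor {R : realType} (Om : set (E3 R)) (nu l1 : R) (g : vfield R)
    (dw : vfield R -> vfield R -> R) (Aw : set (vfield R)) : Prop := WeakAttractor {
  wa_sub : Aw `<=` B0 Om nu l1 g;
  wa_compact : compact_for (weak_nbhs Om) Aw;
  wa_omega : aeqvset Om Aw (weak_omega_limit Om nu g (B0 Om nu l1 g));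
  wa_bounded : exists r t0, forall t, t0 <= t ->
    ns_flow Om nu g t (B0 Om nu l1 g) `<=` ballH Om r;
  wa_attracts : hdist dw (ns_flow Om nu g t (B0 Om nu l1 g)) Aw @[t --> +oo] --> 0%E;
  wa_trajectories : aeqvset Om Aw
    [set w | exists u, [/\ complete_solution Om nu g u,
                           forall t, B0 Om nu l1 g (u t) & w = u 0]] }.

Definition strong_attractor {R : realType} (Om : set (E3 R)) (nu l1 : R) (g : vfield R)
    (A : set (vfield R)) : Prop :=
  compact_for (metric_nbhs (spaceH Om) (distH Om)) A /\
  hdist (distH Om) (ns_flow Om nu g t (B0 Om nu l1 g)) A @[t --> +oo] --> 0%E.

(** Solutions are [C^1] from [[0, +oo)] to V (with derivative [du]), and the
    equation holds in the dual of V. *)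
Definition voigt_solution {R : realType} (Om : set (E3 R)) (nu a : R) (g u0 : vfield R)
    (u : R -> vfield R) : Prop :=
  [/\ forall t, 0 <= t -> spaceV Om (u t), aeqv Om (u 0) u0 &
    exists du : R -> vfield R,
    [/\ forall t, 0 <= t -> spaceV Om (du t),
        forall t e, 0 <= t -> 0 < e -> \forall h \near (0 : R), 0 <= t + h ->
          normV Om a (u (t + h) - u t - scalev h (du t)) <= e * `|h|,
        forall t e, 0 <= t -> 0 < e -> \forall h \near (0 : R), 0 <= t + h ->
          distV Om a (du (t + h)) (du t) < e
      & forall t v, 0 <= t -> spaceV Om v ->
          inner Om (du t) v + a ^+ 2 * bilinA Om (du t) v
            + nu * bilinA Om (u t) v + trilinB Om (u t) (u t) v = inner Om g v]].

Record voigt_semigroup {R : realType} (Om : set (E3 R)) (nu a : R) (g : vfield R)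
    (S : R -> vfield R -> vfield R) : Prop := VoigtSemigroup {
  vs_V : forall t u, 0 <= t -> spaceV Om u -> spaceV Om (S t u);
  vs_0 : forall u, spaceV Om u -> aeqv Om (S 0 u) u;
  vs_add : forall s t u, 0 <= s -> 0 <= t -> spaceV Om u ->
    aeqv Om (S (s + t) u) (S s (S t u));
  vs_cont : forall t u e, 0 <= t -> spaceV Om u -> 0 < e ->
    exists2 d, 0 < d & forall v, spaceV Om v -> distV Om a u v < d ->
      distV Om a (S t u) (S t v) < e;
  vs_strong_cont : forall t u e, 0 <= t -> spaceV Om u -> 0 < e ->
    \forall h \near (0 : R), 0 <= t + h -> distV Om a (S (t + h) u) (S t u) < e;
  vs_solves : forall u0, spaceV Om u0 ->
    voigt_solution Om nu a g u0 (fun t => S t u0) }.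

Record global_attractor {R : realType} (Om : set (E3 R)) (a : R)
    (S : R -> vfield R -> vfield R) (A : set (vfield R)) : Prop := GlobalAttractor {
  ga_V : A `<=` spaceV Om;
  ga_compact : compact_for (metric_nbhs (spaceV Om) (distV Om a)) A;
  ga_invariant : forall t, 0 <= t -> aeqvset Om (S t @` A) A;
  ga_attracts : forall D, D `<=` spaceV Om -> (exists r, forall u, D u -> normV Om a u <= r) ->
    hdist (distV Om a) (S t @` D) A @[t --> +oo] --> 0%E }.

(* Main.v *)
Require Import Defs.
From HB Require Import structures.
From mathcomp Require Import all_boot all_order all_algebra.
From mathcomp Require Import all_classical all_reals all_analysis measurable_realfun.
From mathcomp Require Import ring lra.

(** Write [K] for the weak attractor [Aw].

    The hypothesis makes [K] totally bounded in [L^2]: it is close to the attractor of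
    a Voigt model, which is compact in a norm that dominates the one of [L^2]
    ([approximated_net]). A weakly compact set that is totally bounded is strongly
    compact ([strong_compact]), because on it finitely many pairings control the norm.

    For the attraction, let [u] be a Leray-Hopf solution that starts in the absorbing
    ball, and let [T] be large. By the weak attraction, [u(t)] is for [t] near [T] weakly
    close to a point [k(t)] of [K], in the sense of finitely many pairings prescribed
    in advance. The identity
      [|u(T) - k(T)|^2 = |u(T)|^2 - |k(T)|^2 - 2 <u(T) - k(T), k(T)>],
    whose last term is small as [K] has a finite net, reduces strong closeness to the
    bound of [|u(T)|^2] from above by [|k(T)|^2] up to a small error. This is obtained
    from the energy inequality, as follows.

    - The energy at [T] is at most an average of the energy over a short interval
      [[T - h, T]], up to an error of order [h] ([energy_at_endpoint]).
    - For almost all [t], the field [u(t)] is in V, a bounded part of which is totally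
      bounded in [L^2] by the theorem of Rellich ([spaceV_net]). Hence, if the prescribed
      pairings include those with a net of V, [<u(t) - k(t), u(t)>] is small in proportion
      to the norm of [u(t)] in V, of which the square is integrable in time by the
      dissipation of energy ([integral_N2_le]). So [|u(t)|^2] is close to [|k(t)|^2].
    - The pairings of [u] with solenoidal fields are equicontinuous in time, by the
      equations ([equicontinuity]). So [k(t)] is weakly close to [k(T)], and since both
      belong to [K], [|k(t)|^2] is close to [|k(T)|^2] ([norm_sqr_pointwise]).

    These are put together in [endpoint_close]. The theorem of Rellich is derived from
    the inequality of Poincare on the cubes of a fine grid, and the energy inequality is
    tested with bumps built from the function [exp(-1/x)]. *)

Set Implicit Arguments.
Unset Strict Implicit.
Unset Printing Implicit Defensive.
Import Order.TTheory GRing.Theory Num.Theory.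
Import numFieldNormedType.Exports.
Local Open Scope classical_set_scope.
Local Open Scope ring_scope.

(** * Borel sets of the three-dimensional space *)

(** The points of [E3 R], with the product measurable structure that carries [vol]. *)
Notation VT R := (measurableTypeR R * measurableTypeR R * measurableTypeR R)%type.

Section measurable_base.
Variable R : realType.

(** A countable basis of measurable sets turns topological openness into
    measurability. Such a basis of rational boxes is what relates the topology of the
    space to the product sigma-algebra. *)
Definition measurable_base d (T : measurableType d) (op : set (set T))
    (B : nat -> set T) :=
  (forall n, measurable (B n)) /\
  forall (U : set T) x, op U -> U x -> exists2 n, B n x & B n `<=` U.

Lemma measurable_base_open d (T : measurableType d) op (B : nat -> set T) U :
  measurable_base op B -> op U -> measurable U.
Proof.
move=> [mB bB] oU.
have -> : U = \bigcup_n (if `[< B n `<=` U >] then B n else set0).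
  apply/seteqP; split=> [x Ux|x [n _]].
    have [n Bx BU] := bB _ _ oU Ux.
    by exists n => //; rewrite asboolT.
  by case: ifPn => // /asboolP; apply.
apply: bigcup_measurable => n _; case: ifP => _ //; exact: mB.
Qed.

Lemma measurable_base_real :
  exists B, measurable_base (@open R) B.
Proof.
pose B n : set R := if (unpickle n : option (rat * rat)) is Some q
  then [set` `]ratr q.1, ratr q.2[] else set0.
exists B; split=> [n|U x oU Ux].
  by rewrite /B; case: unpickle => [q|] //; apply: measurable_itv.
have /nbhs_ballP [e /= e0 eU] : nbhs x U by exact: open_nbhs_nbhs.
have [p] := @rat_in_itvoo R (x - e) x ltac:(by rewrite ltrBlDr ltrDl).
have [q] := @rat_in_itvoo R x (x + e) ltac:(by rewrite ltrDl).
rewrite !in_itv /= => /andP[q1 q2] /andP[p1 p2].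
exists (pickle (p, q)); rewrite /B pickleK /= ?in_itv /= ?p2 ?q1 //.
move=> y /=; rewrite in_itv /= => /andP[y1 y2]; apply: eU.
rewrite /ball /= ltr_norml ltrBlDr ltrBrDl; apply/andP; split; lra.
Qed.

(** Products of basis elements, indexed by pairs, form a basis as soon as each open
    set contains an open rectangle around each of its points. *)
Lemma measurable_base_prod d1 d2 (T1 : measurableType d1) (T2 : measurableType d2)
    op1 op2 (op : set (set (T1 * T2))) B1 B2 :
  (forall U x, op U -> U x -> exists V1 V2,
    [/\ op1 V1, op2 V2, V1 x.1, V2 x.2 & V1 `*` V2 `<=` U]) ->
  measurable_base op1 B1 -> measurable_base op2 B2 ->
  exists B, measurable_base op B.
Proof.
move=> ops [mB1 bB1] [mB2 bB2].
pose B n := if (unpickle n : option (nat * nat)) is Some q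
  then B1 q.1 `*` B2 q.2 else set0.
exists B; split=> [n|U x oU Ux].
  by rewrite /B; case: unpickle => [q|] //; exact: measurableX.
have [V1 [V2 [ p1 p2 x1 x2 VU]]] := ops _ _ oU Ux.
have [n nx nV] := bB1 _ _ p1 x1; have [m mx mV] := bB2 _ _ p2 x2.
exists (pickle (n, m)); rewrite /B pickleK //=.
by move=> y [/nV y1 /mV y2]; apply: VU.
Qed.

Lemma open_prod_rect (T1 T2 : topologicalType) (U : set (T1 * T2)) x :
  open U -> U x -> exists V1 V2,
    [/\ open V1, open V2, V1 x.1, V2 x.2 & V1 `*` V2 `<=` U].
Proof.
move=> oU Ux.
have [[A B] /= [A1 B1] AB] : nbhs x U by exact: open_nbhs_nbhs.
move: A1 B1; rewrite !nbhsE => -[V1 [ p1 x1] VA] [V2 [ p2 x2] VB].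
exists V1, V2; split => // y [y1 y2]; apply: AB; split; [exact: VA|exact: VB].
Qed.

Lemma open_measurable_E3 (U : set (E3 R)) : open U -> measurable U.
Proof.
have [B1 hB1] := measurable_base_real.
have [B2 hB2] := @measurable_base_prod _ _ _ _ _ _ (@open (R * R)%type) _ _
  (@open_prod_rect R R) hB1 hB1.
have [B3 hB3] := @measurable_base_prod _ _ _ _ _ _ (@open (R * R * R)%type) _ _
  (@open_prod_rect (R * R)%type R) hB2 hB1.
exact: measurable_base_open hB3.
Qed.

Lemma continuous_measurable_E3 (D : set (E3 R)) (f : E3 R -> R) :
  continuous f -> measurable_fun D f.
Proof.
move=> /continuousP cf; apply: measurable_funTS.
apply: (measurability _ (RGenOpens.measurableE R)).
move=> _ [_ [a [b ->] <-]]; rewrite setTI; apply: open_measurable_E3.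
exact/cf/interval_open.
Qed.

Lemma open_measurable_vol (U : set (VT R)) : open (U : set (E3 R)) -> measurable U.
Proof. by move=> oU; have := open_measurable_E3 oU; exact. Qed.

Lemma continuous_measurable_vol (D : set (VT R)) (f : VT R -> R) :
  continuous (f : E3 R -> R) -> measurable_fun D f.
Proof. by move=> cf; have := @continuous_measurable_E3 (D : set (E3 R)) _ cf; exact. Qed.

End measurable_base.

(** * Semi-inner products and square-integrable fields *)

Section semi_inner_product.
Variables (R : realType) (V : lmodType R) (X : set V) (b : V -> V -> R).

(** The forms [inner] and [innerT] are inner products only up to equality almost
    everywhere, and only on square-integrable fields, hence the domain [X] and the
    absence of definiteness. *)
Record semi_inner : Prop := SemiInner {
  si_lin : forall a u v, X u -> X v -> X (a *: u + v);
  si_linl : forall a u v w, X u -> X v -> X w ->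
    b (a *: u + v) w = a * b u w + b v w;
  si_sym : forall u v, X u -> X v -> b u v = b v u;
  si_ge0 : forall u, X u -> 0 <= b u u }.

Hypothesis H : semi_inner.

Lemma si_scale a u : X u -> X (a *: u).
Proof.
move=> Xu; have -> : a *: u = (a - 1) *: u + u by rewrite scalerBl scale1r subrK.
exact: si_lin.
Qed.

Lemma si_D u v : X u -> X v -> X (u + v).
Proof. by move=> Xu Xv; rewrite -[u]scale1r; exact: si_lin. Qed.

Lemma si_B u v : X u -> X v -> X (u - v).
Proof. by move=> Xu Xv; apply: si_D => //; rewrite -scaleN1r; exact: si_scale. Qed.

Lemma si_Dl u v w : X u -> X v -> X w -> b (u + v) w = b u w + b v w.
Proof. by move=> *; rewrite -[u]scale1r si_linl // !mul1r scale1r. Qed.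

Lemma si_Zl a u w : X u -> X w -> b (a *: u) w = a * b u w.
Proof.
move=> Xu Xw; have {1}-> : a *: u = (a - 1) *: u + u by rewrite scalerBl scale1r subrK.
by rewrite si_linl //; ring.
Qed.

Lemma si_Bl u v w : X u -> X v -> X w -> b (u - v) w = b u w - b v w.
Proof.
move=> Xu Xv Xw; have -> : u - v = (-1) *: v + u by rewrite scaleN1r addrC.
by rewrite si_linl // mulN1r addrC.
Qed.

Lemma si_Dr u v w : X u -> X v -> X w -> b w (u + v) = b w u + b w v.
Proof. by move=> *; rewrite !(@si_sym H w) ?si_Dl //; exact: si_D. Qed.

Lemma si_Zr a u w : X u -> X w -> b w (a *: u) = a * b w u.
Proof. by move=> *; rewrite !(@si_sym H w) ?si_Zl //; exact: si_scale. Qed.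

Lemma si_Br u v w : X u -> X v -> X w -> b w (u - v) = b w u - b w v.
Proof. by move=> *; rewrite !(@si_sym H w) ?si_Bl //; exact: si_B. Qed.

(** The quadratic polynomial [b (t u + v) (t u + v)] is nonnegative: its value at the
    vertex gives the inequality, and where [b v v] vanishes it is affine in [t], so
    that its slope must vanish as well. *)
Lemma si_CS u v : X u -> X v -> b u v ^+ 2 <= b u u * b v v.
Proof.
move=> Xu Xv.
have q t : 0 <= b u u + 2 * t * b u v + t ^+ 2 * b v v.
  have -> : b u u + 2 * t * b u v + t ^+ 2 * b v v = b (t *: v + u) (t *: v + u).
    have Xtv := si_scale t Xv.
    rewrite si_Dl ?si_Dr ?si_Zl ?si_Zr //; last exact: si_D.
    by rewrite (@si_sym H v u) //; ring.
  by apply: si_ge0 => //; exact: si_lin.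
have bv := si_ge0 H Xv; have [bv0|bv0] := eqVneq (b v v) 0; last first.
  have := q (- (b u v / b v v)).
  have -> : b u u + 2 * - (b u v / b v v) * b u v + (- (b u v / b v v)) ^+ 2 * b v v
     = b u u - b u v ^+ 2 / b v v by field.
  by rewrite subr_ge0 ler_pdivrMr // lt_neqAle eq_sym bv0.
suff -> : b u v = 0 by rewrite expr0n /= bv0 mulr0.
apply/eqP/negPn/negP => n0.
have := q (- (b u u + 1) / (2 * b u v)); rewrite bv0 mulr0 addr0.
have -> : b u u + 2 * (- (b u u + 1) / (2 * b u v)) * b u v = -1 by field.
by rewrite lerNr oppr0 ler10.
Qed.

Definition si_norm u := Num.sqrt (b u u).

Lemma si_normE u : X u -> si_norm u ^+ 2 = b u u.
Proof. by move=> Xu; rewrite sqr_sqrtr // si_ge0. Qed.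

Lemma si_norm_ge0 u : 0 <= si_norm u.
Proof. exact: sqrtr_ge0. Qed.

Lemma si_CSn u v : X u -> X v -> `|b u v| <= si_norm u * si_norm v.
Proof.
move=> Xu Xv; rewrite -sqrtrM ?si_ge0 // -sqrtr_sqr ler_wsqrtr //; exact: si_CS.
Qed.

Lemma si_CSl u v : X u -> X v -> b u v <= si_norm u * si_norm v.
Proof. by move=> Xu Xv; apply: le_trans (ler_norm _) _; exact: si_CSn. Qed.

Lemma si_triangle u v : X u -> X v -> si_norm (u + v) <= si_norm u + si_norm v.
Proof.
move=> Xu Xv; rewrite -(@ler_pXn2r _ 2) ?nnegrE ?addr_ge0 ?si_norm_ge0 //.
rewrite si_normE; last exact: si_D.
rewrite si_Dl ?si_Dr //; last exact: si_D.
rewrite (@si_sym H v u) // sqrrD !si_normE // mulr2n.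
by have := si_CSl Xu Xv; lra.
Qed.

Lemma si_normZ a u : X u -> si_norm (a *: u) = `|a| * si_norm u.
Proof.
move=> Xu; rewrite /si_norm si_Zl ?si_Zr //; last exact: si_scale.
by rewrite mulrA -expr2 sqrtrM ?sqr_ge0 // sqrtr_sqr.
Qed.

Lemma si_normC u v : X u -> X v -> si_norm (u - v) = si_norm (v - u).
Proof.
move=> Xu Xv; have -> : u - v = (-1) *: (v - u) by rewrite scaleN1r opprB.
by rewrite si_normZ ?normrN ?normr1 ?mul1r //; exact: si_B.
Qed.

Lemma si_triangleB u v w : X u -> X v -> X w ->
  si_norm (u - w) <= si_norm (u - v) + si_norm (v - w).
Proof.
move=> Xu Xv Xw; have -> : u - w = (u - v) + (v - w) by rewrite addrA subrK.
by apply: si_triangle; exact: si_B.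
Qed.

Lemma si_norm_le u v : X u -> X v -> si_norm u <= si_norm v + si_norm (u - v).
Proof.
move=> Xu Xv; rewrite addrC -{1}(subrK v u); apply: si_triangle => //; exact: si_B.
Qed.

End semi_inner_product.

Section L2_fields.
Variables (R : realType) (Om : set (E3 R)).
Hypothesis mOm : measurable (Om : set (VT R)).
Local Notation L2 := (L2s Om).
Implicit Types f g h : E3 R -> R.

Lemma L2s_measurable f : L2 f -> measurable_fun (Om : set (VT R)) f.
Proof. by case=> mf _; exact: mf. Qed.

Lemma L2s_integrable f : L2 f -> vol.-integrable Om (fun x => (f x ^+ 2)%:E).
Proof. by case. Qed.

Lemma L2sI f : measurable_fun (Om : set (VT R)) f ->
  vol.-integrable Om (fun x => (f x ^+ 2)%:E) -> L2 f.
Proof. by move=> mf f2; split => //; exact: mf. Qed.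

Lemma L2s_integrableM f g : L2 f -> L2 g ->
  vol.-integrable Om (EFin \o (fun x => f x * g x)).
Proof.
move=> Lf Lg; have mf := L2s_measurable Lf; have mg := L2s_measurable Lg.
apply: (le_integrable mOm _ _
  (integrableD mOm (L2s_integrable Lf) (L2s_integrable Lg))).
  by apply/measurable_EFinP; apply: measurable_funM.
move=> x Dx; rewrite /= lee_fin normrM.
rewrite [leRHS]ger0_norm ?addr_ge0 ?sqr_ge0 // -(real_normK (num_real (f x))) -(real_normK (num_real (g x))).
have := normr_ge0 (f x); have := normr_ge0 (g x); nra.
Qed.

Lemma L2s_lin a f g : L2 f -> L2 g -> L2 (fun x => a * f x + g x).
Proof.
move=> Lf Lg; have mf := L2s_measurable Lf; have mg := L2s_measurable Lg.
have f2 := L2s_integrable Lf; have g2 := L2s_integrable Lg.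
apply: L2sI; first by apply: measurable_funD => //; apply: measurable_funM.
have fg := L2s_integrableM Lf Lg.
have := integrableD mOm (integrableD mOm (integrableZl mOm (a ^+ 2) f2)
  (integrableZl mOm (2 * a) fg)) g2.
by apply: eq_integrable => // x _ /=; rewrite -!EFinM -!EFinD; congr EFin; ring.
Qed.

Lemma L2s_0 : L2 (fun=> 0).
Proof.
by apply: L2sI => //; rewrite expr0n /=; exact: integrable0.
Qed.

Definition sprod (f g : E3 R -> R) := \int[vol]_(x in Om) (f x * g x).

Lemma sprod_lin a f g h : L2 f -> L2 g -> L2 h ->
  sprod (fun x => a * f x + g x) h = a * sprod f h + sprod g h.
Proof.
move=> Lf Lg Lh; rewrite /sprod -RintegralZl //; last exact: L2s_integrableM.
rewrite -RintegralD //; last 2 first.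
- have := integrableZl mOm a (L2s_integrableM Lf Lh).
  by apply: eq_integrable => // x _ /=; rewrite -EFinM.
- exact: L2s_integrableM.
by apply: eq_Rintegral => x _; ring.
Qed.

Lemma Rintegral_sum (I : Type) (s : seq I) (F : I -> E3 R -> R) :
  (forall i, vol.-integrable Om (EFin \o F i)) ->
  \int[vol]_(x in Om) (\sum_(i <- s) F i x) = \sum_(i <- s) \int[vol]_(x in Om) F i x.
Proof.
move=> iF; elim: s => [|i s IH].
  rewrite big_nil; under eq_Rintegral do rewrite big_nil.
  by rewrite Rintegral_cst // mul0r.
rewrite big_cons -IH; under eq_Rintegral do rewrite big_cons.
rewrite RintegralD //; elim: s {IH} => [|j s IH].
  under eq_fun do rewrite big_nil; exact: integrable0.
have := integrableD mOm (iF j) IH.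
by apply: eq_integrable => // x _ /=; rewrite big_cons.
Qed.

Lemma Rintegrable_sum (I : Type) (s : seq I) (F : I -> E3 R -> R) :
  (forall i, vol.-integrable Om (EFin \o F i)) ->
  vol.-integrable Om (EFin \o (fun x => \sum_(i <- s) F i x)).
Proof.
move=> iF; elim: s => [|j s IH].
  rewrite [X in _.-integrable _ X](_ : _ = cst 0%E); first exact: integrable0.
  by apply/funext => x /=; rewrite big_nil.
have := integrableD mOm (iF j) IH.
by apply: eq_integrable => // x _ /=; rewrite big_cons.
Qed.

Lemma innerE u v : L2v Om u -> L2v Om v -> inner Om u v = \sum_i sprod (u i) (v i).
Proof. by move=> Lu Lv; rewrite /inner Rintegral_sum // => i; exact: L2s_integrableM. Qed.

Definition L2t (G : tfield R) := forall i j, L2 (G i j).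

Lemma innerTE G K : L2t G -> L2t K ->
  innerT Om G K = \sum_i \sum_j sprod (G i j) (K i j).
Proof.
move=> LG LK; rewrite /innerT Rintegral_sum => [|i].
  by apply: eq_bigr => i _; rewrite Rintegral_sum // => j; exact: L2s_integrableM.
by apply: Rintegrable_sum => j; exact: L2s_integrableM.
Qed.

(** [R^o] serves to see real-valued fields as a module over [R]. *)
Lemma inner_semi : semi_inner (L2v Om : set ('I_3 -> E3 R -> R^o)) (inner Om).
Proof.
have lin a (u v : 'I_3 -> E3 R -> R^o) : L2v Om u -> L2v Om v -> L2v Om (a *: u + v).
  by move=> Lu Lv i; exact: L2s_lin.
split => // [a u v w Lu Lv Lw|u v Lu Lv|u Lu].
- rewrite !innerE //; last exact: lin.
  by rewrite mulr_sumr -big_split /=; apply: eq_bigr => i _; rewrite -sprod_lin.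
- by rewrite /inner; apply: eq_Rintegral => x _; apply: eq_bigr => i _; rewrite mulrC.
- by apply: Rintegral_ge0 => x _; apply: sumr_ge0 => i _; rewrite -expr2 sqr_ge0.
Qed.

Lemma innerT_semi : semi_inner (L2t : set ('I_3 -> 'I_3 -> E3 R -> R^o)) (innerT Om).
Proof.
have lin a (u v : 'I_3 -> 'I_3 -> E3 R -> R^o) : L2t u -> L2t v -> L2t (a *: u + v).
  by move=> Lu Lv i j; exact: L2s_lin.
split => // [a u v w Lu Lv Lw|u v Lu Lv|u Lu].
- rewrite !innerTE //; last exact: lin.
  rewrite mulr_sumr -big_split /=; apply: eq_bigr => i _.
  by rewrite mulr_sumr -big_split /=; apply: eq_bigr => j _; rewrite -sprod_lin.
- rewrite /innerT; apply: eq_Rintegral => x _; apply: eq_bigr => i _.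
  by apply: eq_bigr => j _; rewrite mulrC.
- apply: Rintegral_ge0 => x _; apply: sumr_ge0 => i _.
  by apply: sumr_ge0 => j _; rewrite -expr2 sqr_ge0.
Qed.

End L2_fields.

(** * Semidistances and compactness *)

Section compactness.
Variable R : realType.

Lemma hdist_ge0 (T : Type) (d : T -> T -> R) B C : (0 <= hdist d B C)%E.
Proof. by apply: ereal_sup_ubound; left. Qed.

Lemma hdist_lt (T : Type) (d : T -> T -> R) B C e b :
  (hdist d B C < e%:E)%E -> B b -> exists2 c, C c & d b c < e.
Proof.
move=> h Bb.
have : (ereal_inf [set (d b c)%:E | c in C] < e%:E)%E.
  by apply: le_lt_trans h; apply: ereal_sup_ubound; right; exists b.
by move=> /ereal_inf_lt [_ [c Cc <-]]; rewrite lte_fin; exists c.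
Qed.

Lemma hdist_le (T : Type) (d : T -> T -> R) B C e :
  0 <= e -> (forall b, B b -> exists2 c, C c & d b c <= e) -> (hdist d B C <= e%:E)%E.
Proof.
move=> e0 h; apply: ge_ereal_sup => _ [->|[b Bb <-]]; first by rewrite lee_fin.
have [c Cc dc] := h b Bb.
by apply: (@le_trans _ _ (d b c)%:E); [apply: ereal_inf_lbound; exists c|rewrite lee_fin].
Qed.

Lemma cvge0_lt (I : Type) (F : set_system I) (f : I -> \bar R) e :
  Filter F -> f @ F --> 0%E -> 0 < e -> \forall x \near F, (f x < e%:E)%E.
Proof.
move=> FF f0 e0; apply: (f0 [set y | (y < e%:E)%E]).
by apply: open_nbhs_nbhs; split; [exact: open_ereal_lt_ereal|rewrite /= lte_fin].
Qed.

Lemma cvge0_le (I : Type) (F : set_system I) (f : I -> \bar R) :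
  Filter F -> (forall x, (0 <= f x)%E) ->
  (forall e, 0 < e -> \forall x \near F, (f x <= e%:E)%E) -> f @ F --> 0%E.
Proof.
move=> FF f0 h.
have ffin : \forall x \near F, f x \is a fin_num.
  near=> x; rewrite ge0_fin_numE //; apply: le_lt_trans (ltry 1).
  by near: x; exact: h.
apply/fine_cvgP; split => //; apply/cvgrPdist_le => e e0.
near=> x.
have fx : f x \is a fin_num by near: x.
rewrite sub0r normrN /= ger0_norm ?fine_ge0 // -lee_fin fineK //.
by near: x; exact: h.
Unshelve. all: by end_near. Qed.

(** If no finite subset of [K] were an [e]-net, the sets of points of [K] at distance
    at least [e] from finitely many points of [K] would generate a proper filter,
    which has no cluster point: the ball around such a point is avoided by the filter. *)
Lemma compact_for_net (T : Type) (X : set T) (d : T -> T -> R) (K : set T) e :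
  0 < e -> compact_for (metric_nbhs X d) K ->
  exists (I : finType) (w : I -> T), (forall i, K (w i)) /\
    forall k, K k -> exists i, d (w i) k < e.
Proof.
move=> e0 cK; apply: contrapT => noN.
pose A (I : finType) (w : I -> T) : set T := [set q | K q /\ forall i, e <= d (w i) q].
pose F : set_system T := [set U | exists (I : finType) (w : I -> T),
  (forall i, K (w i)) /\ A I w `<=` U].
have A0 (I : finType) (w : I -> T) : (forall i, K (w i)) -> A I w !=set0.
  move=> Kw; apply: contrapT => An; apply: noN; exists I, w; split=> // k Kk.
  apply: contrapT => Ai; apply: An; exists k; split=> // i.
  by rewrite leNgt; apply/negP => di; apply: Ai; exists i.
have FF : ProperFilter F.
  split.
    by move=> [I [w [Kw sub]]]; have [x /sub] := A0 I w Kw.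
  split.
  - by exists void, (fun v : void => match v with end); split => [[]|].
  - move=> P Q [I [w [Kw wP]]] [J [v [Kv vQ]]].
    exists (I + J)%type, (fun x => match x with inl i => w i | inr j => v j end).
    split => [[]//|q [Kq wq]]; split.
      by apply: wP; split => // i; exact: (wq (inl i)).
    by apply: vQ; split => // j; exact: (wq (inr j)).
  - by move=> P Q PQ [I [w [Kw wP]]]; exists I, w; split => // q /wP /PQ.
have FK : F K.
  by exists void, (fun v : void => match v with end); split => [[]|q []].
have [p Kp cp] := cK F FF FK.
have : (A unit (fun=> p) `&` [set q | d p q < e]) !=set0.
  apply: cp; first by exists unit, (fun=> p); split.
  by exists e.
by case=> q [[_ /(_ tt)]] /= h1 h2; move: (lt_le_trans h2 h1); rewrite ltxx.
Qed.

End compactness.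

(** * Iterated integrals of bounded measurable functions *)

Section bounded_measurable.
Variable R : realType.
Local Notation lam := (@lebesgue_measure R).
Local Notation RT := (measurableTypeR R).

(** On sets of finite measure this class is integrable and it is stable under partial
    integration, so that no integrability has to be tracked in iterated integrals. *)
Definition bmeas d (T : measurableType d) (f : T -> R) :=
  measurable_fun setT f /\ exists C, forall x, `|f x| <= C.

Lemma bmeas_cst d (T : measurableType d) c : bmeas (fun _ : T => c).
Proof. by split=> //; exists `|c|. Qed.

Lemma bmeasD d (T : measurableType d) (f g : T -> R) :
  bmeas f -> bmeas g -> bmeas (fun x => f x + g x).
Proof.
move=> [mf [C fC]] [mg [D gD]]; split; first exact: measurable_funD.
exists (C + D) => x; apply: le_trans (ler_normD _ _) _; exact: lerD.
Qed.

Lemma bmeasM d (T : measurableType d) (f g : T -> R) :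
  bmeas f -> bmeas g -> bmeas (fun x => f x * g x).
Proof.
move=> [mf [C fC]] [mg [D gD]]; split; first exact: measurable_funM.
by exists (C * D) => x; rewrite normrM ler_pM.
Qed.

Lemma bmeasB d (T : measurableType d) (f g : T -> R) :
  bmeas f -> bmeas g -> bmeas (fun x => f x - g x).
Proof.
move=> Bf Bg; have := bmeasD Bf (bmeasM (bmeas_cst T (-1)) Bg).
by congr bmeas; apply/funext => x; rewrite mulN1r.
Qed.

Lemma bmeas_norm d (T : measurableType d) (f : T -> R) :
  bmeas f -> bmeas (fun x => `|f x|).
Proof.
move=> [mf [C fC]]; split; first exact: measurableT_comp.
by exists C => x; rewrite normr_id.
Qed.

Lemma bmeas_comp d d' (T : measurableType d) (T' : measurableType d')
    (h : T' -> T) (f : T -> R) :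
  measurable_fun setT h -> bmeas f -> bmeas (fun x => f (h x)).
Proof. by move=> mh [mf [C fC]]; split; [exact: measurableT_comp|exists C]. Qed.

Lemma bmeas_integrable d (T : measurableType d) (mu : {measure set T -> \bar R})
    (A : set T) (f : T -> R) :
  measurable A -> (mu A < +oo)%E -> bmeas f -> mu.-integrable A (EFin \o f).
Proof.
move=> mA fA [mf [C fC]]; apply: measurable_bounded_integrable => //.
  exact: measurable_funTS.
by exists C; split; [exact: num_real|move=> M CM x _; apply: le_trans (fC x) (ltW CM)].
Qed.

Lemma bmeas_ge0_shift d (T : measurableType d) (f : T -> R) : bmeas f ->
  exists C, bmeas (fun x => f x + C) /\ forall x, 0 <= f x + C.
Proof.
move=> Bf; have [_ [C fC]] := Bf; exists C; split.
  exact: bmeasD (bmeas_cst _ C).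
by move=> x; rewrite -lerBlDr sub0r; have := fC x; rewrite ler_norml => /andP[].
Qed.

Section partial_integral.
Variables (d : measure_display) (T : measurableType d).
Variable A : set RT.
Hypotheses (mA : measurable A) (fA : (lam A < +oo)%E).

(** Adding a constant reduces the measurability of a partial integral to the case of
    nonnegative functions, in which it is part of the theorem of Tonelli. *)
Lemma bmeas_integral (F : T * RT -> R) : bmeas F ->
  bmeas (fun x => \int[lam]_(t in A) F (x, t)).
Proof.
move=> BF; have [C [BC C0]] := bmeas_ge0_shift BF.
have Bs x : bmeas (fun t => F (x, t)) by apply: bmeas_comp BF.
have eqF x : \int[lam]_(t in A) F (x, t) =
    fine (\int[lam]_(t in A) (F (x, t) + C)%:E) - C * fine (lam A).
  rewrite -/(Rintegral _ _ _) RintegralD //; last 2 first.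
  - exact: bmeas_integrable.
  - by apply: bmeas_integrable => //; exact: bmeas_cst.
  by rewrite Rintegral_cst // addrK.
have mE : measurable_fun [set: T] (fun x => (\int[lam]_(t in A) (F (x, t) + C)%:E)%E).
  pose G (z : T * RT) := (((F z + C) * \1_A z.2)%:E)%E.
  have mG : measurable_fun setT G.
    apply/measurable_EFinP; apply: measurable_funM; first by case: BC.
    exact: (measurableT_comp (@measurable_indic _ RT R setT _ mA) measurable_snd).
  have G0 z : (0 <= G z)%E by rewrite /G lee_fin mulr_ge0.
  have := measurable_fun_fubini_tonelli_F (m2 := lam) _ mG G0.
  congr measurable_fun; apply/funext => x; rewrite /fubini_F /G /=.
  rewrite [RHS]integral_mkcond; apply: eq_integral => t _.
  rewrite patchE indicE; case: ifP => tA; first by rewrite mulr1.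
  by rewrite mulr0.
have [_ [D hD]] := BF; split; last first.
  exists (D * fine (lam A)) => x.
  apply: le_trans (le_normr_Rintegral mA (bmeas_integrable mA fA (Bs x))) _.
  rewrite -Rintegral_cst //; apply: le_Rintegral => //.
  - by apply: bmeas_integrable => //; exact: bmeas_norm.
  - by apply: bmeas_integrable => //; exact: bmeas_cst.
rewrite (_ : (fun x => _) = (fun x => fine (\int[lam]_(t in A) (F (x, t) + C)%:E) - C * fine (lam A))); last exact/funext.
apply: measurable_funB => //; exact: measurableT_comp.
Qed.

End partial_integral.

Section swap.
Variables (A B : set RT).
Hypotheses (mA : measurable A) (fA : (lam A < +oo)%E).
Hypotheses (mB : measurable B) (fB : (lam B < +oo)%E).

Lemma swap_integral_ge0 (F : RT * RT -> R) : bmeas F -> (forall z, 0 <= F z) ->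
  \int[lam]_(x in A) \int[lam]_(y in B) F (x, y) =
  \int[lam]_(y in B) \int[lam]_(x in A) F (x, y).
Proof.
move=> BF F0.
pose G (z : RT * RT) := ((F z * \1_A z.1 * \1_B z.2)%:E)%E.
have mG : measurable_fun setT G.
  apply/measurable_EFinP; apply: measurable_funM; last first.
    exact: (measurableT_comp (@measurable_indic _ RT R setT _ mB) measurable_snd).
  apply: measurable_funM; first by case: BF.
  exact: (measurableT_comp (@measurable_indic _ RT R setT _ mA) measurable_fst).
have G0 z : (0 <= G z)%E by rewrite /G lee_fin !mulr_ge0.
have Fx x : bmeas (fun y => F (x, y)) by apply: bmeas_comp BF.
have Fy y : bmeas (fun x => F (x, y)) by apply: bmeas_comp BF.
have -> : \int[lam]_(x in A) \int[lam]_(y in B) F (x, y) =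
   fine (\int[lam]_x \int[lam]_y G (x, y))%E.
  rewrite Rintegral_mkcond /Rintegral; congr fine; apply: eq_integral => x _.
  rewrite patchE /G /=; case: ifP => xA.
    rewrite indicE xA fineK; last exact/integrable_fin_num/bmeas_integrable.
    rewrite integral_mkcond; apply: eq_integral => y _.
    by rewrite patchE indicE; case: ifP; rewrite !(mulr1,mulr0).
  by rewrite integral0_eq // => y _; rewrite indicE xA mulr0 mul0r.
rewrite (fubini_tonelli _ mG G0) Rintegral_mkcond /Rintegral.
congr fine; apply: eq_integral => y _.
rewrite patchE /G /=; case: ifP => yB.
  rewrite indicE yB fineK; last exact/integrable_fin_num/bmeas_integrable.
  rewrite [RHS]integral_mkcond; apply: eq_integral => x _.
  by rewrite patchE indicE; case: ifP; rewrite !(mulr1,mulr0).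
by rewrite integral0_eq // => x _; rewrite [\1_B _]indicE yB mulr0.
Qed.

(** The theorem of Tonelli applies after the addition of a constant, whose
    contribution to the two iterated integrals is the same. *)
Lemma swap_integral (F : RT * RT -> R) : bmeas F ->
  \int[lam]_(x in A) \int[lam]_(y in B) F (x, y) =
  \int[lam]_(y in B) \int[lam]_(x in A) F (x, y).
Proof.
move=> BF; have [C [BC C0]] := bmeas_ge0_shift BF.
have := swap_integral_ge0 BC C0.
have Fx x : bmeas (fun y => F (x, y)) by apply: bmeas_comp BF.
have Fy y : bmeas (fun x => F (x, y)) by apply: bmeas_comp BF.
have BF' : bmeas (fun z : RT * RT => F (z.2, z.1)) by apply: bmeas_comp BF; exact: measurable_swap.
under eq_Rintegral => x _.
  rewrite RintegralD ?Rintegral_cst //; last 2 first.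
    exact: bmeas_integrable.
    by apply: bmeas_integrable => //; exact: bmeas_cst.
  over.
under [in RHS]eq_Rintegral => x _.
  rewrite RintegralD ?Rintegral_cst //; last 2 first.
    exact: bmeas_integrable.
    by apply: bmeas_integrable => //; exact: bmeas_cst.
  over.
rewrite !RintegralD //; do ?by apply: bmeas_integrable => //; exact: bmeas_cst.
- by rewrite !Rintegral_cst // -!mulrA (mulrC (fine (lam A))) => /addIr.
- by apply: bmeas_integrable => //; exact: (bmeas_integral mA fA BF').
- by apply: bmeas_integrable => //; exact: (bmeas_integral mB fB BF).
Qed.
End swap.

End bounded_measurable.

(** * The inequality of Poincare on cubes *)

Section cube_poincare.
Variable R : realType.
Local Notation lam := (@lebesgue_measure R).
Local Notation RT := (measurableTypeR R).

Section bounded_measurable_integral.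
Variable A : set RT.
Hypotheses (mA : measurable A) (fA : (lam A < +oo)%E).
Implicit Types f g : RT -> R.

Lemma le_bint f g : bmeas f -> bmeas g -> (forall x, A x -> f x <= g x) ->
  \int[lam]_(x in A) f x <= \int[lam]_(x in A) g x.
Proof. by move=> Bf Bg fg; apply: le_Rintegral => //; exact: bmeas_integrable. Qed.

Lemma bintD f g : bmeas f -> bmeas g ->
  \int[lam]_(x in A) (f x + g x) = \int[lam]_(x in A) f x + \int[lam]_(x in A) g x.
Proof. by move=> Bf Bg; apply: RintegralD => //; exact: bmeas_integrable. Qed.

Lemma bintZ c f : bmeas f ->
  \int[lam]_(x in A) (c * f x) = c * \int[lam]_(x in A) f x.
Proof. by move=> Bf; apply: RintegralZl => //; exact: bmeas_integrable. Qed.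

Lemma bintC c : \int[lam]_(x in A) (cst c x) = c * fine (lam A).
Proof. exact: Rintegral_cst. Qed.

Lemma bmeasZ d (T : measurableType d) c (f : T -> R) :
  bmeas f -> bmeas (fun x => c * f x).
Proof. by move=> Bf; apply: bmeasM => //; exact: bmeas_cst. Qed.

Lemma bmeas_sqr d (T : measurableType d) (f : T -> R) :
  bmeas f -> bmeas (fun x => f x ^+ 2).
Proof. by move=> Bf; exact: bmeasM. Qed.

Lemma le_bint_lin f g h c1 c2 : bmeas f -> bmeas g -> bmeas h ->
  (forall x, A x -> f x <= c1 * g x + c2 * h x) ->
  \int[lam]_(x in A) f x <= c1 * \int[lam]_(x in A) g x + c2 * \int[lam]_(x in A) h x.
Proof.
move=> Bf Bg Bh fgh; have B1 := bmeasZ c1 Bg; have B2 := bmeasZ c2 Bh.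
by rewrite -(bintZ c1 Bg) -(bintZ c2 Bh) -(bintD B1 B2); apply: le_bint => //; exact: bmeasD.
Qed.

(** The variance of [f] is nonnegative. *)
Lemma sqr_bint_le f : 0 < fine (lam A) -> bmeas f ->
  (\int[lam]_(x in A) f x) ^+ 2 <= fine (lam A) * \int[lam]_(x in A) (f x ^+ 2).
Proof.
set l := fine _ => l0 Bf; set I := \int[lam]_(x in A) f x; set m := I / l.
have : 0 <= \int[lam]_(x in A) (f x - m) ^+ 2 by apply: Rintegral_ge0 => x _; exact: sqr_ge0.
have -> : \int[lam]_(x in A) (f x - m) ^+ 2 =
    \int[lam]_(x in A) (f x ^+ 2) - I ^+ 2 / l.
  transitivity (\int[lam]_(x in A) (f x ^+ 2 + ((- 2 * m) * f x + cst (m ^+ 2) x))).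
    by apply: eq_Rintegral => x _ /=; ring.
  have B1 := bmeas_sqr Bf; have B2 := bmeasZ (- 2 * m) Bf; have B3 := bmeas_cst RT (m ^+ 2).
  rewrite bintD // ?bintD ?bintC ?bintZ //; last exact: bmeasD.
  by rewrite -/I -/l /m; field; rewrite gt_eqF.
by rewrite subr_ge0 ler_pdivrMr // mulrC.
Qed.

End bounded_measurable_integral.

Definition hitv (a L : R) : set RT := [set` `[a, a + L[].

Lemma measurable_hitv a L : measurable (hitv a L).
Proof. exact: measurable_itv. Qed.

Lemma lam_hitv a L : 0 < L -> lam (hitv a L) = L%:E.
Proof.
move=> L0; have := @lebesgue_measure_itv R `[a, a + L[.
by rewrite /= lte_fin ltrDl L0 -EFinB addrAC subrr add0r.
Qed.

Lemma lam_hitv_fin a L : 0 < L -> (lam (hitv a L) < +oo)%E.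
Proof. by move=> L0; rewrite lam_hitv // ltry. Qed.

Lemma fine_lam_hitv a L : 0 < L -> fine (lam (hitv a L)) = L.
Proof. by move=> L0; rewrite lam_hitv. Qed.

Hint Resolve measurable_hitv lam_hitv_fin : core.

(** By the fundamental theorem of calculus and Cauchy-Schwarz, the square of
    [g t - g s] is at most [L] times the integral of [gam ^+ 2]; integrating over
    [s] and [t] gives the inequality. The mean is not subtracted: it is to be
    controlled separately, by the finitely many integrals over the cells of a grid. *)
Lemma poincare_itv a L (g gam : RT -> R) : 0 < L -> bmeas g -> bmeas gam ->
  (forall s t, hitv a L s -> hitv a L t -> s <= t ->
     g t - g s = \int[lam]_(x in `[s, t]) gam x) ->
  \int[lam]_(x in hitv a L) (g x ^+ 2) <=
    L^-1 * (\int[lam]_(x in hitv a L) g x) ^+ 2 +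
    L ^+ 2 * \int[lam]_(x in hitv a L) (gam x ^+ 2).
Proof.
move=> L0 Bg Bgam ftc; set J := hitv a L.
have mJ : measurable J by exact: measurable_hitv.
have fJ : (lam J < +oo)%E by exact: lam_hitv_fin.
set c := L * \int[lam]_(x in J) (gam x ^+ 2).
have c0 : 0 <= c by apply: mulr_ge0; [exact: ltW|apply: Rintegral_ge0 => x _; exact: sqr_ge0].
have Bn := bmeas_norm Bgam.
have le1 s t : J s -> J t -> s <= t -> (g t - g s) ^+ 2 <= c.
  move=> Js Jt st; rewrite ftc // -real_normK ?num_real //.
  have sub : [set` `[s, t]] `<=` J.
    move=> x; move: Js Jt; rewrite /J /hitv /= !in_itv /= => /andP[as_ _] /andP[_ tL] /andP[sx xt].
    by rewrite (le_trans as_) //= (le_lt_trans xt).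
  have mst : measurable ([set` `[s, t]] : set RT) by exact: measurable_itv.
  have fst : (lam [set` `[s, t]] < +oo)%E.
    by apply: le_lt_trans fJ; apply: le_measure => //; rewrite inE.
  have h : `|\int[lam]_(x in `[s, t]) gam x| <= \int[lam]_(x in J) `|gam x|.
    apply: le_trans (le_normr_Rintegral _ _) _ => //.
      exact: bmeas_integrable.
    have i1 := bmeas_integrable mst fst Bn.
    have i2 := bmeas_integrable mJ fJ Bn.
    rewrite /Rintegral fine_le //; [exact: integrable_fin_num|exact: integrable_fin_num|].
    apply: ge0_subset_integral => //.
    exact: measurable_int i2.
  apply: le_trans (_ : (\int[lam]_(x in J) `|gam x|) ^+ 2 <= c).
    by rewrite lerXn2r // nnegrE; apply: Rintegral_ge0.
  have := sqr_bint_le mJ fJ _ Bn; rewrite fine_lam_hitv // => /(_ L0).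
  by under [X in _ <= _ * X -> _]eq_Rintegral do rewrite real_normK ?num_real //.
have le2 s t : J s -> J t -> (g t - g s) ^+ 2 <= c.
  move=> Js Jt; have [st|/ltW ts] := leP s t; first exact: le1.
  by rewrite -sqrrN opprB; exact: le1.
set I := \int[lam]_(x in J) g x; set Q := \int[lam]_(x in J) (g x ^+ 2).
have B2 := bmeas_sqr Bg.
have le3 s : J s -> Q + (- 2 * g s * I + L * g s ^+ 2) <= L * c.
  move=> Js.
  have Bs : bmeas (fun t : RT => (g t - g s) ^+ 2).
    by apply: bmeas_sqr; apply: bmeasB => //; exact: bmeas_cst.
  have := @le_bint J mJ fJ _ _ Bs (bmeas_cst RT c) (fun t Jt => le2 s t Js Jt).
  rewrite bintC // fine_lam_hitv // (mulrC c); apply: le_trans; rewrite le_eqVlt.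
  apply/orP; left; apply/eqP.
  have -> : \int[lam]_(t in J) (g t - g s) ^+ 2 =
      \int[lam]_(x in J) (g x ^+ 2 + ((- 2 * g s) * g x + cst (g s ^+ 2) x)).
    by apply: eq_Rintegral => x _ /=; ring.
  have B1 := bmeasZ (- 2 * g s) Bg; have B3 := bmeas_cst RT (g s ^+ 2).
  rewrite bintD // ?bintD ?bintC ?bintZ //; last exact: bmeasD.
  by rewrite fine_lam_hitv // (mulrC L).
have B1 := bmeasZ (- 2 * I) Bg; have B3 := bmeasZ L B2.
have B4 := bmeasD B1 B3; have B5 := bmeas_cst RT Q.
have : \int[lam]_(s in J) (cst Q s + (- 2 * I * g s + L * g s ^+ 2)) <=
    \int[lam]_(s in J) cst (L * c) s.
  apply: le_bint => //; [exact: bmeasD|exact: bmeas_cst|].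
  by move=> x Jx /=; rewrite (mulrAC (-2) I); exact: le3.
rewrite bintD // bintD // !bintC // !bintZ // -/I -/Q fine_lam_hitv //.
move=> h; rewrite -(ler_pM2l L0) mulrDr mulrA mulfV ?gt_eqF // mul1r.
have -> : L * (L ^+ 2 * \int[lam]_(x in J) (gam x ^+ 2)) = L * c * L by rewrite /c; ring.
have : 0 <= L * c * L by have L0' := ltW L0; apply: mulr_ge0 => //; exact: mulr_ge0.
by rewrite expr2; lra.
Qed.

Definition int3 (A B C : set RT) (F : VT R -> R) : R :=
  \int[lam]_(x in A) \int[lam]_(y in B) \int[lam]_(z in C) F (x, y, z).

(** The form in which differentiability enters the inequality of Poincare: along each
    axis, [f] is a primitive of the corresponding component of its gradient. *)
Definition slices (f f0 f1 f2 : VT R -> R) :=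
  [/\ forall s t y z, s <= t -> f (t, y, z) - f (s, y, z) = \int[lam]_(x in `[s, t]) f0 (x, y, z),
      forall s t x z, s <= t -> f (x, t, z) - f (x, s, z) = \int[lam]_(y in `[s, t]) f1 (x, y, z) &
      forall s t x y, s <= t -> f (x, y, t) - f (x, y, s) = \int[lam]_(z in `[s, t]) f2 (x, y, z)].

Section three_dimensions.
Variables (A B C : set RT).
Hypotheses (mA : measurable A) (fA : (lam A < +oo)%E).
Hypotheses (mB : measurable B) (fB : (lam B < +oo)%E).
Hypotheses (mC : measurable C) (fC : (lam C < +oo)%E).
Implicit Types F : VT R -> R.

Lemma bmeas_slice3 F x y : bmeas F -> bmeas (fun z : RT => F (x, y, z)).
Proof. by apply: bmeas_comp. Qed.

Lemma bmeas_int1 F : bmeas F ->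
  bmeas (fun p : RT * RT => \int[lam]_(z in C) F (p, z)).
Proof. exact: bmeas_integral. Qed.

Lemma bmeas_int1' F x : bmeas F ->
  bmeas (fun y : RT => \int[lam]_(z in C) F (x, y, z)).
Proof. by move=> /bmeas_int1; apply: bmeas_comp. Qed.

Lemma bmeas_int2 F : bmeas F ->
  bmeas (fun x : RT => \int[lam]_(y in B) \int[lam]_(z in C) F (x, y, z)).
Proof. by move=> /bmeas_int1; exact: bmeas_integral. Qed.

Lemma int3D F G : bmeas F -> bmeas G ->
  int3 A B C (fun p => F p + G p) = int3 A B C F + int3 A B C G.
Proof.
move=> BF BG; rewrite /int3 -bintD //; [|exact: bmeas_int2|exact: bmeas_int2].
apply: eq_Rintegral => x _; rewrite -bintD //; [|exact: bmeas_int1'|exact: bmeas_int1'].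
by apply: eq_Rintegral => y _; rewrite -bintD //; exact: bmeas_slice3.
Qed.

Lemma int3Z c F : bmeas F -> int3 A B C (fun p => c * F p) = c * int3 A B C F.
Proof.
move=> BF; rewrite /int3 -bintZ //; last exact: bmeas_int2.
apply: eq_Rintegral => x _; rewrite -bintZ //; last exact: bmeas_int1'.
by apply: eq_Rintegral => y _; rewrite -bintZ //; exact: bmeas_slice3.
Qed.

Lemma int3_swap23 F : bmeas F ->
  int3 A B C F = \int[lam]_(x in A) \int[lam]_(z in C) \int[lam]_(y in B) F (x, y, z).
Proof.
move=> BF; apply: eq_Rintegral => x _.
by apply: (@swap_integral _ _ _ mB fB mC fC (fun p : RT * RT => F (x, p.1, p.2)));
   apply: bmeas_comp BF; apply: measurable_fun_pair => //; exact: measurable_fun_pair.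
Qed.

Lemma int3_swap1 F : bmeas F ->
  int3 A B C F = \int[lam]_(y in B) \int[lam]_(z in C) \int[lam]_(x in A) F (x, y, z).
Proof.
move=> BF; rewrite /int3 (@swap_integral _ _ _ mA fA mB fB (fun p : RT * RT => \int[lam]_(z in C) F (p, z))).
  apply: eq_Rintegral => y _.
  by apply: (@swap_integral _ _ _ mA fA mC fC (fun p : RT * RT => F (p.1, y, p.2)));
     apply: bmeas_comp BF; apply: measurable_fun_pair => //; exact: measurable_fun_pair.
exact: bmeas_int1.
Qed.

End three_dimensions.

End cube_poincare.

Section cube_poincare_inequality.
Variable R : realType.
Local Notation lam := (@lebesgue_measure R).
Local Notation RT := (measurableTypeR R).

Hint Resolve measurable_hitv lam_hitv_fin : core.

(** The inequality on intervals is used in one variable after the other: the square of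
    the integral in [z] that it leaves is treated as a function of [y], and the square
    of the integral in [y] and [z] as a function of [x]. The partial derivatives of
    these integrals are estimated by [sqr_bint_le]. *)
Lemma cube_poincare a b c L (f f0 f1 f2 : VT R -> R) : 0 < L ->
  bmeas f -> bmeas f0 -> bmeas f1 -> bmeas f2 -> slices f f0 f1 f2 ->
  let I3 := int3 (hitv a L) (hitv b L) (hitv c L) in
  is_true (I3 (fun p => f p ^+ 2) <= (L ^- 3) * (I3 f) ^+ 2 +
    L ^+ 2 * (I3 (fun p => f0 p ^+ 2) + I3 (fun p => f1 p ^+ 2) + I3 (fun p => f2 p ^+ 2))).
Proof.
move=> L0 Bf B0 B1 B2 sl I3; have [s0 s1 s2] := sl.
set J1 := hitv a L; set J2 := hitv b L; set J3 := hitv c L.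
have m1 : measurable J1 by exact: measurable_hitv.
have m2 : measurable J2 by exact: measurable_hitv.
have m3 : measurable J3 by exact: measurable_hitv.
have fi1 : (lam J1 < +oo)%E by exact: lam_hitv_fin.
have fi2 : (lam J2 < +oo)%E by exact: lam_hitv_fin.
have fi3 : (lam J3 < +oo)%E by exact: lam_hitv_fin.
have mst s t : measurable ([set` `[s, t]] : set RT) by exact: measurable_itv.
have fst s t : (lam [set` `[s, t]] < +oo)%E.
  by have := @lebesgue_measure_itv R `[s, t]; rewrite /= => ->; case: ifP => // _; rewrite -EFinB ltry.
have Bf' := bmeas_sqr Bf; have B0' := bmeas_sqr B0.
have B1' := bmeas_sqr B1; have B2' := bmeas_sqr B2.
pose in3 (F : VT R -> R) (x y : RT) := \int[lam]_(z in J3) F (x, y, z).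
pose in2 (F : VT R -> R) (x : RT) := \int[lam]_(y in J2) in3 F x y.
have Bin3 F : bmeas F -> bmeas (fun p : RT * RT => in3 F p.1 p.2).
  move=> BF; have := bmeas_int1 m3 fi3 BF.
  by congr bmeas; apply/funext => -[x y].
have Bin3' F x : bmeas F -> bmeas (fun y : RT => in3 F x y).
  by move=> BF; exact: (bmeas_int1' m3 fi3 x BF).
have Bin2 F : bmeas F -> bmeas (in2 F).
  by move=> BF; exact: (bmeas_int2 m2 fi2 m3 fi3 BF).
have Bin2s F : bmeas F -> bmeas (in2 (fun p => F p ^+ 2)).
  by move=> BF; exact: (Bin2 (fun p => F p ^+ 2) (bmeas_sqr BF)).
have I3Z k F : bmeas F -> k * I3 F = \int[lam]_(x in J1) (k * in2 F x).
  by move=> BF; rewrite (bintZ m1 fi1 k (Bin2 F BF)).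
have I3E F : I3 F = \int[lam]_(x in J1) in2 F x by [].
have sq3 F x y : bmeas F -> in3 F x y ^+ 2 <= L * in3 (fun p => F p ^+ 2) x y.
  move=> BF; have := sqr_bint_le m3 fi3 _ (bmeas_slice3 x y BF).
  by rewrite fine_lam_hitv //; exact.
have Bin3s F x : bmeas F -> bmeas (fun y : RT => in3 (fun p => F p ^+ 2) x y).
  by move=> BF; exact: (Bin3' (fun p => F p ^+ 2) x (bmeas_sqr BF)).
have sq2 F x : bmeas F -> in2 F x ^+ 2 <= L ^+ 2 * in2 (fun p => F p ^+ 2) x.
  move=> BF; have := sqr_bint_le m2 fi2 _ (Bin3' _ x BF).
  rewrite fine_lam_hitv // => /(_ L0) /le_trans; apply.
  rewrite expr2 -mulrA ler_pM2l // -bintZ //; last exact: Bin3s.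
  apply: le_bint => //.
  - by apply: bmeas_sqr; exact: Bin3'.
  - by apply: bmeasZ; exact: Bin3s.
  - by move=> y _; exact: sq3.
have step1 x y : in3 (fun p => f p ^+ 2) x y <=
    L^-1 * in3 f x y ^+ 2 + L ^+ 2 * in3 (fun p => f2 p ^+ 2) x y.
  apply: poincare_itv => //; [exact: bmeas_slice3|exact: bmeas_slice3|].
  by move=> s t _ _; exact: s2.
have step2 x : \int[lam]_(y in J2) (in3 f x y ^+ 2) <=
    L^-1 * in2 f x ^+ 2 + L ^+ 2 * (L * in2 (fun p => f1 p ^+ 2) x).
  have := @poincare_itv _ b L (in3 f x) (in3 f1 x) L0 (Bin3' _ _ Bf) (Bin3' _ _ B1).
  move=> /(_ _)/le_trans; apply.
    move=> s t _ _ st; rewrite /in3 -RintegralB //; [|exact/bmeas_integrable/bmeas_slice3..] => //.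
    have Bs : bmeas (fun p : RT * RT => f1 (x, p.2, p.1)).
      by apply: bmeas_comp B1; apply: measurable_fun_pair => //; exact: measurable_fun_pair.
    rewrite -(@swap_integral _ _ _ m3 fi3 (mst s t) (fst s t) _ Bs).
    by apply: eq_Rintegral => z _ /=; exact: s1.
  rewrite lerD2l ler_pM2l ?exprn_gt0 //.
  rewrite -bintZ //; last exact: Bin3s.
  apply: le_bint => //; [exact/bmeas_sqr/Bin3'|exact/bmeasZ/Bin3s|].
  by move=> y _; exact: sq3.
have step3 : \int[lam]_(x in J1) (in2 f x ^+ 2) <=
    L^-1 * I3 f ^+ 2 + L ^+ 2 * (L ^+ 2 * I3 (fun p => f0 p ^+ 2)).
  have := @poincare_itv _ a L (in2 f) (in2 f0) L0 (Bin2 _ Bf) (Bin2 _ B0).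
  move=> /(_ _)/le_trans; apply.
    move=> s t _ _ st; rewrite /in2 -RintegralB //; [|exact/bmeas_integrable/Bin3'..] => //.
    have Bs : bmeas (fun p : RT * RT => in3 f0 p.2 p.1).
      exact: (bmeas_comp (@measurable_swap _ _ RT RT) (Bin3 _ B0)).
    rewrite -(@swap_integral _ _ _ m2 fi2 (mst s t) (fst s t) _ Bs).
    apply: eq_Rintegral => y _ /=.
    rewrite /in3 -RintegralB //; [|exact/bmeas_integrable/bmeas_slice3..] => //.
    have Bs' : bmeas (fun p : RT * RT => f0 (p.2, y, p.1)).
      by apply: bmeas_comp B0; apply: measurable_fun_pair => //; exact: measurable_fun_pair.
    rewrite -(@swap_integral _ _ _ m3 fi3 (mst s t) (fst s t) _ Bs').
    by apply: eq_Rintegral => z _ /=; exact: s0.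
  rewrite lerD2l ler_pM2l ?exprn_gt0 //.
  rewrite (I3Z _ (fun p => f0 p ^+ 2) B0').
  apply: le_bint => //; [exact/bmeas_sqr/Bin2|exact/bmeasZ/Bin2s|].
  by move=> x _; exact: sq2.
pose V0 := \int[lam]_(x in J1) \int[lam]_(y in J2) (in3 f x y ^+ 2).
pose V1 := \int[lam]_(x in J1) (in2 f x ^+ 2).
have BV0 : bmeas (fun x : RT => \int[lam]_(y in J2) (in3 f x y ^+ 2)).
  by apply: (bmeas_integral m2 fi2 (F := fun p => in3 f p.1 p.2 ^+ 2));
     apply: bmeas_sqr; exact: Bin3.
have BV1 : bmeas (fun x => in2 f x ^+ 2) by apply: bmeas_sqr; exact: Bin2.
have le1 : I3 (fun p => f p ^+ 2) <= L^-1 * V0 + L ^+ 2 * I3 (fun p => f2 p ^+ 2).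
  apply: (le_bint_lin m1 fi1 (Bin2s _ Bf) BV0 (Bin2s _ B2)) => x _.
  apply: (le_bint_lin m2 fi2 (Bin3s _ x Bf) (bmeas_sqr (Bin3' _ x Bf)) (Bin3s _ x B2)) => y _.
  exact: step1.
have le2 : V0 <= L^-1 * V1 + (L ^+ 2 * L) * I3 (fun p => f1 p ^+ 2).
  apply: (le_bint_lin m1 fi1 BV0 BV1 (Bin2s _ B1)) => x _.
  by rewrite -mulrA; exact: step2.
have {}step3 : V1 <= L^-1 * I3 f ^+ 2 + L ^+ 2 * (L ^+ 2 * I3 (fun p => f0 p ^+ 2)).
  exact: step3.
move: le1 le2 step3.
move: (I3 _) (I3 (fun p => f p ^+ 2)) (I3 (fun p => f0 p ^+ 2)) (I3 (fun p => f1 p ^+ 2))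
  (I3 (fun p => f2 p ^+ 2)) V0 V1 => I If I0 I1 I2 V0 V1 le1 le2 le3.
have Li : 0 <= L^-1 by rewrite invr_ge0 ltW.
apply: le_trans le1 _; apply: le_trans (lerD (ler_wpM2l Li le2) (lexx _)) _.
apply: le_trans (lerD (ler_wpM2l Li (lerD (ler_wpM2l Li le3) (lexx _))) (lexx _)) _.
rewrite le_eqVlt; apply/orP; left; apply/eqP; field; exact: lt0r_neq0.
Qed.

Lemma grid_integral a L n (F : RT -> R) : 0 < L -> bmeas F ->
  \int[lam]_(x in hitv a (L *+ n)) F x =
  \sum_(i < n) \int[lam]_(x in hitv (a + L *+ i) L) F x.
Proof.
move=> L0 BF; elim: n => [|n IH].
  rewrite big_ord0 mulr0n (_ : hitv a 0 = set0) ?Rintegral_set0 //.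
  by apply/seteqP; split => // x; rewrite /hitv /= in_itv /= addr0 => /andP[/le_lt_trans h /h]; rewrite ltxx.
rewrite big_ord_recr /= -IH.
have Ln : 0 <= L *+ n by rewrite mulrn_wge0 // ltW.
have sp : hitv a (L *+ n.+1) = hitv a (L *+ n) `|` hitv (a + L *+ n) L.
  apply/seteqP; split => x; rewrite /hitv /= !in_itv /= mulrSr addrA.
    move=> /andP[ax ->]; rewrite ax andbT /=.
    by have [xn|nx] := ltP x (a + L *+ n); [left|right].
  move=> [/andP[-> xn]|/andP[nx ->]] /=.
    by apply: lt_trans xn _; rewrite ltrDl.
  by rewrite andbT (le_trans _ nx) // lerDl.
have mi : lam.-integrable (hitv a (L *+ n) `|` hitv (a + L *+ n) L) (EFin \o F).
  rewrite -sp; apply: bmeas_integrable => //; apply: lam_hitv_fin.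
  by rewrite pmulrn_lgt0.
rewrite sp (Rintegral_setU _ _ mi) //.
apply/disj_setPS => x [] /=; rewrite /hitv /= !in_itv /= => /andP[_ h1] /andP[h2 _].
by move: (lt_le_trans h1 h2); rewrite ltxx.
Qed.

Lemma grid_int3 a L n (F : VT R -> R) : 0 < L -> (0 < n)%N -> bmeas F ->
  let B := hitv a (L *+ n) in
  int3 B B B F = \sum_(i < n) \sum_(j < n) \sum_(k < n)
    int3 (hitv (a + L *+ i) L) (hitv (a + L *+ j) L) (hitv (a + L *+ k) L) F.
Proof.
move=> L0 n0 BF B.
have Ln : 0 < L *+ n by rewrite pmulrn_lgt0.
have [mB fB] : measurable B /\ (lam B < +oo)%E by split; [exact: measurable_hitv|exact: lam_hitv_fin].
have mH (k : nat) : measurable (hitv (a + L *+ k) L) by exact: measurable_hitv.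
have fH (k : nat) : (lam (hitv (a + L *+ k) L) < +oo)%E by exact: lam_hitv_fin.
rewrite /int3 (grid_integral _ _ L0 (bmeas_int2 mB fB mB fB BF)).
apply: eq_bigr => i _.
have mJ := mH i; have fJ := fH i.
have sumI (m : nat) (D : set RT) (G : 'I_m -> RT -> R) : measurable D -> (lam D < +oo)%E ->
    (forall k, bmeas (G k)) ->
    \int[lam]_(x in D) (\sum_(k < m) G k x) = \sum_(k < m) \int[lam]_(x in D) G k x /\
    bmeas (fun x => \sum_(k < m) G k x).
  move=> mD fD; elim: m G => [|m IH] G BG.
    split; first by rewrite big_ord0; under eq_Rintegral do rewrite big_ord0; rewrite Rintegral_cst // mul0r.
    by under eq_fun do rewrite big_ord0; exact: bmeas_cst.
  have [e1 b1] := IH (fun k => G (widen_ord (leqnSn m) k)) (fun k => BG _).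
  split; last by under eq_fun do rewrite big_ord_recr; exact: bmeasD.
  rewrite big_ord_recr /= -e1 -(bintD mD fD b1 (BG ord_max)).
  by apply: eq_Rintegral => x _; rewrite big_ord_recr.
transitivity (\int[lam]_(x in hitv (a + L *+ i) L) \sum_(j < n)
    \int[lam]_(y in hitv (a + L *+ j) L) \int[lam]_(z in B) F (x, y, z)).
  by apply: eq_Rintegral => x _; exact: (grid_integral _ _ L0 (bmeas_int1' mB fB x BF)).
rewrite (sumI _ _ _ mJ fJ _).1; last first.
  by move=> j; exact: (bmeas_int2 (mH j) (fH j) mB fB BF).
apply: eq_bigr => j _.
have mK := mH j; have fK := fH j.
transitivity (\int[lam]_(x in hitv (a + L *+ i) L) \sum_(k < n)
    \int[lam]_(y in hitv (a + L *+ j) L) \int[lam]_(z in hitv (a + L *+ k) L) F (x, y, z)).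
  apply: eq_Rintegral => x _; rewrite -(sumI _ _ _ mK fK _).1; last first.
    by move=> k; exact: (bmeas_int1' (mH k) (fH k) x BF).
  by apply: eq_Rintegral => y _; exact: (grid_integral _ _ L0 (bmeas_slice3 x y BF)).
rewrite (sumI _ _ _ mJ fJ _).1 //.
by move=> k; exact: (bmeas_int2 mK fK (mH k) (fH k) BF).
Qed.

End cube_poincare_inequality.

(** * Compactly supported functions *)

Section compactly_supported.
Variable R : realType.
Local Notation lam := (@lebesgue_measure R).
Local Notation RT := (measurableTypeR R).
Implicit Types (Om : set (E3 R)) (f g : E3 R -> R).

(** Recording bounds and vanishing outside of [Om], rather than a compact support,
    gives a class that is visibly stable under products and differences. The
    derivatives are required to vanish outside of [Om] separately: this does not follow
    at a boundary point that is not a limit of exterior points. *)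
Record C1c Om f : Prop := C1C {
  c1_cont : continuous f;
  c1_der : forall i x, derivable f x (evec i);
  c1_pcont : forall i, continuous (partial i f);
  c1_out : forall x, ~ Om x -> f x = 0;
  c1_pout : forall i x, ~ Om x -> partial i f x = 0;
  c1_bnd : exists C, forall x, `|f x| <= C;
  c1_pbnd : forall i, exists C, forall x, `|partial i f x| <= C }.

Arguments c1_cont [Om f] _ _.
Arguments c1_der [Om f] _ _ _.
Arguments c1_pcont [Om f] _ _ _.

Lemma compact_support_bounded f (K : set (E3 R)) : continuous f -> compact K ->
  (forall x, ~ K x -> f x = 0) -> exists C, forall x, `|f x| <= C.
Proof.
move=> cf cK f0.
have : compact (f @` K).
  by apply: continuous_compact => //; exact: continuous_subspaceT.
move=> /compact_bounded [M [_ hM]].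
exists (`|M| + 1) => x; have [Kx|Kx] := pselect (K x); last first.
  by rewrite f0 // normr0 addr_ge0.
apply: (hM (`|M| + 1)); last by exists x.
by rewrite (le_lt_trans (ler_norm M)) // ltrDl.
Qed.

Lemma test_fun_C1c Om f : test_fun Om f -> C1c Om f.
Proof.
move=> [sf cS SOm].
have f0 x : ~ closure [set x | f x != 0] x -> f x = 0.
  move=> nx; apply/eqP/negPn/negP => fx; apply: nx; exact: subset_closure.
have p0 i x : ~ closure [set x | f x != 0] x -> partial i f x = 0.
  move=> nx; rewrite /partial -(derive_cst (0 : R) x (evec i)).
  apply: near_eq_derive.
  have : nbhs x (~` closure [set x | f x != 0]).
    by apply: open_nbhs_nbhs; split => //; apply: closed_openC; exact: closed_closure.
  by apply: filterS => y; exact: f0.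
have [c1 h1] := sf 1%N.
have pc i : continuous (partial i f) by have [] := h1 i.
split => //.
- by move=> i x; have [] := h1 i.
- by move=> x nx; apply: f0 => /SOm.
- by move=> i x nx; apply: p0 => /SOm.
- exact: compact_support_bounded cS f0.
- by move=> i; apply: compact_support_bounded (p0 i).
Qed.

Lemma partialM i f g x : derivable f x (evec i) -> derivable g x (evec i) ->
  partial i (fun x => f x * g x) x = f x * partial i g x + g x * partial i f x.
Proof. by move=> df dg; rewrite /partial -[LHS]/('D_(evec i) (f * g) x) deriveM. Qed.

Lemma partialB i f g x : derivable f x (evec i) -> derivable g x (evec i) ->
  partial i (fun x => f x - g x) x = partial i f x - partial i g x.
Proof. by move=> df dg; rewrite /partial -[LHS]/('D_(evec i) (f - g) x) deriveB. Qed.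

Lemma partialZ i f c x : derivable f x (evec i) ->
  partial i (fun x => c * f x) x = c * partial i f x.
Proof. by move=> df; rewrite /partial -[LHS]/('D_(evec i) (c \*: f) x) deriveZ. Qed.

Lemma C1cM Om f g : C1c Om f -> C1c Om g -> C1c Om (fun x => f x * g x).
Proof.
move=> [f1 f2 f3 f4 f5 [Cf f6] f7] [g1 g2 g3 g4 g5 [Cg g6] g7].
have pE i : partial i (fun x => f x * g x) =
    (fun x => f x * partial i g x + g x * partial i f x).
  by apply/funext => x; exact: partialM.
split.
- by move=> x; apply: cvgM; [exact: f1|exact: g1].
- by move=> i x; exact: (derivableM (f2 i x) (g2 i x)).
- move=> i; rewrite pE => x; apply: cvgD; apply: cvgM.
  + exact: f1.
  + exact: g3.
  + exact: g1.
  + exact: f3.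
- by move=> x nx; rewrite f4 // mul0r.
- by move=> i x nx; rewrite pE f4 // g4 // !mul0r addr0.
- by exists (Cf * Cg) => x; rewrite normrM ler_pM.
- move=> i; have [Df f8] := f7 i; have [Dg g8] := g7 i.
  exists (Cf * Dg + Cg * Df) => x; rewrite pE.
  by apply: le_trans (ler_normD _ _) _; rewrite !normrM lerD // ler_pM.
Qed.

Lemma C1cB Om f g : C1c Om f -> C1c Om g -> C1c Om (fun x => f x - g x).
Proof.
move=> [f1 f2 f3 f4 f5 [Cf f6] f7] [g1 g2 g3 g4 g5 [Cg g6] g7].
have pE i : partial i (fun x => f x - g x) = (fun x => partial i f x - partial i g x).
  by apply/funext => x; exact: partialB.
split.
- by move=> x; apply: cvgB; [exact: f1|exact: g1].
- by move=> i x; exact: (derivableB (f2 i x) (g2 i x)).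
- by move=> i; rewrite pE => x; apply: cvgB; [exact: f3|exact: g3].
- by move=> x nx; rewrite f4 // g4 // subr0.
- by move=> i x nx; rewrite pE f5 // g5 // subr0.
- by exists (Cf + Cg) => x; apply: le_trans (ler_normB _ _) _; exact: lerD.
- move=> i; have [Df f8] := f7 i; have [Dg g8] := g7 i.
  by exists (Df + Dg) => x; rewrite pE; apply: le_trans (ler_normB _ _) _; exact: lerD.
Qed.

Lemma C1c_bmeas Om f : C1c Om f -> bmeas (f : VT R -> R).
Proof. by move=> H; split; [exact: continuous_measurable_vol (c1_cont H)|exact: c1_bnd H]. Qed.

Lemma C1c_pbmeas Om f i : C1c Om f -> bmeas (partial i f : VT R -> R).
Proof. by move=> H; split; [exact: (@continuous_measurable_vol R setT _ (c1_pcont H i))|exact: (c1_pbnd H)]. Qed.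

Lemma ftc_segment (g gam : R -> R) s t : (forall x, derivable g x 1) ->
  (forall x, 'D_1 g x = gam x) -> continuous gam -> s <= t ->
  g t - g s = \int[lam]_(x in `[s, t]) gam x.
Proof.
move=> dg gE cg; rewrite le_eqVlt => /predU1P[->|st].
  by rewrite subrr set_itv1 Rintegral_set1.
have cgc : continuous g.
  by move=> x; apply/differentiable_continuous/derivable1_diffP; exact: dg.
rewrite /Rintegral (@continuous_FTC2 _ _ g) //.
- exact: continuous_subspaceT.
- split => //; [exact/cvg_at_right_filter/cgc|exact/cvg_at_left_filter/cgc].
- by move=> x _; rewrite derive1E.
Qed.

(** A derivative along a line is the directional derivative. *)
Lemma slice_derive f (e : R -> E3 R) x v :
  (forall h : R, e (h *: 1 + x) = h *: v + e x) -> derivable f (e x) v ->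
  derivable (fun t => f (e t)) x 1 /\ 'D_1 (fun t => f (e t)) x = 'D_v f (e x).
Proof.
move=> eE df.
have E : (fun h : R => h^-1 *: (((fun t => f (e t)) \o shift x) (h *: 1) - f (e x))) =
    (fun h : R => h^-1 *: ((f \o shift (e x)) (h *: v) - f (e x))).
  by apply/funext => h /=; rewrite eE.
by split; [rewrite /derivable E|rewrite /derive E].
Qed.

Definition o0 : 'I_3 := @Ordinal 3 0 isT.
Definition o1 : 'I_3 := @Ordinal 3 1 isT.
Definition o2 : 'I_3 := @Ordinal 3 2 isT.

Lemma C1c_slices Om f : C1c Om f ->
  slices f (partial o0 f) (partial o1 f) (partial o2 f).
Proof.
move=> H.
have E0 (h x y z : R) : (h *: (1 : R) + x, y, z) = h *: evec o0 + (x, y, z) :> E3 R.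
  by congr (_, _, _); rewrite /= ?scaler0 ?add0r.
have E1 (h x y z : R) : (x, h *: (1 : R) + y, z) = h *: evec o1 + (x, y, z) :> E3 R.
  by congr (_, _, _); rewrite /= ?scaler0 ?add0r.
have E2 (h x y z : R) : (x, y, h *: (1 : R) + z) = h *: evec o2 + (x, y, z) :> E3 R.
  by congr (_, _, _); rewrite /= ?scaler0 ?add0r.
split=> s t y z st.
- apply: (@ftc_segment (fun x : R => f (x, y, z)) (fun x => partial o0 f (x, y, z))) => //.
  + by move=> x; have [] := slice_derive (e := fun x => (x, y, z)) (fun h => E0 h _ _ _) (c1_der H o0 (x, y, z)).
  + by move=> x; have [] := slice_derive (e := fun x => (x, y, z)) (fun h => E0 h _ _ _) (c1_der H o0 (x, y, z)).
  + move=> x; apply: (continuous_comp (f := fun x => (x, y, z))); last exact: (c1_pcont H).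
    exact: (cvg_pair (cvg_pair cvg_id (cvg_cst y)) (cvg_cst z)).
- apply: (@ftc_segment (fun x : R => f (y, x, z)) (fun x => partial o1 f (y, x, z))) => //.
  + by move=> x; have [] := slice_derive (e := fun x => (y, x, z)) (fun h => E1 h _ _ _) (c1_der H o1 (y, x, z)).
  + by move=> x; have [] := slice_derive (e := fun x => (y, x, z)) (fun h => E1 h _ _ _) (c1_der H o1 (y, x, z)).
  + move=> x; apply: (continuous_comp (f := fun x => (y, x, z))); last exact: (c1_pcont H).
    exact: (cvg_pair (cvg_pair (cvg_cst y) cvg_id) (cvg_cst z)).
- apply: (@ftc_segment (fun x : R => f (y, z, x)) (fun x => partial o2 f (y, z, x))) => //.
  + by move=> x; have [] := slice_derive (e := fun x => (y, z, x)) (fun h => E2 h _ _ _) (c1_der H o2 (y, z, x)).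
  + by move=> x; have [] := slice_derive (e := fun x => (y, z, x)) (fun h => E2 h _ _ _) (c1_der H o2 (y, z, x)).
  + move=> x; apply: (continuous_comp (f := fun x => (y, z, x))); last exact: (c1_pcont H).
    exact: (cvg_pair (cvg_pair (cvg_cst y) (cvg_cst z)) cvg_id).
Qed.

End compactly_supported.

(** * Integrals over the volume *)

Section volume_integral.
Variable R : realType.
Local Notation lam := (@lebesgue_measure R).
Local Notation RT := (measurableTypeR R).

Lemma product_sigma_finite : sigma_finite setT (lam \x lam)%E.
Proof.
have /sigma_finiteP[F [TF ndF Foo]] := sigma_finiteT lam.
exists (fun n => F n `*` F n).
  rewrite -setXTT TF predeqE => -[x y]; split.
    move=> [/= [n _ Fnx] [k _ Gky]]; exists (maxn n k) => //; split.
      by move: x Fnx; exact/subsetPset/ndF/leq_maxl.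
    by move: y Gky; exact/subsetPset/ndF/leq_maxr.
  by move=> [n _ []/= ? ?]; split; exists n.
move=> k; have [? ?] := Foo k.
split; first exact: measurableX.
by rewrite product_measure1E// lte_mul_pinfty// ge0_fin_numE.
Qed.
Definition lam2 : {sigma_finite_measure set (RT * RT)%type -> \bar R} :=
  HB.pack_for (SigmaFiniteMeasure.type (RT * RT)%type R) (lam \x lam)%E (Measure_isSigmaFinite.Build _ _ _ (lam \x lam)%E product_sigma_finite).

Lemma tonelli_support d (T : measurableType d) (mu : {sigma_finite_measure set T -> \bar R})
    (B : set RT) (F : T * RT -> R) :
  measurable B -> (lam B < +oo)%E -> bmeas F -> (forall p, 0 <= F p) ->
  (forall p z, ~ B z -> F (p, z) = 0) ->
  (\int[mu \x lam]_p (F p)%:E = \int[mu]_x (\int[lam]_(z in B) F (x, z))%:E)%E.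
Proof.
move=> mB fB BF F0 FB.
have mF : measurable_fun setT (fun p => (F p)%:E) by apply/measurable_EFinP; case: BF.
have F0' p : (0 <= (F p)%:E)%E by rewrite lee_fin.
rewrite (fubini_tonelli1 _ mF F0').
apply: eq_integral => x _; rewrite /fubini_F.
have Bx : bmeas (fun z : RT => F (x, z)) by apply: bmeas_comp BF.
rewrite /Rintegral fineK; last exact/integrable_fin_num/bmeas_integrable.
rewrite [RHS]integral_mkcond; apply: eq_integral => z _.
by rewrite patchE; case: ifPn => //; rewrite notin_setE => zB; rewrite FB.
Qed.

Definition in_box (B : set RT) (p : VT R) := [/\ B p.1.1, B p.1.2 & B p.2].

Section box.
Variable B : set RT.
Hypotheses (mB : measurable B) (fB : (lam B < +oo)%E).

Lemma vol_int3_ge0 (F : VT R -> R) : bmeas F -> (forall p, 0 <= F p) ->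
  (forall p, ~ in_box B p -> F p = 0) ->
  (\int[vol]_p (F p)%:E = (int3 B B B F)%:E)%E.
Proof.
move=> BF F0 FB.
pose G (p : RT * RT) := \int[lam]_(z in B) F (p, z).
pose H (x : RT) := \int[lam]_(y in B) G (x, y).
have BG : bmeas G by exact: bmeas_int1.
have BH : bmeas H by exact: bmeas_int2.
have G0 p : 0 <= G p by apply: Rintegral_ge0.
have zero (g : RT -> R) : (forall z, g z = 0) -> \int[lam]_(z in B) g z = 0.
  by move=> g0; under eq_Rintegral do rewrite g0; rewrite Rintegral_cst // mul0r.
have z1 (p : RT * RT) z : ~ B z -> F (p, z) = 0 by move=> Bz; apply: FB => -[].
have e1 := @tonelli_support _ _ lam2 B F mB fB BF F0 z1.
have z2 x y : ~ B y -> G (x, y) = 0.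
  by move=> By; rewrite /G; apply: zero => z; apply: FB => -[].
have z3 x y : ~ B x -> G (x, y) = 0.
  by move=> Bx; rewrite /G; apply: zero => z; apply: FB => -[].
have e2 := @tonelli_support _ _ lam B G mB fB BG G0 z2.
apply: (eq_trans e1); apply: (eq_trans e2).
rewrite -[in RHS]/(\int[lam]_(x in B) H x) /Rintegral fineK; last first.
  exact/integrable_fin_num/bmeas_integrable.
rewrite [RHS]integral_mkcond; apply: eq_integral => x _.
rewrite patchE; case: ifPn => //; rewrite notin_setE => Bx.
congr EFin; apply: zero => y; exact: z3.
Qed.

Lemma vol_integrable_box (F : VT R -> R) : bmeas F -> (forall p, 0 <= F p) ->
  (forall p, ~ in_box B p -> F p = 0) -> vol.-integrable setT (EFin \o F).
Proof.
move=> BF F0 FB; apply/integrableP; split; first by apply/measurable_EFinP; case: BF.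
under eq_integral do rewrite /= ger0_norm //.
by rewrite vol_int3_ge0 // ltry.
Qed.

(** The theorem of Tonelli gives the result for nonnegative functions; the multiple [I]
    of the indicator function of the box is added to reduce to these. *)
Lemma vol_int3 (F : VT R -> R) : bmeas F -> (forall p, ~ in_box B p -> F p = 0) ->
  vol.-integrable setT (EFin \o F) /\ \int[vol]_p F p = int3 B B B F.
Proof.
move=> BF FB.
have [_ [C FC]] := BF.
pose I (p : VT R) : R := C * (\1_B p.1.1 * \1_B p.1.2 * \1_B p.2).
have C0 : 0 <= C by apply: le_trans (FC point); exact: normr_ge0.
have mi := @measurable_indic _ RT R setT _ mB.
have BI : bmeas I.
  split.
    apply: measurable_funM => //; apply: measurable_funM; last exact: (measurableT_comp mi measurable_snd).
    apply: measurable_funM.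
      exact: (measurableT_comp mi (measurableT_comp measurable_fst measurable_fst)).
    exact: (measurableT_comp mi (measurableT_comp measurable_snd measurable_fst)).
  exists C => p; rewrite /I !indicE normrM (ger0_norm C0) -[leRHS]mulr1.
  by apply: ler_wpM2l => //; do 3 case: (_ \in _); rewrite !(mul0r,mulr0,mul1r) ?normr1 ?normr0 //.
have I0 p : 0 <= I p by rewrite /I !mulr_ge0.
have IB p : ~ in_box B p -> I p = 0.
  move=> nb; rewrite /I !indicE.
  have [h1|_] := boolP (p.1.1 \in B); last by rewrite !(mul0r,mulr0).
  have [h2|_] := boolP (p.1.2 \in B); last by rewrite !(mul0r,mulr0).
  have [h3|_] := boolP (p.2 \in B); last by rewrite !(mul0r,mulr0).
  by case: nb; split; exact/set_mem.
have BFI : bmeas (fun p => F p + I p) by exact: bmeasD.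
have FI0 p : 0 <= F p + I p.
  have [pb|pb] := pselect (in_box B p); last by rewrite FB // add0r.
  have -> : I p = C.
    by case: pb => b1 b2 b3; rewrite /I !indicE !mem_set // !mulr1.
  by rewrite -lerBlDr sub0r; have := FC p; rewrite ler_norml => /andP[].
clearbody I.
have FIB p : ~ in_box B p -> F p + I p = 0 by move=> nb; rewrite FB // IB // addr0.
have i1 := vol_integrable_box BFI FI0 FIB.
have i2 := vol_integrable_box BI I0 IB.
have FE : F = (fun p => (F p + I p) - I p) by apply/funext => p; rewrite addrK.
split.
  have := integrableB measurableT i1 i2; apply: eq_integrable => //.
  by move=> p _ /=; rewrite -EFinD addrK.
have e1 : \int[vol]_p (F p + I p) = int3 B B B (fun p => F p + I p).
  exact: (congr1 fine (vol_int3_ge0 BFI FI0 FIB)).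
have e2 : \int[vol]_p I p = int3 B B B I.
  exact: (congr1 fine (vol_int3_ge0 BI I0 IB)).
have e3 : \int[vol]_p F p = \int[vol]_p ((F p + I p) - I p) by rewrite {1}FE.
have e4 := RintegralB measurableT i1 i2.
apply: (eq_trans e3); apply: (eq_trans e4).
apply: (eq_trans (f_equal2 (fun a b : R => a - b) e1 e2)).
have e5 := int3D mB fB mB fB mB fB BF BI.
apply: (eq_trans (congr1 (fun a : R => a - int3 B B B I) e5)).
by move: (int3 B B B F) (int3 B B B I) => a b; rewrite addrK.
Qed.

End box.

End volume_integral.

(** * Integration by parts, and a grid inequality *)

Section domain.
Variable R : realType.
Local Notation lam := (@lebesgue_measure R).
Local Notation RT := (measurableTypeR R).
Variable Om : set (E3 R).
Hypotheses (oOm : open Om) (bOm : bounded_set Om).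

#[local] Opaque int3.

Lemma bounded_coord : exists2 M : R, 0 < M &
  forall p, Om p -> [/\ - M < p.1.1 < M, - M < p.1.2 < M & - M < p.2 < M].
Proof.
have [M0 [_ hM]] := bOm.
pose M := `|M0| + 1.
have M0M : M0 < M by rewrite /M (le_lt_trans (ler_norm M0)) // ltrDl.
have Mp : 0 < M by rewrite ltr_wpDl.
exists (M + 1); first by rewrite addr_gt0.
move=> p Op; have /= := hM M M0M p Op.
rewrite prod_normE /= ge_max => /andP[+ h3].
rewrite prod_normE /= ge_max => /andP[h1 h2].
have MM : M < M + 1 by rewrite ltrDl.
by split; rewrite -ltr_norml; apply: le_lt_trans MM.
Qed.

Let mOm : measurable (Om : set (VT R)) := open_measurable_vol oOm.

Lemma sum_ord3_exchange (I : finType) (P : 'I_3 -> R) (c : 'I_3 -> I -> R) :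
  (forall i, P i = \sum_q c i q) ->
  \sum_i P i = \sum_q (c o0 q + c o1 q + c o2 q).
Proof.
move=> Pc; rewrite (eq_bigr _ (fun i _ => Pc i)) exchange_big; apply: eq_bigr => q _.
rewrite !big_ord_recl big_ord0 /= addr0 addrA.
by congr (_ + _ + _); congr (c _ _); exact: val_inj.
Qed.

Section in_a_box.
Variable M : R.
Hypothesis M0 : 0 < M.
Hypothesis OmM : forall p, Om p -> [/\ - M < p.1.1 < M, - M < p.1.2 < M & - M < p.2 < M].
Let B : set RT := hitv (- M) (M + M).

Let MM0 : 0 < M + M. Proof. exact: addr_gt0. Qed.
Let mB : measurable B. Proof. exact: measurable_hitv. Qed.
Let fB : (lam B < +oo)%E. Proof. exact: lam_hitv_fin. Qed.

Let Om_box p : Om p -> in_box B p.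
Proof.
move=> /OmM[/andP[a1 b1] /andP[a2 b2] /andP[a3 b3]].
by split; rewrite /B /hitv /= in_itv /= addrA addNr add0r ltW.
Qed.

Lemma Om_int3 (F : VT R -> R) : bmeas F -> (forall p, ~ Om p -> F p = 0) ->
  vol.-integrable Om (EFin \o F) /\ \int[vol]_(p in Om) F p = int3 B B B F.
Proof.
move=> BF F0.
have FB p : ~ in_box B p -> F p = 0 by move=> nb; apply: F0 => /Om_box.
have [i1 i2] := vol_int3 mB fB BF FB; split.
  exact: (integrableS measurableT mOm (@subsetT _ _) i1).
rewrite -i2 Rintegral_mkcond; congr Rintegral; apply/funext => p.
by rewrite patchE; case: ifPn => //; rewrite notin_setE => /F0.
Qed.

Lemma bmeas_ftc_itv (g gam : RT -> R) : bmeas gam ->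
  (forall s t, s <= t -> g t - g s = \int[lam]_(x in `[s, t]) gam x) ->
  g M = 0 -> g (- M) = 0 -> \int[lam]_(x in B) gam x = 0.
Proof.
move=> Bg ftc g1 g2.
have -> : B = [set` `[- M, M[] by rewrite /B /hitv addrA addNr add0r.
have MM : - M <= M by apply: le_trans (ltW M0); rewrite oppr_le0 ltW.
have iM : lam.-integrable [set` `[- M, M[] (EFin \o gam).
  have mI : measurable ([set` `[- M, M[] : set RT) by exact: measurable_itv.
  apply: bmeas_integrable => //.
  have := @lebesgue_measure_itv R `[- M, M[; rewrite /= => ->.
  by case: ifP => // _; rewrite -EFinB ltry.
by rewrite (Rintegral_itv_bndo_bndc iM) -(ftc _ _ MM) g1 g2 subrr.
Qed.

(** Integrating first in the [j]-th variable leaves the difference of two values of [f]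
    on the boundary of a box that contains [Om]. *)
Lemma partial_integral_eq0 f j : C1c Om f -> \int[vol]_(p in Om) partial j f p = 0.
Proof.
move=> H.
have [s0 s1 s2] := C1c_slices H.
have Bp i := C1c_pbmeas i H.
have fM p : (p.1.1 = M \/ p.1.1 = - M) \/ (p.1.2 = M \/ p.1.2 = - M) \/ (p.2 = M \/ p.2 = - M) -> f p = 0.
  move=> hp; apply: (c1_out H) => /OmM.
  by move=> [/andP[a1 b1] /andP[a2 b2] /andP[a3 b3]];
     case: hp => [[] h|[[] h|[] h]]; move: a1 b1 a2 b2 a3 b3; rewrite h ltxx.
rewrite (Om_int3 (Bp j) (c1_pout H j)).2.
have int0 (g : RT -> R) : (forall x, g x = 0) -> \int[lam]_(x in B) g x = 0.
  move=> g0; transitivity (\int[lam]_(x in B) (cst 0 x : R)).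
    by apply: eq_Rintegral => x _; exact: g0.
  by rewrite Rintegral_cst // mul0r.
have sl3 x y : bmeas (fun z : RT => partial o2 f (x, y, z)) by apply: bmeas_slice3.
have sl2 x z : bmeas (fun y : RT => partial o1 f (x, y, z)).
  apply: (bmeas_comp _ (Bp o1)); apply: measurable_fun_pair => //; exact: measurable_fun_pair.
have sl1 y z : bmeas (fun x : RT => partial o0 f (x, y, z)).
  apply: (bmeas_comp _ (Bp o0)); apply: measurable_fun_pair => //; exact: measurable_fun_pair.
case: j => [[|[|[|//]]] p].
- rewrite (_ : Ordinal p = o0); last exact: val_inj.
  rewrite (int3_swap1 mB fB mB fB mB fB (Bp o0)).
  apply: (int0 _) => y; apply: (int0 _) => z.
  apply: (bmeas_ftc_itv (g := fun x => f (x, y, z)) (sl1 y z)) => [s t|//|//].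
  + exact: s0.
  + by apply: fM; left; left.
  + by apply: fM; left; right.
- rewrite (_ : Ordinal p = o1); last exact: val_inj.
  rewrite (int3_swap23 B mB fB mB fB (Bp o1)).
  apply: (int0 _) => x; apply: (int0 _) => z.
  apply: (bmeas_ftc_itv (g := fun y => f (x, y, z)) (sl2 x z)) => [s t|//|//].
  + exact: s1.
  + by apply: fM; right; left; left.
  + by apply: fM; right; left; right.
- rewrite (_ : Ordinal p = o2); last exact: val_inj.
  apply: (int0 _) => x; apply: (int0 _) => y.
  apply: (bmeas_ftc_itv (g := fun z => f (x, y, z)) (sl3 x y)) => [s t|//|//].
  + exact: s2.
  + by apply: fM; right; right; left.
  + by apply: fM; right; right; right.
Qed.

Definition cell (n : nat) (q : 'I_n * 'I_n * 'I_n) (f : E3 R -> R) : R :=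
  let J (i : 'I_n) := hitv (- M + (M + M) / n%:R *+ i) ((M + M) / n%:R) in
  int3 (J q.1.1) (J q.1.2) (J q.2) f.

(** The inequality of Poincare is summed over the cells of a grid that covers [Om]. *)
Lemma cell_poincare n f : (0 < n)%N -> C1c Om f ->
  \int[vol]_(p in Om) (f p ^+ 2) <=
    ((M + M) / n%:R) ^- 3 * \sum_q (cell (n := n) q f) ^+ 2 +
    ((M + M) / n%:R) ^+ 2 * \sum_i \int[vol]_(p in Om) (partial i f p ^+ 2).
Proof.
move=> n0 H; set L := (M + M) / n%:R.
have L0 : 0 < L by rewrite divr_gt0 // ltr0n.
have nL : L *+ n = M + M by rewrite -mulr_natr divfK // pnatr_eq0 -lt0n.
have Bf := C1c_bmeas H; have Bp i := C1c_pbmeas i H.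
have Bf2 := bmeas_sqr Bf; have Bp2 i := bmeas_sqr (Bp i).
have e1 : \int[vol]_(p in Om) (f p ^+ 2) = int3 B B B (fun p => f p ^+ 2).
  by apply: (Om_int3 Bf2 _).2 => p np; rewrite (c1_out H np) expr0n.
have e2 i : \int[vol]_(p in Om) (partial i f p ^+ 2) =
    int3 B B B (fun p => partial i f p ^+ 2).
  by apply: (Om_int3 (Bp2 i) _).2 => p np; rewrite (c1_pout H i np) expr0n.
have grid F : bmeas F -> int3 B B B F =
    \sum_(q : 'I_n * 'I_n * 'I_n) cell q F.
  move=> BF; rewrite /B -nL (grid_int3 _ L0 n0 BF) pair_big /= pair_big /=.
  apply: eq_bigr => q _; rewrite /cell -/L; reflexivity.
have eg i := eq_trans (e2 i) (grid _ (Bp2 i)).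
rewrite (sum_ord3_exchange eg).
rewrite e1 (grid _ Bf2) !mulr_sumr -big_split /=.
apply: ler_sum => q _.
exact: (cube_poincare (- M + L *+ q.1.1) (- M + L *+ q.1.2) (- M + L *+ q.2)
  L0 Bf (Bp o0) (Bp o1) (Bp o2) (C1c_slices H)).
Qed.

End in_a_box.

Lemma bmeas_L2s (F : VT R -> R) : bmeas F -> (forall p, ~ Om p -> F p = 0) -> L2s Om F.
Proof.
move=> BF F0; have [M M0 OmM] := bounded_coord.
apply: L2sI; first by apply: measurable_funTS; case: BF.
have F20 p : ~ Om p -> F p ^+ 2 = 0 by move=> /F0 ->; rewrite expr0n.
exact: (Om_int3 M0 OmM (bmeas_sqr BF) F20).1.
Qed.

Lemma C1c_L2s f : C1c Om f -> L2s Om f.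
Proof. by move=> H; apply: bmeas_L2s; [exact: C1c_bmeas H|exact: c1_out H]. Qed.

Lemma C1c_pL2s i f : C1c Om f -> L2s Om (partial i f).
Proof. by move=> H; apply: bmeas_L2s; [exact: C1c_pbmeas H|exact: (c1_pout H i)]. Qed.

(** The integral of the [j]-th derivative of [f * phi] is zero. *)
Lemma C1c_weak_partial f j : C1c Om f -> weak_partial Om j f (partial j f).
Proof.
move=> H; split; [exact: C1c_L2s|exact: C1c_pL2s|move=> phi /test_fun_C1c Hp].
have [M M0 OmM] := bounded_coord.
have i1 : vol.-integrable Om (EFin \o (fun x => f x * partial j phi x)).
  by apply: L2s_integrableM; [exact: mOm|exact: C1c_L2s|exact: C1c_pL2s].
have i2 : vol.-integrable Om (EFin \o (fun x => partial j f x * phi x)).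
  by apply: L2s_integrableM; [exact: mOm|exact: C1c_pL2s|exact: C1c_L2s].
apply/eqP; rewrite -addr_eq0 -RintegralD //; apply/eqP.
rewrite -[RHS](partial_integral_eq0 M0 OmM j (C1cM H Hp)).
apply: eq_Rintegral => x _; rewrite partialM; first by rewrite (mulrC (phi x)).
- exact: c1_der H _ _.
- exact: c1_der Hp _ _.
Qed.

End domain.

(** * Finite nets from finitely many functionals *)

(** Rounding the values of the finitely many functionals to multiples of [d] takes
    finitely many values; the net consists of one element of [S] for each value that
    is taken. *)
Lemma finite_net (R : realType) (T : Type) (S : set T) (K : finType) (l : K -> T -> R) (C d : R) :
  0 < d -> (forall s k, S s -> `|l k s| <= C) ->
  exists (I : finType) (w : I -> T), (forall i, S (w i)) /\
    forall s, S s -> exists i, forall k, `|l k s - l k (w i)| <= d.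
Proof.
move=> d0 lC; have [[s0 Ss0]|S0] := pselect (S !=set0); last first.
  exists void, (fun v : void => match v with end); split => [[]|s Ss].
  by exfalso; apply: S0; exists s.
pose N := Num.truncn ((C + C) / d).
pose c (s : T) : {ffun K -> 'I_N.+1} := [ffun k => inord (Num.truncn ((l k s + C) / d))].
have cE s k : S s ->
    (c s k : nat)%:R <= (l k s + C) / d < (c s k : nat).+1%:R.
  move=> Ss; set x := (l k s + C) / d; have /andP[x0 xC] : 0 <= l k s + C <= C + C.
    by have := lC s k Ss; rewrite ler_norml => /andP[]; rewrite lerD2r -lerBlDr sub0r => -> ->.
  have tx : (Num.truncn x <= N)%N by apply: le_truncn; rewrite ler_pM2r // invr_gt0.
  by rewrite ffunE inordK ?ltnS // truncn_itv // divr_ge0 // ltW.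
have /choice [w wP] i : exists x, S x /\ ((exists2 s, S s & c s = i) -> c x = i).
  have [[s Ss cs]|ns] := pselect (exists2 s, S s & c s = i); first by exists s.
  by exists s0.
exists {ffun K -> 'I_N.+1}, w; split=> [i|s Ss]; first by have [] := wP i.
exists (c s) => k; have [Sx /(_ (ex_intro2 _ _ s Ss erefl)) cx] := wP (c s).
set x := w (c s) in Sx cx *.
have := cE s k Ss; have := cE x k Sx; rewrite cx /= => /andP[h1 h2] /andP[h3 h4].
have : `|(l k s + C) / d - (l k x + C) / d| <= 1.
  rewrite -natr1 in h2 h4.
  by rewrite ler_norml; apply/andP; split; lra.
rewrite -mulrBl opprD addrACA subrr addr0 normrM [X in _ * X]ger0_norm ?invr_ge0 ?(ltW d0) //.
by rewrite ler_pdivrMr // mul1r.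
Qed.

Section rellich.
Variable R : realType.
Local Notation lam := (@lebesgue_measure R).
Local Notation RT := (measurableTypeR R).
Variable Om : set (E3 R).
Hypotheses (oOm : open Om) (bOm : bounded_set Om).

#[local] Opaque int3.

Let mOm : measurable (Om : set (VT R)) := open_measurable_vol oOm.

Section cells.
Variable M : R.
Hypothesis M0 : 0 < M.
Hypothesis OmM : forall p, Om p -> [/\ - M < p.1.1 < M, - M < p.1.2 < M & - M < p.2 < M].
Variable n : nat.
Hypothesis n0 : (0 < n)%N.
Let L := (M + M) / n%:R.
Let L0 : 0 < L. Proof. by rewrite divr_gt0 ?addr_gt0 // ltr0n. Qed.

Lemma cellB (q : 'I_n * 'I_n * 'I_n) f g : C1c Om f -> C1c Om g ->
  cell M q (fun x => f x - g x) = cell M q f - cell M q g.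
Proof.
move=> /C1c_bmeas Bf /C1c_bmeas Bg.
pose J (i : 'I_n) := hitv (- M + L *+ i) L.
have cE F : cell M q F = int3 (J q.1.1) (J q.1.2) (J q.2) F by [].
rewrite !cE.
have mJ i : measurable (J i) by exact: measurable_hitv.
have fJ i : (lam (J i) < +oo)%E by exact: lam_hitv_fin.
have := int3D (mJ q.1.1) (fJ q.1.1) (mJ q.1.2) (fJ q.1.2) (mJ q.2) (fJ q.2) Bf
  (bmeasZ (-1) Bg).
rewrite (int3Z (mJ q.1.1) (fJ q.1.1) (mJ q.1.2) (fJ q.1.2) (mJ q.2) (fJ q.2) _ Bg).
rewrite mulN1r => <-; congr int3; apply/funext => x; by rewrite mulN1r.
Qed.

(** Cauchy-Schwarz on the cell, in the form of the nonnegativity of the integral of the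
    square of [f - m], where [m] is the mean of [f] on it. *)
Lemma cell_le (q : 'I_n * 'I_n * 'I_n) f : C1c Om f ->
  cell M q f ^+ 2 <= L ^+ 3 * \int[vol]_(p in Om) (f p ^+ 2).
Proof.
move=> H; have Bf := C1c_bmeas H; have Bf2 := bmeas_sqr Bf.
have MM0 : 0 < M + M by exact: addr_gt0.
have nL : L *+ n = M + M by rewrite -mulr_natr divfK // pnatr_eq0 -lt0n.
have cell_ge0 F q' : (forall x, 0 <= F x) -> 0 <= cell M q' F.
  move=> F0; rewrite /cell.
  Transparent int3. rewrite /int3. Opaque int3.
  by do 3 apply: Rintegral_ge0 => ? _.
have e1 : cell M q (fun p => f p ^+ 2) <= \int[vol]_(p in Om) (f p ^+ 2).
  rewrite (Om_int3 oOm M0 OmM Bf2 _).2; last first.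
    by move=> p np; rewrite (c1_out H np) expr0n.
  have -> : int3 (hitv (- M) (M + M)) (hitv (- M) (M + M)) (hitv (- M) (M + M)) (fun p => f p ^+ 2) =
      \sum_(q : 'I_n * 'I_n * 'I_n) cell M q (fun p => f p ^+ 2).
    rewrite -nL (grid_int3 _ L0 n0 Bf2) pair_big /= pair_big /=.
    by apply: eq_bigr => q' _; rewrite /cell -/L; reflexivity.
  rewrite (bigD1 q) //= lerDl; apply: sumr_ge0 => q' _.
  by apply: cell_ge0 => x; exact: sqr_ge0.
apply: le_trans (ler_wpM2l _ e1); last by rewrite exprn_ge0 // ltW.
pose J (i : 'I_n) := hitv (- M + L *+ i) L.
have cE F : cell M q F = int3 (J q.1.1) (J q.1.2) (J q.2) F by [].
rewrite !cE; have mJ i : measurable (J i) by exact: measurable_hitv.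
have fJ i : (lam (J i) < +oo)%E by exact: lam_hitv_fin.
set J1 := J q.1.1; set J2 := J q.1.2; set J3 := J q.2.
have lin F G c : bmeas F -> bmeas G -> int3 J1 J2 J3 (fun p => F p + c * G p) =
    int3 J1 J2 J3 F + c * int3 J1 J2 J3 G.
  move=> BF BG.
  have := int3D (mJ q.1.1) (fJ q.1.1) (mJ q.1.2) (fJ q.1.2) (mJ q.2) (fJ q.2) BF (bmeasZ c BG).
  by rewrite (int3Z (mJ q.1.1) (fJ q.1.1) (mJ q.1.2) (fJ q.1.2) (mJ q.2) (fJ q.2) _ BG).
have cst3 c : int3 J1 J2 J3 (fun=> c) = c * L ^+ 3.
  Transparent int3. rewrite /int3. Opaque int3.
  have st (m : 'I_n) (k : R) : \int[lam]_(x in J m) (cst k x) = k * L.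
    by rewrite Rintegral_cst // fine_lam_hitv.
  transitivity (\int[lam]_(x in J1) (cst (c * L * L) x)).
    apply: eq_Rintegral => x _; transitivity (\int[lam]_(x in J2) (cst (c * L) x)).
      by apply: eq_Rintegral => y _; exact: st.
    exact: st.
  by rewrite st; ring.
set I := int3 J1 J2 J3 f; set m := I / L ^+ 3.
have L3 : 0 < L ^+ 3 by exact: exprn_gt0.
have : 0 <= int3 J1 J2 J3 (fun p => (f p ^+ 2 + (- 2 * m) * f p) + m ^+ 2 * 1).
  have -> : (fun p => (f p ^+ 2 + (- 2 * m) * f p) + m ^+ 2 * 1) = (fun p => (f p - m) ^+ 2).
    by apply/funext => p; ring.
  by rewrite -cE; apply: cell_ge0 => x; exact: sqr_ge0.
rewrite (lin (fun p => f p ^+ 2 + (- 2 * m) * f p) (fun=> 1)); last 2 first.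
- by apply: bmeasD => //; exact: bmeasZ.
- exact: bmeas_cst.
rewrite (lin _ _ _ Bf2 Bf) cst3 mul1r -/I; set Q := int3 _ _ _ _.
have -> : Q + -2 * m * I + m ^+ 2 * L ^+ 3 = Q - I ^+ 2 / L ^+ 3.
  by rewrite /m; field; rewrite gt_eqF.
by rewrite subr_ge0 (ler_pdivrMr _ _ L3) (mulrC Q).
Qed.

End cells.
End rellich.

(** * The spaces H and V *)

Section inner_wrappers.
Variable R : realType.
Variable Om : set (E3 R).
Hypothesis mOm : measurable (Om : set (VT R)).
Implicit Types u v w : vfield R.
Local Notation L2v := (L2v Om).
Local Notation inner := (inner Om).
Local Notation normH := (normH Om).

Let SI := inner_semi mOm.

Lemma L2vB u v : L2v u -> L2v v -> L2v (u - v).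
Proof. exact: (si_B SI). Qed.
Lemma L2vZ a u : L2v u -> L2v (scalev a u).
Proof. exact: (si_scale SI). Qed.
Lemma innerC u v : L2v u -> L2v v -> inner u v = inner v u.
Proof. exact: (si_sym SI). Qed.
Lemma inner_ge0 u : L2v u -> 0 <= inner u u.
Proof. exact: (si_ge0 SI). Qed.
Lemma innerBl u v w : L2v u -> L2v v -> L2v w -> inner (u - v) w = inner u w - inner v w.
Proof. exact: (si_Bl SI). Qed.
Lemma innerBr u v w : L2v u -> L2v v -> L2v w -> inner w (u - v) = inner w u - inner w v.
Proof. exact: (si_Br SI). Qed.
Lemma innerZr a u w : L2v u -> L2v w -> inner w (scalev a u) = a * inner w u.
Proof. exact: (si_Zr SI). Qed.
Lemma normH_ge0 u : 0 <= normH u.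
Proof. exact: sqrtr_ge0. Qed.
Lemma normH_sqr u : L2v u -> normH u ^+ 2 = inner u u.
Proof. exact: (si_normE SI). Qed.
Lemma inner_CS u v : L2v u -> L2v v -> `|inner u v| <= normH u * normH v.
Proof. exact: (si_CSn SI). Qed.
Lemma normH_triangle u v w : L2v u -> L2v v -> L2v w ->
  normH (u - w) <= normH (u - v) + normH (v - w).
Proof. exact: (si_triangleB SI). Qed.
Lemma normHC u v : L2v u -> L2v v -> normH (u - v) = normH (v - u).
Proof. exact: (si_normC SI). Qed.
Lemma normH_le u v : L2v u -> L2v v -> normH u <= normH v + normH (u - v).
Proof. exact: (si_norm_le SI). Qed.
Lemma normHZ a u : L2v u -> normH (scalev a u) = `|a| * normH u.
Proof. exact: (si_normZ SI). Qed.

Let ST := innerT_semi mOm.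

Definition normT (G : tfield R) := Num.sqrt (innerT Om G G).

Lemma innerT_ge0 G : 0 <= innerT Om G G.
Proof.
apply: Rintegral_ge0 => x _; apply: sumr_ge0 => i _; apply: sumr_ge0 => j _.
by rewrite -expr2 sqr_ge0.
Qed.
Lemma normT_ge0 G : 0 <= normT G.
Proof. exact: sqrtr_ge0. Qed.
Lemma normT_sqr G : normT G ^+ 2 = innerT Om G G.
Proof. by rewrite sqr_sqrtr // innerT_ge0. Qed.
Lemma innerT_CS G K : L2t Om G -> L2t Om K -> `|innerT Om G K| <= normT G * normT K.
Proof. exact: (si_CSn ST). Qed.
Lemma normTZ a G : L2t Om G -> normT (fun i j x => a * G i j x) = `|a| * normT G.
Proof. exact: (si_normZ ST). Qed.
Lemma L2tB G K : L2t Om G -> L2t Om K -> L2t Om (G - K).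
Proof. exact: (si_B ST). Qed.
Lemma normTB_le G K : L2t Om G -> L2t Om K -> normT (G - K) <= normT G + normT K.
Proof.
move=> LG LK; have /= := si_triangleB ST LG (si_scale ST 0 LG) LK.
rewrite scale0r subr0 => /le_trans; apply.
rewrite lerD2l sub0r -scaleN1r (si_normZ ST) // normrN normr1 mul1r.
by [].
Qed.

End inner_wrappers.

Section spaces.
Variable R : realType.
Variable Om : set (E3 R).
Hypotheses (oOm : open Om) (bOm : bounded_set Om).
Implicit Types u v w : vfield R.
Local Notation sol := (solenoidal Om).
Let mOm : measurable (Om : set (VT R)) := open_measurable_vol oOm.

Lemma solenoidal_C1c u i : sol u -> C1c Om (u i).
Proof. by move=> [tu _]; exact: test_fun_C1c. Qed.

Lemma solenoidal_L2v u : sol u -> L2v Om u.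
Proof. by move=> su i; apply: (C1c_L2s oOm bOm); exact: solenoidal_C1c. Qed.

Lemma solenoidal_L2t u : sol u -> L2t Om (cgrad u).
Proof. by move=> su i j; apply: (C1c_pL2s oOm bOm); exact: solenoidal_C1c. Qed.

Lemma inner0 u : inner Om (u - u) (u - u) = 0.
Proof.
rewrite /inner (_ : (fun _ => _) = cst 0).
  by rewrite Rintegral_cst // mul0r.
apply/funext => x; rewrite big1 // => i _.
by rewrite subrr mul0r.
Qed.

Lemma innerT0 (G : tfield R) : innerT Om (G - G) (G - G) = 0.
Proof.
rewrite /innerT (_ : (fun _ => _) = cst 0).
  by rewrite Rintegral_cst // mul0r.
apply/funext => x; rewrite big1 // => i _; rewrite big1 // => j _.
by rewrite subrr mul0r.
Qed.

Lemma solenoidal_Vgrad u : sol u -> Vgrad Om u (cgrad u).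
Proof.
move=> su; split=> [i j|e e0].
  by apply: (C1c_weak_partial oOm bOm); exact: solenoidal_C1c.
by exists u => //; rewrite inner0 innerT0 addr0 exprn_gt0.
Qed.

Lemma solenoidal_V u : sol u -> spaceV Om u.
Proof. by move=> su; exists (cgrad u); exact: solenoidal_Vgrad. Qed.

Lemma Vgrad_grad u : spaceV Om u -> Vgrad Om u (grad Om u).
Proof. by move=> [G VG]; rewrite /grad; case: xgetP => [K _ //|/(_ G)]. Qed.

Lemma Vgrad_L2v u G : Vgrad Om u G -> L2v Om u.
Proof. by move=> [wp _] i; have [] := wp i o0. Qed.

Lemma Vgrad_L2t u G : Vgrad Om u G -> L2t Om G.
Proof. by move=> [wp _] i j; have [] := wp i j. Qed.

(** Outside of [spaceV Om] the gradient is the zero field by definition. *)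
Lemma grad_L2t u : L2t Om (grad Om u).
Proof.
rewrite /grad; case: xgetP => [K _ VK|_]; first exact: Vgrad_L2t VK.
by move=> i j; apply: L2s_0.
Qed.

Lemma bilinA_ge0 u : 0 <= bilinA Om u u.
Proof. exact: innerT_ge0. Qed.

Lemma spaceV_H u : spaceV Om u -> spaceH Om u.
Proof.
move=> [G VG]; have Lu := Vgrad_L2v VG; split => // e e0.
have [phi sphi he] := VG.2 e e0; exists phi => //.
rewrite -(@ltr_pXn2r _ 2) ?nnegrE ?normH_ge0 ?ltW //.
rewrite normH_sqr //; last by apply: L2vB => //; exact: solenoidal_L2v.
by apply: le_lt_trans he; rewrite lerDl innerT_ge0.
Qed.

Lemma spaceH_L2v u : spaceH Om u -> L2v Om u.
Proof. by case. Qed.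

Lemma solenoidal_H u : sol u -> spaceH Om u.
Proof. by move=> /solenoidal_V/spaceV_H. Qed.

Lemma normH_le_normV a u : L2v Om u -> normH Om u <= normV Om a u.
Proof.
by move=> Lu; apply: ler_wsqrtr; rewrite lerDl mulr_ge0 ?sqr_ge0 ?bilinA_ge0.
Qed.

Lemma normV1_sqr u : L2v Om u -> normV Om 1 u ^+ 2 = normH Om u ^+ 2 + bilinA Om u u.
Proof.
move=> Lu; rewrite normH_sqr // sqr_sqrtr ?expr1n ?mul1r //.
by rewrite addr_ge0 ?inner_ge0 ?bilinA_ge0.
Qed.

Lemma scalev_cgrad c u : sol u -> cgrad (scalev c u) = (fun i j x => c * cgrad u i j x).
Proof.
move=> su; apply/funext => i; apply/funext => j; apply/funext => x.
by rewrite /cgrad partialZ //; exact: (c1_der (solenoidal_C1c i su)).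
Qed.

End spaces.

(** * The theorem of Rellich *)

Lemma sqr_le_norm (R : realDomainType) (x d : R) : `|x| <= d -> x ^+ 2 <= d ^+ 2.
Proof.
move=> xd; rewrite -(real_normK (num_real x)) lerXn2r // nnegrE //.
exact: le_trans xd.
Qed.

Section rellich_net.
Variable R : realType.
Variable Om : set (E3 R).
Hypotheses (oOm : open Om) (bOm : bounded_set Om).
Implicit Types u v w : vfield R.
Local Notation sol := (solenoidal Om).
Let mOm : measurable (Om : set (VT R)) := open_measurable_vol oOm.

#[local] Opaque int3.

Lemma inner_sum u : L2v Om u ->
  inner Om u u = \sum_k \int[vol]_(p in Om) (u k p ^+ 2).
Proof.
move=> Lu; rewrite (innerE mOm Lu Lu); apply: eq_bigr => k _.
by apply: eq_Rintegral => p _; rewrite expr2.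
Qed.

Lemma innerT_sum (G : tfield R) : L2t Om G ->
  innerT Om G G = \sum_k \sum_i \int[vol]_(p in Om) (G k i p ^+ 2).
Proof.
move=> LG; rewrite (innerTE mOm LG LG); apply: eq_bigr => k _; apply: eq_bigr => i _.
by apply: eq_Rintegral => p _; rewrite expr2.
Qed.

(** Fields whose integrals over the cells of a fine grid nearly agree are close in
    [L^2], up to an error of order [L] in terms of their gradients. *)
Lemma solenoidal_diff_le M n phi psi : 0 < M ->
  (forall p, Om p -> [/\ - M < p.1.1 < M, - M < p.1.2 < M & - M < p.2 < M]) ->
  (0 < n)%N -> sol phi -> sol psi ->
  let L := (M + M) / n%:R in
  is_true (inner Om (phi - psi) (phi - psi) <=
    L ^- 3 * \sum_k \sum_q (cell (n := n) M q (phi k) - cell M q (psi k)) ^+ 2 +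
    L ^+ 2 * innerT Om (cgrad phi - cgrad psi) (cgrad phi - cgrad psi)).
Proof.
move=> M0 OmM n0 sphi spsi L.
have C1 k : C1c Om (fun p => phi k p - psi k p).
  by apply: C1cB; exact: solenoidal_C1c.
have Ld : L2v Om (phi - psi).
  by apply: L2vB => //; apply: solenoidal_L2v.
have LT : L2t Om (cgrad phi - cgrad psi).
  by apply: L2tB => //; apply: solenoidal_L2t.
rewrite (inner_sum Ld) (innerT_sum LT) !mulr_sumr -big_split /=.
apply: ler_sum => k _.
have := cell_poincare oOm M0 OmM n0 (C1 k); rewrite -/L.
have -> : \sum_q cell (n := n) M q (fun p => phi k p - psi k p) ^+ 2 =
    \sum_q (cell (n := n) M q (phi k) - cell M q (psi k)) ^+ 2.
  by apply: eq_bigr => q _; rewrite (@cellB _ Om _ M0 _ n0) //; exact: solenoidal_C1c.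
suff -> : \sum_i \int[vol]_(p in Om) (partial i (fun p => phi k p - psi k p) p ^+ 2) =
   \sum_i \int[vol]_(p in Om) ((cgrad phi - cgrad psi) k i p ^+ 2) by [].
apply: eq_bigr => i _; apply: eq_Rintegral => p _; rewrite partialB //.
  exact: (c1_der (solenoidal_C1c k sphi)).
exact: (c1_der (solenoidal_C1c k spsi)).
Qed.

(** The grid is chosen so fine that in [solenoidal_diff_le] the gradients, which are
    bounded by 1, contribute at most half of [eta ^+ 2]. The finitely many integrals
    over cells are bounded on the unit ball of [H^1], so [finite_net] makes them agree
    up to an error that contributes at most the other half. *)
Lemma rellich_net eta : 0 < eta ->
  exists (I : finType) (z : I -> vfield R), (forall i, sol (z i)) /\
    forall phi, sol phi -> inner Om phi phi + innerT Om (cgrad phi) (cgrad phi) <= 1 ->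
    exists i, normH Om (phi - z i) <= eta.
Proof.
move=> eta0; have [M M0 OmM] := bounded_coord bOm.
have MM0 : 0 < M + M by exact: addr_gt0.
(* The difference of two gradients has a square of at most 4, so that 4 L ^+ 2 is to be
   at most half of eta ^+ 2. *)
pose A := 8 * (M + M) ^+ 2 / eta ^+ 2.
pose n := (Num.truncn A).+1.
have n0 : (0 < n)%N by [].
have nA : A < n%:R by rewrite /n truncnS_gt.
have nR : 1 <= n%:R :> R by rewrite ler1n.
pose L := (M + M) / n%:R.
have L0 : 0 < L by rewrite divr_gt0 // ltr0n.
have L8 : 8 * L ^+ 2 <= eta ^+ 2.
  have e2 : 0 < eta ^+ 2 by exact: exprn_gt0.
  have nn : A <= n%:R ^+ 2 by apply: le_trans (ltW nA) _; rewrite expr2 ler_peMr // (le_trans ler01).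
  rewrite /L expr_div_n mulrA ler_pdivrMr; last by rewrite exprn_gt0 // ltr0n.
  by move: nn; rewrite /A ler_pdivrMr // (mulrC (eta ^+ 2)).
pose K := ('I_3 * ('I_n * 'I_n * 'I_n))%type.
pose N : R := \sum_(k < 3) \sum_(q : 'I_n * 'I_n * 'I_n) 1.
have N0 : 0 <= N by apply: sumr_ge0 => k _; apply: sumr_ge0.
pose B := 2 * (L ^- 3 * N + 1).
have LN0 : 0 <= L ^- 3 * N by rewrite mulr_ge0 // invr_ge0 exprn_ge0 // ltW.
have B0 : 0 < B by rewrite mulr_gt0 // ltr_wpDl.
pose d := Num.min 1 (eta ^+ 2 / B).
have d0 : 0 < d by rewrite lt_min ltr01 divr_gt0 // exprn_gt0.
have d2 : 2 * (L ^- 3 * N * d ^+ 2) <= eta ^+ 2.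
  have dd : d ^+ 2 <= eta ^+ 2 / B.
    apply: (@le_trans _ _ d); last by rewrite ge_min lexx orbT.
    by rewrite expr2 ger_pMl // ge_min lexx.
  have EB : B * (eta ^+ 2 / B) = eta ^+ 2 by field; rewrite gt_eqF.
  have := ler_wpM2l (ltW B0) dd; rewrite EB.
  apply: le_trans; rewrite mulrA ler_wpM2r ?sqr_ge0 // /B ler_pM2l //.
  by rewrite lerDl.
pose S : set (vfield R) := [set phi | sol phi /\
  inner Om phi phi + innerT Om (cgrad phi) (cgrad phi) <= 1].
pose l (k : K) (phi : vfield R) := cell M k.2 (phi k.1).
have lC phi k : S phi -> `|l k phi| <= L ^+ 3 + 1.
  move=> [sphi h1].
  have Lphi := solenoidal_L2v oOm bOm sphi.
  have := cell_le oOm M0 OmM n0 k.2 (solenoidal_C1c k.1 sphi); rewrite -/L => h.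
  have h2 : \int[vol]_(p in Om) (phi k.1 p ^+ 2) <= 1.
    apply: le_trans h1; apply: (@le_trans _ _ (inner Om phi phi)); last first.
      by rewrite lerDl innerT_ge0.
    rewrite inner_sum // (bigD1 k.1) //= lerDl; apply: sumr_ge0 => j _.
    by apply: Rintegral_ge0 => x _; exact: sqr_ge0.
  have L3 : 0 < L ^+ 3 by exact: exprn_gt0.
  have h3 : l k phi ^+ 2 <= L ^+ 3.
    by apply: le_trans h _; rewrite ger_pMr.
  have := real_normK (num_real (l k phi)) => E; rewrite -E in h3.
  have := normr_ge0 (l k phi); nra.
have [I [w [Sw hw]]] := @finite_net _ _ S K l _ d d0 lC.
exists I, w; split=> [i|phi sphi h1]; first by have [] := Sw i.
have [i hi] := hw phi (conj sphi h1); exists i.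
have [swi hwi] := Sw i.
have Lphi := solenoidal_L2v oOm bOm sphi; have Lw := solenoidal_L2v oOm bOm swi.
have Tphi := solenoidal_L2t oOm bOm sphi; have Tw := solenoidal_L2t oOm bOm swi.
rewrite -(@ler_pXn2r _ 2) ?nnegrE ?normH_ge0 ?(ltW eta0) //.
rewrite normH_sqr //; last exact: L2vB.
apply: (le_trans (solenoidal_diff_le M0 OmM n0 sphi swi)).
rewrite -/L.
have h2 : \sum_k \sum_q (cell (n := n) M q (phi k) - cell M q (w i k)) ^+ 2 <= N * d ^+ 2.
  rewrite /N mulr_suml; apply: ler_sum => k _; rewrite mulr_suml; apply: ler_sum => q _.
  by rewrite mul1r; apply: sqr_le_norm; exact: (hi (k, q)).
have h3 : innerT Om (cgrad phi - cgrad (w i)) (cgrad phi - cgrad (w i)) <= 4.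
  have le1 psi : sol psi -> inner Om psi psi + innerT Om (cgrad psi) (cgrad psi) <= 1 ->
      normT Om (cgrad psi) <= 1.
    move=> spsi hp; rewrite -(@ler_pXn2r _ 2) ?nnegrE ?normT_ge0 // normT_sqr expr1n.
    apply: le_trans hp; rewrite lerDr; apply: inner_ge0 => //; exact: solenoidal_L2v.
  rewrite -normT_sqr (_ : 4 = 2 ^+ 2); last by ring.
  apply: sqr_le_norm; rewrite ger0_norm ?normT_ge0 //.
  apply: le_trans (normTB_le mOm Tphi Tw) _; rewrite -[2]/(1 + 1).
  by apply: lerD; exact: le1.
have Li : 0 <= L ^- 3 by rewrite invr_ge0 exprn_ge0 // ltW.
have L2 : 0 <= L ^+ 2 by exact: sqr_ge0.
apply: le_trans (lerD (ler_wpM2l Li h2) (ler_wpM2l L2 h3)) _.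
by rewrite mulrA; move: L8 d2; clear; lra.
Qed.

(** An element of V is replaced by a solenoidal field [phi] close to it in [H^1], and
    [phi] is scaled into the unit ball, to which [rellich_net] applies. The factor
    [2 * (normV Om 1 u + 1)] is large enough for both the field and its gradient. *)
Lemma spaceV_net eta : 0 < eta ->
  exists (I : finType) (z : I -> vfield R), (forall i, sol (z i)) /\
    forall u, spaceV Om u -> exists i,
      normH Om (u - scalev (2 * (normV Om 1 u + 1)) (z i)) <= eta * (normV Om 1 u + 1).
Proof.
move=> eta0; have [I [z [sz hz]]] := rellich_net (divr_gt0 eta0 (ltr0Sn _ 3)).
exists I, z; split=> // u Vu.
have VG := Vgrad_grad Vu; set G := grad Om u in VG.
have Lu := Vgrad_L2v VG; have LG := Vgrad_L2t VG.
set N := normV Om 1 u.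
have N0 : 0 <= N by exact: sqrtr_ge0.
have N2 := normV1_sqr oOm Lu; rewrite -/N in N2.
have e0 : 0 < Num.min 1 (eta / 2) by rewrite lt_min ltr01 divr_gt0.
have [phi sphi hphi] := VG.2 _ e0.
set e := Num.min 1 (eta / 2) in e0 hphi.
have Lphi := solenoidal_L2v oOm bOm sphi; have Tphi := solenoidal_L2t oOm bOm sphi.
have Ld := L2vB mOm Lu Lphi; have Td := L2tB mOm LG Tphi.
have hd : normH Om (u - phi) <= e.
  rewrite -(@ler_pXn2r _ 2) ?nnegrE ?normH_ge0 ?(ltW e0) // normH_sqr //.
  by apply: le_trans (ltW hphi); rewrite lerDl innerT_ge0.
have hT : normT Om (G - cgrad phi) <= e.
  rewrite -(@ler_pXn2r _ 2) ?nnegrE ?normT_ge0 ?(ltW e0) // normT_sqr.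
  by apply: le_trans (ltW hphi); rewrite lerDr inner_ge0.
have e1 : e <= 1 by rewrite ge_min lexx.
have e2 : e <= eta / 2 by rewrite ge_min lexx orbT.
have uN : normH Om u <= N by exact: normH_le_normV.
have GN : normT Om G <= N.
  rewrite -(@ler_pXn2r _ 2) ?nnegrE ?normT_ge0 // N2 normT_sqr lerDr.
  exact: sqr_ge0.
set c := 2 * (N + 1).
have c0 : 0 < c by rewrite mulr_gt0 // ltr_wpDl.
have phiN : normH Om phi <= N + 1.
  have := normH_le mOm Lphi Lu; rewrite (normHC mOm Lphi Lu) => /le_trans; apply.
  by apply: lerD => //; exact: le_trans hd e1.
have TN : normT Om (cgrad phi) <= N + 1.
  have := normTB_le mOm LG Td.
  rewrite (_ : G - (G - cgrad phi) = cgrad phi); last by rewrite opprB addrC subrK.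
  by move=> /le_trans; apply; apply: lerD => //; exact: le_trans hT e1.
have sol' : sol (scalev c^-1 phi).
  have [tphi dphi] := sphi.
  split=> [i|x].
    have [sm cs so] := tphi i.
    have CkZ k (h : E3 R -> R) a : Ck k h -> Ck k (fun x => a * h x).
      elim: k h => [|k IH] h /= => [ch x|[ch hk]]; first exact: cvgMr (ch x).
      split=> [x|j]; first exact: cvgMr (ch x).
      have [dj Cj] := hk j; split=> [x|]; first exact: (derivableZ (k := a) (dj x)).
      rewrite (_ : partial j (fun x => a * h x) = fun x => a * partial j h x); last first.
        by apply/funext => x; exact: partialZ.
      exact: IH.
    have supp : [set x | scalev c^-1 phi i x != 0] = [set x | phi i x != 0].
      by apply/seteqP; split=> x /=; rewrite /scalev mulf_eq0 invr_eq0 (gt_eqF c0).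
    by split; rewrite ?supp // => k; exact: CkZ.
  under eq_bigr => i _.
    rewrite (_ : partial i _ x = c^-1 * partial i (phi i) x); last first.
      by apply: partialZ; exact: (c1_der (solenoidal_C1c i sphi)).
    over.
  by rewrite -mulr_sumr dphi mulr0.
have [|i hi] := hz _ sol'.
  rewrite (scalev_cgrad _ sphi) -normH_sqr //; last exact: L2vZ.
  rewrite -normT_sqr // normHZ // normTZ // !exprMn -mulrDr.
  rewrite real_normK ?num_real // exprVn mulrC ler_pdivrMr ?exprn_gt0 // mul1r.
  have := normH_ge0 Om phi; have := normT_ge0 Om (cgrad phi).
  rewrite /c; move: (normH Om phi) (normT Om (cgrad phi)) phiN TN N0; clear=> x y; nra.
exists i.
have Lz := solenoidal_L2v oOm bOm (sz i).
have Lcz := L2vZ mOm c Lz.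
apply: le_trans (normH_triangle mOm Lu Lphi Lcz) _.
have -> : phi - scalev c (z i) = scalev c (scalev c^-1 phi - z i).
  apply/funext => k; apply/funext => x; rewrite /scalev !fctE /=.
  by rewrite mulrBr mulrA divff ?gt_eqF // mul1r.
rewrite normHZ //; last by apply: L2vB => //; exact: L2vZ.
rewrite ger0_norm ?(ltW c0) //.
apply: le_trans (lerD hd (ler_wpM2l (ltW c0) hi)) _.
by rewrite /c; move: e2 N0 eta0; clear; nra.
Qed.

End rellich_net.

(** * Weak and strong compactness *)

Section weak_topology.
Variable R : realType.
Variable Om : set (E3 R).
Hypotheses (oOm : open Om) (bOm : bounded_set Om).
Implicit Types u v w : vfield R.
Local Notation sol := (solenoidal Om).
Let mOm : measurable (Om : set (VT R)) := open_measurable_vol oOm.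

Lemma inner_near v k w d gam : L2v Om v -> L2v Om k -> L2v Om w ->
  normH Om (k - w) <= d -> `|inner Om v w| <= gam -> `|inner Om v k| <= gam + normH Om v * d.
Proof.
move=> Lv Lk Lw kw vw.
have -> : inner Om v k = inner Om v w + inner Om v (k - w) by rewrite innerBr //; ring.
apply: le_trans (ler_normD _ _) _; apply: lerD => //.
apply: le_trans (inner_CS mOm Lv (L2vB mOm Lk Lw)) _.
by apply: ler_wpM2l => //; exact: normH_ge0.
Qed.

Lemma weak_nbhs_family p (I : finType) (y : I -> vfield R) gam : 0 < gam ->
  (forall i, spaceH Om (y i)) ->
  weak_nbhs Om p [set q | spaceH Om q /\ forall i, `|inner Om q (y i) - inner Om p (y i)| < gam].
Proof.
move=> g0 Hy; exists #|I|, (fun k => y (enum_val k)), gam; split => // q Hq hq.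
by split => // i; have := hq (enum_rank i); rewrite enum_rankK.
Qed.

(** Total boundedness in [L^2], the net consisting of test fields: both the pairing
    with an element of [K] is controlled by the pairings with the net, and the
    Navier-Stokes equations may be tested with the elements of the net. *)
Definition solenoidal_net (K : set (vfield R)) := forall e, 0 < e ->
  exists (I : finType) (w : I -> vfield R), (forall i, sol (w i)) /\
    forall k, K k -> exists i, normH Om (k - w i) <= e.

(** Let [p] be a weak cluster point of a filter on [K]. If [q] in [K] is weakly close
    to [p], then the square of [normH Om (p - q)] is the difference of the pairings of
    [p - q] with [p] and with [q]. As [p] and [q] are close to a finite net, against
    which [p - q] is small, both pairings are small. *)
Lemma strong_compact r (K : set (vfield R)) : K `<=` ballH Om r ->
  compact_for (weak_nbhs Om) K -> solenoidal_net K ->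
  compact_for (metric_nbhs (spaceH Om) (distH Om)) K.
Proof.
move=> Kr cK netK F FF FK.
have [p Kp hp] := cK F FF FK; exists p => // U N FU [e e0 heN].
have [Hp rp] := Kr p Kp.
have r0 : 0 <= r by exact: le_trans (normH_ge0 Om p) rp.
pose d := e ^+ 2 / (4 * (1 + 2 * r)).
have d0 : 0 < d by rewrite divr_gt0 ?exprn_gt0 // mulr_gt0 // ltr_pwDl // mulr_ge0.
have [I [w [sw hw]]] := netK d d0.
have FUK : F (U `&` K) by exact: filterI.
have [q [[Uq Kq] [Hq wq]]] := hp _ _ FUK (weak_nbhs_family p d0 (fun i => solenoidal_H oOm bOm (sw i))).
exists q; split => //; apply: heN => //.
have [_ rq] := Kr q Kq.
have Lp := spaceH_L2v Hp; have Lq := spaceH_L2v Hq.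
have Ld := L2vB mOm Lp Lq.
have dr : normH Om (p - q) <= 2 * r.
  have := normH_le mOm Lp Lq => h0.
  have := normH_triangle mOm Lp (L2vZ mOm 0 Lp) Lq.
  have -> : p - scalev 0 p = p.
    by apply/funext => i; apply/funext => x; rewrite /scalev !fctE /= mul0r subr0.
  have -> : scalev 0 p - q = scalev (-1) q.
    by apply/funext => i; apply/funext => x; rewrite /scalev !fctE /= mul0r sub0r mulN1r.
  rewrite normHZ // normrN normr1 mul1r; lra.
have near k : K k -> `|inner Om (p - q) k| <= d + 2 * r * d.
  move=> Kk; have [i hi] := hw k Kk.
  have Lw := solenoidal_L2v oOm bOm (sw i).
  have [Hk _] := Kr k Kk.
  have hpq : `|inner Om (p - q) (w i)| <= d.
    by rewrite innerBl // distrC; apply: ltW; exact: wq.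
  apply: le_trans (inner_near Ld (spaceH_L2v Hk) Lw hi hpq) _.
  by rewrite lerD2l ler_wpM2r // ltW.
rewrite /distH -(@ltr_pXn2r _ 2) ?nnegrE ?normH_ge0 ?(ltW e0) //.
rewrite normH_sqr // innerBr //.
have := near p Kp; have := near q Kq; rewrite !ler_norml => /andP[h1 _] /andP[_ h2].
have : 2 * (d + 2 * r * d) < e ^+ 2.
  have -> : 2 * (d + 2 * r * d) = e ^+ 2 / 2.
    by rewrite /d; field; rewrite gt_eqF // ltr_pwDl // mulr_ge0.
  by rewrite ltr_pdivrMr // ltr_pMr ?exprn_gt0 // ltr1n.
by move: h1 h2; clear; lra.
Qed.

(** If this failed, then for each [eta] there would be a bad [k] in [K], which has a
    counterexample [q] at distance less than [eta]. The bad points form a filter on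
    [K]; near a weak cluster point [p] of it, both [k] and [q] are close to [p] for [dw],
    hence weakly, which is a contradiction. The uniformity in [K] is due to its
    weak compactness. *)
Lemma weak_metric_uniform (dw : vfield R -> vfield R -> R) r (K : set (vfield R))
    (I : finType) (y : I -> vfield R) gam : weak_metric Om dw ->
  K `<=` ballH Om r -> compact_for (weak_nbhs Om) K ->
  0 < gam -> (forall i, spaceH Om (y i)) ->
  exists2 eta, 0 < eta & forall q k, ballH Om r q -> K k -> dw q k < eta ->
    forall i, `|inner Om q (y i) - inner Om k (y i)| < gam.
Proof.
move=> wm Kr cK g0 Hy; apply: contrapT => no.
pose bad eta : set (vfield R) := [set k | K k /\ exists q, [/\ ballH Om r q, dw q k < eta &
  exists i, gam <= `|inner Om q (y i) - inner Om k (y i)|]].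
have bad0 eta : 0 < eta -> bad eta !=set0.
  move=> eta0; apply: contrapT => nb; apply: no; exists eta => // q k Bq Kk dqk i.
  rewrite ltNge; apply/negP => hi; apply: nb; exists k; split => //; exists q; split => //.
  by exists i.
pose F : set_system (vfield R) := [set U | exists2 eta, 0 < eta & bad eta `<=` U].
have FF : ProperFilter F.
  split; first by move=> [eta /bad0[k bk] /(_ k bk)].
  split.
  - by exists 1.
  - move=> P Q [a a0 aP] [b b0 bQ]; exists (Num.min a b); first by rewrite lt_min a0.
    move=> k [Kk [q [Bq dqk hi]]]; rewrite lt_min in dqk; have /andP[da db] := dqk.
    by split; [apply: aP|apply: bQ]; split => //; exists q.
  - by move=> P Q PQ [a a0 aP]; exists a => // k /aP /PQ.
have FK : F K by exists 1 => // k [].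
have [p Kp hp] := cK F FF FK.
have Bp := Kr p Kp; have [Hp rp] := Bp.
have g2 : 0 < gam / 2 by rewrite divr_gt0.
have wn := weak_nbhs_family p g2 Hy.
have [e e0 he] : metric_nbhs (ballH Om r) dw p
    [set q | spaceH Om q /\ forall i, `|inner Om q (y i) - inner Om p (y i)| < gam / 2].
  apply: (wm_weak wm _ Bp).1; exists [set q | spaceH Om q /\
     forall i, `|inner Om q (y i) - inner Om p (y i)| < gam / 2] => //.
have e2 : 0 < e / 2 by rewrite divr_gt0.
have [W wW WB] : exists2 W, weak_nbhs Om p W & W `&` ballH Om r `<=` [set q | dw p q < e / 2].
  by apply: (wm_weak wm _ Bp).2; exists (e / 2).
have Fb : F (bad (e / 2)) by exists (e / 2).
have [k [[Kk [q [Bq dqk [i hi]]]] Wk]] := hp _ _ Fb wW.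
have Bk := Kr k Kk; have dpk := WB k (conj Wk Bk); rewrite /= in dpk.
have [_ /(_ i) hk] : spaceH Om k /\ forall i, `|inner Om k (y i) - inner Om p (y i)| < gam / 2.
  by apply: he => //; apply: lt_trans dpk _; rewrite ltr_pdivrMr // ltr_pMr // ltr1n.
have [_ /(_ i) hq] : spaceH Om q /\ forall i, `|inner Om q (y i) - inner Om p (y i)| < gam / 2.
  apply: he => //; have [Hq _] := Bq; have [Hk _] := Bk.
  apply: le_lt_trans (wm_triangle wm Hp Hk Hq) _.
  by rewrite (wm_sym wm Hk Hq) (splitr e) ltrD.
have : `|inner Om q (y i) - inner Om k (y i)| < gam.
  have -> : inner Om q (y i) - inner Om k (y i) =
    (inner Om q (y i) - inner Om p (y i)) - (inner Om k (y i) - inner Om p (y i)) by ring.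
  by apply: le_lt_trans (ler_normB _ _) _; rewrite (splitr gam) ltrD.
by rewrite ltNge hi.
Qed.

End weak_topology.

(** * Test functions of time *)

Section flat.
Variable R : realType.
Implicit Types (p q : {poly R}) (x y t : R).

(** The functions [p(1/x) exp(-1/x)], extended by zero, are closed under derivation,
    which makes all of them smooth. *)
Definition flat p x : R := if 0 < x then p.[x^-1] * expR (- x^-1) else 0.

(** The derivative of [p(1/x) exp(-1/x)] is [q(1/x) exp(-1/x)] for this [q]. *)
Definition dflat p : {poly R} := (p - p^`()) * 'X^2.

(** The [k]-th power of [expR (y / k) >= y / k]. *)
Lemma pow_expR_le k y : 0 <= y -> y ^+ k * expR (- y) <= k%:R ^+ k.
Proof.
move=> y0; rewrite expRN -ler_pdivlMr ?invr_gt0 ?expR_gt0 // invrK.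
case: k => [|k].
  by rewrite !expr0 mul1r; apply: le_trans (expR_ge1Dx y); rewrite lerDl.
have k0 : 0 < k.+1%:R :> R by rewrite ltr0n.
have kn0 : k.+1%:R != 0 :> R by rewrite gt_eqF.
have -> : expR y = expR (y / k.+1%:R) ^+ k.+1 by rewrite -expRM_natr divfK.
rewrite -exprMn lerXn2r ?nnegrE ?mulr_ge0 ?expR_ge0 //.
rewrite -[leLHS](divfK kn0) mulrC ler_pM2l //.
by apply: le_trans (expR_ge1Dx _); rewrite lerDr.
Qed.

Lemma flat_bounded p : exists2 C, 0 <= C & forall x, `|flat p x| <= C.
Proof.
exists (\sum_(i < size p) `|p`_i| * i%:R ^+ i).
  by apply: sumr_ge0 => i _; rewrite mulr_ge0 // exprn_ge0.
move=> x; rewrite /flat; case: ifPn => [x0|_]; last first.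
  by rewrite normr0; apply: sumr_ge0 => i _; rewrite mulr_ge0 // exprn_ge0.
have y0 : 0 <= x^-1 by rewrite invr_ge0 ltW.
rewrite normrM (ger0_norm (expR_ge0 _)) horner_coef.
apply: le_trans (ler_wpM2r (expR_ge0 _) (ler_norm_sum _ _ _)) _.
rewrite mulr_suml; apply: ler_sum => i _.
by rewrite normrM -mulrA ler_wpM2l // ger0_norm ?exprn_ge0 // pow_expR_le.
Qed.

Lemma flat0 p x : x <= 0 -> flat p x = 0.
Proof. by move=> x0; rewrite /flat ltNge x0. Qed.

(** [flat p] is of order [x ^+ 2] at the origin, so that its derivative there is zero. *)
Lemma flat_sqr p x : flat p x = x ^+ 2 * flat (p * 'X^2) x.
Proof.
rewrite /flat; case: ifPn => [x0|_]; last by rewrite mulr0.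
by rewrite hornerM hornerXn; field; rewrite gt_eqF.
Qed.

Lemma is_derive_flat p x : is_derive x (1 : R) (flat p) (flat (dflat p) x).
Proof.
have [x0|x0|->] := ltgtP x 0.
- rewrite flat0 ?(ltW x0) //.
  have nr : \forall y \near x, cst (0 : R) y = flat p y.
    by near=> y; rewrite flat0 //; apply/ltW; near: y; exact: lt_nbhsl.
  exact: near_eq_is_derive nr _.
- have xn0 : x != 0 by rewrite gt_eqF.
  have nr : \forall y \near x, p.[y^-1] * expR (- y^-1) = flat p y.
    by near=> y; rewrite /flat ifT //; near: y; exact: lt_nbhsr.
  apply: (near_eq_is_derive nr).
  have dV : is_derive x (1 : R) (fun y : R => y^-1) (- x ^- 2).
    have := is_deriveV xn0 (is_derive_id x (1 : R)).
    by rewrite /GRing.scale /= mulr1.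
  have dp : is_derive x (1 : R) (fun y : R => p.[y^-1]) (p^`().[x^-1] * - x ^- 2).
    have dpp : is_derive (x^-1) (1 : R) (horner p) (p^`().[x^-1]).
      exact: is_derive_poly.
    exact: (is_derive1_comp dpp dV).
  have de : is_derive x (1 : R) (fun y : R => expR (- y^-1)) (expR (- x^-1) * x ^- 2).
    have dN := is_deriveN dV.
    have := @is_derive1_comp _ _ (fun y : R => - y^-1) _ _ _ (is_derive_expR (- x^-1)) dN.
    by rewrite /GRing.scale /= opprK.
  have E : flat (dflat p) x = p.[x^-1] *: (expR (- x^-1) * x ^- 2) +
      expR (- x^-1) *: (p^`().[x^-1] * - x ^- 2).
    by rewrite /flat x0 /dflat !hornerE /GRing.scale /=; field.
  rewrite E; exact: (is_deriveM dp de).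
- rewrite flat0 //; have [C C0 hC] := flat_bounded (p * 'X^2).
  have cv : (fun h : R => h^-1 *: ((flat p \o shift 0) (h *: (1 : R)) - flat p 0)) @ 0^' --> (0 : R).
    apply/cvgrPdist_le => e e0.
    near=> h.
    have h0 : h != 0 by near: h; exact: nbhs_dnbhs_neq.
    rewrite sub0r normrN /= addr0 (flat0 p (lexx 0)) subr0 /GRing.scale /= mulr1.
    rewrite flat_sqr mulrA expr2 mulrA mulVf // mul1r normrM.
    apply: le_trans (ler_wpM2l _ (hC h)) _ => //.
    have hs : `|h| <= e / (C + 1).
      near: h; apply: dnbhs0_le; by rewrite divr_gt0 // ltr_wpDl.
    apply: le_trans (ler_wpM2r C0 hs) _.
    rewrite mulrAC ler_pdivrMr ?ltr_wpDl // ler_pM2l //.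
    by rewrite lerDl.
  apply: DeriveDef; first by apply/cvg_ex; exists 0.
  exact: cvg_lim cv.
Unshelve. all: by end_near. Qed.

End flat.

Section time_bumps.
Variable R : realType.
Local Notation lam := (@lebesgue_measure R).
Implicit Types (p q : {poly R}) (a b h k t x : R).

(** A class of functions that contains the bumps and is stable under derivation, by
    which the smoothness of bumps follows by induction on the order. *)
Inductive bump_class a h b k : (R -> R) -> Prop :=
| bump_base p q : bump_class a h b k
    (fun t => flat p ((t - a) / h) * flat q ((b - t) / k))
| bump_add f g : bump_class a h b k f -> bump_class a h b k g ->
    bump_class a h b k (fun t => f t + g t).

Lemma flatZ c p x : flat (c *: p) x = c * flat p x.
Proof. by rewrite /flat; case: ifP => _; rewrite ?mulr0 // hornerZ mulrA. Qed.

Lemma is_derive_flat_up p a h t :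
  is_derive t (1 : R) (fun t => flat p ((t - a) / h)) (flat (dflat p) ((t - a) / h) / h).
Proof.
have dl : is_derive t (1 : R) (fun t : R => (t - a) / h) h^-1.
  have := is_deriveZ (h^-1) (is_deriveB (is_derive_id t (1 : R)) (is_derive_cst a t 1)).
  rewrite subr0 /GRing.scale /= mulr1 => H.
  rewrite (_ : (fun t : R => (t - a) / h) = (h^-1 \*: (id - cst a))) //.
  by apply/funext => s; rewrite mulrC.
exact: (@is_derive1_comp _ (flat p) (fun t : R => (t - a) / h) t _ _ (is_derive_flat p ((t - a) / h)) dl).
Qed.

Lemma is_derive_flat_down p b k t :
  is_derive t (1 : R) (fun t => flat p ((b - t) / k)) (- (flat (dflat p) ((b - t) / k) / k)).
Proof.
have dl : is_derive t (1 : R) (fun t : R => (b - t) / k) (- k^-1).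
  have := is_deriveZ (k^-1) (is_deriveB (is_derive_cst b t 1) (is_derive_id t (1 : R))).
  rewrite sub0r /GRing.scale /= mulrN1 => H.
  rewrite (_ : (fun t : R => (b - t) / k) = (k^-1 \*: (cst b - id))) //.
  by apply/funext => s; rewrite mulrC.
by rewrite -mulrN; exact: (@is_derive1_comp _ (flat p) (fun t : R => (b - t) / k) t _ _ (is_derive_flat p ((b - t) / k)) dl).
Qed.

Lemma is_derive_bump p q a h b k t :
  is_derive t (1 : R) (fun t => flat p ((t - a) / h) * flat q ((b - t) / k))
    (flat (dflat p) ((t - a) / h) / h * flat q ((b - t) / k)
     - flat p ((t - a) / h) * (flat (dflat q) ((b - t) / k) / k)).
Proof.
have := is_deriveM (is_derive_flat_up p a h t) (is_derive_flat_down q b k t).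
rewrite /GRing.scale /= => H; set d := (_ - _).
rewrite (_ : d = flat p ((t - a) / h) * - (flat (dflat q) ((b - t) / k) / k) +
  flat q ((b - t) / k) * (flat (dflat p) ((t - a) / h) / h)) //.
by rewrite /d; ring.
Qed.

Lemma bump_class_derive a h b k f : bump_class a h b k f ->
  (forall t, derivable f t 1) /\ bump_class a h b k f^`()%classic.
Proof.
elim=> [p q|f1 f2 _ [d1 b1] _ [d2 b2]].
  split=> [t|].
    by have [] := is_derive_bump p q a h b k t.
  rewrite (_ : _^`()%classic = fun t =>
    (fun t => flat (h^-1 *: dflat p) ((t - a) / h) * flat q ((b - t) / k)) t +
    (fun t => flat p ((t - a) / h) * flat (- k^-1 *: dflat q) ((b - t) / k)) t).
    by apply: bump_add; exact: bump_base.
  apply/funext => t; rewrite derive1E.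
  have [_ ->] := is_derive_bump p q a h b k t.
  by rewrite !flatZ; ring.
split=> [t|]; first exact: (derivableD (d1 t) (d2 t)).
rewrite (_ : _^`()%classic = fun t => f1^`()%classic t + f2^`()%classic t).
  exact: bump_add.
by apply/funext => t; rewrite !derive1E (deriveD (d1 t) (d2 t)).
Qed.

Lemma bump_class_smooth a h b k f n t : bump_class a h b k f -> derivable (derive1n n f) t 1.
Proof.
move=> Bf; have : bump_class a h b k (derive1n n f).
  by elim: n => //= n /bump_class_derive[].
by move=> /bump_class_derive[].
Qed.

(** The profile [exp(-1/x)], extended by zero, and, as [dramp], its derivative. *)
Definition ramp x : R := flat 1 x.
Definition dramp x : R := flat 'X^2 x.

Lemma dflat1 : dflat (1 : {poly R}) = 'X^2.
Proof. by rewrite /dflat derivC subr0 mul1r. Qed.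

Lemma ramp_ge0 x : 0 <= ramp x.
Proof. by rewrite /ramp /flat; case: ifP => // _; rewrite hornerE mul1r expR_ge0. Qed.

Lemma ramp_le1 x : ramp x <= 1.
Proof.
rewrite /ramp /flat; case: ifP => // x0; rewrite hornerE mul1r -expR0 ler_expR.
by rewrite oppr_le0 invr_ge0 ltW.
Qed.

Lemma ramp_le x y : x <= y -> ramp x <= ramp y.
Proof.
move=> xy; rewrite {1}/ramp /flat; case: ifP => [x0|_]; last exact: ramp_ge0.
rewrite /ramp /flat (lt_le_trans x0 xy) !hornerE ?mul1r ler_expR lerN2.
by rewrite lef_pV2 // posrE (lt_le_trans x0).
Qed.

Lemma ramp_gt0 x : 0 < x -> 0 < ramp x.
Proof. by move=> x0; rewrite /ramp /flat x0 hornerE mul1r expR_gt0. Qed.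

Lemma ramp_ge x : 0 < x -> 1 - x^-1 <= ramp x.
Proof. by move=> x0; rewrite /ramp /flat x0 hornerE mul1r expR_ge1Dx. Qed.

Lemma ramp_out x : x <= 0 -> ramp x = 0.
Proof. exact: flat0. Qed.

Lemma dramp_ge0 x : 0 <= dramp x.
Proof.
by rewrite /dramp /flat; case: ifP => // _; rewrite hornerXn mulr_ge0 ?expR_ge0 // sqr_ge0.
Qed.

Lemma dramp_out x : x <= 0 -> dramp x = 0.
Proof. exact: flat0. Qed.

Lemma dramp_le x : dramp x <= 4.
Proof.
rewrite /dramp /flat; case: ifP => // x0; rewrite hornerXn.
apply: le_trans (pow_expR_le 2 _) _; first by rewrite invr_ge0 ltW.
by rewrite -natrX.
Qed.

(** The bump rises at the scale [h] from [a] on and decays at the scale [k] up to [b].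
    The scales are independent, as the decay is made steep in [energy_at_endpoint]. *)
Definition bump a h b k t := ramp ((t - a) / h) * ramp ((b - t) / k).

Lemma bump_derive1 a h b k t : (bump a h b k)^`()%classic t =
  dramp ((t - a) / h) / h * ramp ((b - t) / k) - ramp ((t - a) / h) * (dramp ((b - t) / k) / k).
Proof.
by rewrite derive1E; have [_ ->] := is_derive_bump 1 1 a h b k t; rewrite dflat1.
Qed.

Lemma bump_out a h b k t : 0 < h -> 0 < k -> ~ (a < t < b) -> bump a h b k t = 0.
Proof.
move=> h0 k0 /negP; rewrite negb_and -!leNgt => /orP[ta|bt].
  by rewrite /bump ramp_out ?mul0r // pmulr_lle0 ?invr_gt0 // subr_le0.
by rewrite /bump [X in _ * X]ramp_out ?mulr0 // pmulr_lle0 ?invr_gt0 // subr_le0.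
Qed.

Lemma bump_ge0 a h b k t : 0 <= bump a h b k t.
Proof. by rewrite mulr_ge0 // ramp_ge0. Qed.

Lemma bump_le1 a h b k t : bump a h b k t <= 1.
Proof. by rewrite mulr_ile1 ?ramp_ge0 // ramp_le1. Qed.

Lemma bump_test_time a h b k T : 0 < a -> b < T -> 0 < h -> 0 < k ->
  test_time `]0, T[ (bump a h b k).
Proof.
move=> a0 bT h0 k0.
have sub : closure [set t | bump a h b k t != 0] `<=` [set` `[a, b]].
  have cab : closed ([set` `[a, b]] : set R) by exact: itv_closed.
  rewrite [X in _ `<=` X]((closure_id _).1 cab).
  apply: closureS => t /= nz; rewrite in_itv /=; apply/andP.
  have : (a < t < b) by apply: contrapT => /(bump_out h0 k0) E; rewrite E eqxx in nz.
  by move=> /andP[/ltW -> /ltW ->].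
split.
- by move=> n t; apply: (@bump_class_smooth a h b k); exact: bump_base.
- by apply: (subclosed_compact _ (@segment_compact _ a b)) => //; exact: closed_closure.
- move=> t /sub /=; rewrite !in_itv /= => /andP[at_ tb].
  by rewrite (lt_le_trans a0 at_) (le_lt_trans tb bT).
Qed.

Lemma continuous_up p a h : continuous (fun t : R => flat p ((t - a) / h)).
Proof.
move=> x; apply: differentiable_continuous; apply/derivable1_diffP.
by have [] := is_derive_flat_up p a h x.
Qed.

Lemma continuous_down p b k : continuous (fun t : R => flat p ((b - t) / k)).
Proof.
move=> x; apply: differentiable_continuous; apply/derivable1_diffP.
by have [] := is_derive_flat_down p b k x.
Qed.

Lemma integral_dramp_up a h s t : s <= t ->
  \int[lam]_(x in `[s, t]) (dramp ((x - a) / h) / h) = ramp ((t - a) / h) - ramp ((s - a) / h).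
Proof.
move=> st; rewrite (@ftc_segment _ (fun t => ramp ((t - a) / h))
  (fun x => dramp ((x - a) / h) / h) s t) //.
- by move=> x; have [] := is_derive_flat_up 1 a h x.
- by move=> x; have [_ ->] := is_derive_flat_up 1 a h x; rewrite dflat1.
- by move=> x; apply: cvgMl; exact: continuous_up.
Qed.

Lemma integral_dramp_down b k s t : s <= t ->
  \int[lam]_(x in `[s, t]) (dramp ((b - x) / k) / k) = ramp ((b - s) / k) - ramp ((b - t) / k).
Proof.
move=> st; rewrite (_ : _ - _ = - ramp ((b - t) / k) - - ramp ((b - s) / k)); last by ring.
rewrite (@ftc_segment _ (fun t => - ramp ((b - t) / k))
  (fun x => dramp ((b - x) / k) / k) s t) //.
- by move=> x; have H := is_deriveN (is_derive_flat_down 1 b k x); have [] := H.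
- move=> x; have H := is_deriveN (is_derive_flat_down 1 b k x); have [_ E] := H.
  by rewrite opprK dflat1 in E; exact: E.
- by move=> x; apply: cvgMl; exact: continuous_down.
Qed.

End time_bumps.

(** * Dominated integrals, and bounds for the forms *)

Section domination.
Context d (T : measurableType d) (R : realType) (mu : {measure set T -> \bar R}).

(** The integral of a nonnegative function is the supremum of the integrals of the
    simple functions below it, whence its monotonicity for arbitrary functions. *)
Lemma ge0_le_integral_nomeas (D : set T) (f g : T -> \bar R) :
  (forall x, D x -> (0 <= f x)%E) -> (forall x, D x -> (f x <= g x)%E) ->
  (\int[mu]_(x in D) f x <= \int[mu]_(x in D) g x)%E.
Proof.
move=> f0 fg; rewrite integral_mkcond [leRHS]integral_mkcond.
have F0 x : (0 <= (f \_ D) x)%E by apply: erestrict_ge0.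
have FG x : ((f \_ D) x <= (g \_ D) x)%E.
  by rewrite !patchE; case: ifPn => // /set_mem; exact: fg.
have G0 x : (0 <= (g \_ D) x)%E by apply: le_trans (FG x).
rewrite !ge0_integralTE //; apply: ereal_sup_le => _ [h hf <-].
by exists h => // x; apply: le_trans (hf x) _.
Qed.

(** The integrand is arbitrary: this serves to estimate the time integrals of the
    forms [bilinA] and [trilinB] along a solution without a proof that these are
    measurable in time. *)
Lemma Rintegral_dominated (D : set T) (f g : T -> R) : measurable D ->
  mu.-integrable D (EFin \o g) -> (forall x, D x -> `|f x| <= g x) ->
  `|\int[mu]_(x in D) f x| <= \int[mu]_(x in D) g x.
Proof.
move=> mD ig fg.
have part h : (forall x, D x -> (0 <= h x)%E) -> (forall x, D x -> (h x <= (g x)%:E)%E) ->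
    0 <= fine (\int[mu]_(x in D) h x)%E <= \int[mu]_(x in D) g x /\ (\int[mu]_(x in D) h x)%E \is a fin_num.
  move=> h0 hg; have le := ge0_le_integral_nomeas h0 hg.
  have fg' : (\int[mu]_(x in D) (g x)%:E)%E \is a fin_num by exact: integrable_fin_num.
  have h0' : (0 <= \int[mu]_(x in D) h x)%E by exact: integral_ge0.
  have fh : (\int[mu]_(x in D) h x)%E \is a fin_num.
    by rewrite ge0_fin_numE //; apply: le_lt_trans le _; rewrite ltey_eq fg'.
  by split => //; rewrite fine_ge0 // fine_le.
rewrite {1}/Rintegral integralE.
have hp x : D x -> ((EFin \o f)^\+%E x <= (g x)%:E)%E.
  move=> Dx; rewrite funeposE /= -EFin_max lee_fin ge_max (le_trans (ler_norm _) (fg x Dx)) /=.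
  exact: le_trans (normr_ge0 _) (fg x Dx).
have hn x : D x -> ((EFin \o f)^\-%E x <= (g x)%:E)%E.
  move=> Dx; rewrite funenegE /= -EFin_max lee_fin ge_max.
  rewrite (le_trans (ler_norm _)) ?normrN ?fg //=.
  exact: le_trans (normr_ge0 _) (fg x Dx).
have [/andP[p1 p2] p3] := part _ (fun x _ => funepos_ge0 _ x) hp.
have [/andP[n1 n2] n3] := part _ (fun x _ => funeneg_ge0 _ x) hn.
rewrite fineB // ler_norml; apply/andP; split; lra.
Qed.
End domination.

Section forms.
Variable R : realType.
Variable Om : set (E3 R).
Hypotheses (oOm : open Om) (bOm : bounded_set Om).
Implicit Types u v w : vfield R.
Local Notation sol := (solenoidal Om).
Let mOm : measurable (Om : set (VT R)) := open_measurable_vol oOm.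

Lemma normT_grad_le u : L2v Om u -> normT Om (grad Om u) <= normV Om 1 u.
Proof.
move=> Lu; rewrite -(@ler_pXn2r _ 2) ?nnegrE ?normT_ge0 ?sqrtr_ge0 // normT_sqr.
by rewrite (normV1_sqr oOm Lu) lerDr sqr_ge0.
Qed.

Lemma bilinA_le u w : L2v Om u -> `|bilinA Om u w| <= normT Om (grad Om w) * normV Om 1 u.
Proof.
move=> Lu; rewrite /bilinA; apply: le_trans (innerT_CS mOm (grad_L2t Om u) (grad_L2t Om w)) _.
rewrite [leLHS]mulrC; apply: ler_wpM2l; first exact: normT_ge0.
exact: normT_grad_le.
Qed.

(** The test field is bounded, so the product of [u] with it is in [L^2], without any
    embedding of [H^1]. *)
Lemma trilinB_le w : sol w -> exists2 C, 0 <= C & forall u, L2v Om u ->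
  `|trilinB Om u u w| <= C * normH Om u * normV Om 1 u.
Proof.
move=> sw.
have [C C0 hC] : exists2 C, 0 <= C & forall i x, `|w i x| <= C.
  have h i : exists C, forall x, `|w i x| <= C by exact: c1_bnd (solenoidal_C1c i sw).
  have [c hc] := choice h; exists (\sum_i `|c i|); first by apply: sumr_ge0.
  move=> i x; apply: le_trans (hc i x) _; rewrite (bigD1 i) //=.
  by apply: le_trans (ler_norm _) _; rewrite lerDl sumr_ge0.
exists (3 * C); first exact: mulr_ge0.
move=> u Lu.
pose K : tfield R := fun i j x => w i x * u j x.
have Lw := solenoidal_L2v oOm bOm sw.
have mw i := L2s_measurable (Lw i); have mu i := L2s_measurable (Lu i).
have LK : L2t Om K.
  move=> i j; apply: L2sI; first exact: measurable_funM (mw i) (mu j).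
  apply: (le_integrable mOm _ _ (integrableZl mOm (C ^+ 2) (L2s_integrable (Lu j)))).
    by apply/measurable_EFinP; apply: measurable_funX; exact: measurable_funM (mw i) (mu j).
  move=> x _; rewrite /= lee_fin (ger0_norm (sqr_ge0 _)) ger0_norm; last first.
    by apply: mulr_ge0; exact: sqr_ge0.
  by rewrite /K exprMn ler_wpM2r ?sqr_ge0 // sqr_le_norm.
have -> : trilinB Om u u w = innerT Om (grad Om u) K.
  apply: eq_Rintegral => x _; apply: eq_bigr => i _; apply: eq_bigr => j _.
  by rewrite /K; ring.
apply: le_trans (innerT_CS mOm (grad_L2t Om u) LK) _; rewrite mulrC.
have KH : normT Om K <= 3 * C * normH Om u.
  have CH : 0 <= C * normH Om u by rewrite mulr_ge0 // normH_ge0.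
  have CH3 : 0 <= 3 * (C * normH Om u) by exact: mulr_ge0.
  rewrite -mulrA -(@ler_pXn2r _ 2) ?nnegrE ?normT_ge0 // normT_sqr.
  rewrite (innerT_sum oOm LK).
  have h i : \sum_j \int[vol]_(p in Om) (K i j p ^+ 2) <= (C * normH Om u) ^+ 2.
    rewrite exprMn normH_sqr // (inner_sum oOm Lu) mulr_sumr; apply: ler_sum => j _.
    rewrite -RintegralZl //; last exact: L2s_integrable.
    apply: le_Rintegral => //.
    - exact: L2s_integrable (LK i j).
    - have := integrableZl mOm (C ^+ 2) (L2s_integrable (Lu j)).
      by apply: eq_integrable => // x _ /=; rewrite -EFinM.
    - by move=> x _; rewrite /K exprMn ler_wpM2r ?sqr_ge0 // sqr_le_norm.
  apply: le_trans (ler_sum _ (fun i _ => h i)) _.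
  rewrite sumr_const card_ord -[leLHS]mulr_natl; set X := (C * normH Om u) ^+ 2.
  have -> : (3 * (C * normH Om u)) ^+ 2 = 9 * X by rewrite /X; ring.
  have : 0 <= X by exact: sqr_ge0.
  by clear; lra.
by apply: ler_pM; rewrite ?normT_ge0 // normT_grad_le.
Qed.

End forms.

(** * Leray-Hopf solutions: measurability and energy *)

Section time_integrals.
Variable R : realType.
Local Notation lam := (@lebesgue_measure R).

Definition seg (a b : R) : set (measurableTypeR R) := [set` `[a, b]].

Lemma measurable_seg a b : measurable (seg a b).
Proof. exact: measurable_itv. Qed.

Lemma lam_seg a b : a <= b -> lam (seg a b) = (b - a)%:E.
Proof.
move=> ab; have := @lebesgue_measure_itv R `[a, b]; rewrite /= lte_fin => ->.
case: ltP => [_|ba]; first by rewrite -EFinB.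
by have -> : b - a = 0 by apply/eqP; rewrite subr_eq0 eq_le ba ab.
Qed.

Lemma lam_seg_fin a b : (lam (seg a b) < +oo)%E.
Proof.
have := @lebesgue_measure_itv R `[a, b]; rewrite /= => ->.
by case: ifP => // _; rewrite -EFinB ltry.
Qed.

Lemma seg_integrable a b (f : R -> R) C : measurable_fun (seg a b) f ->
  (forall t, seg a b t -> `|f t| <= C) -> lam.-integrable (seg a b) (EFin \o f).
Proof.
move=> mf fC; apply: measurable_bounded_integrable => //.
- exact: measurable_seg.
- exact: lam_seg_fin.
- by exists C; split; [exact: num_real|move=> M CM t It /=; apply: le_trans (fC t It) (ltW CM)].
Qed.

Lemma Rintegral_subset (I J : set (measurableTypeR R)) (f : R -> R) : measurable I -> measurable J ->
  J `<=` I -> lam.-integrable I (EFin \o f) -> (forall t, I t -> 0 <= f t) ->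
  \int[lam]_(t in J) f t <= \int[lam]_(t in I) f t.
Proof.
move=> mI mJ JI iI f0; rewrite /Rintegral fine_le //.
- exact/integrable_fin_num/(integrableS mI mJ JI iI).
- exact: integrable_fin_num.
- apply: ge0_subset_integral => //; first exact: measurable_int iI.
Qed.

Lemma Rintegral_support (D J : set R) (f : R -> R) : J `<=` D -> (forall t, ~ J t -> f t = 0) ->
  \int[lam]_(t in D) f t = \int[lam]_(t in J) f t.
Proof.
move=> JD f0; rewrite Rintegral_mkcond [RHS]Rintegral_mkcond; congr Rintegral.
apply/funext => t; rewrite !patchE; case: ifPn => tD; case: ifPn => tJ //.
  by rewrite f0 //; move: tJ; rewrite notin_setE.
by exfalso; move: tD; rewrite notin_setE; apply; apply: JD; exact: set_mem.
Qed.

Lemma Rintegral_seg_cst a b c : a <= b -> \int[lam]_(t in seg a b) c = c * (b - a).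
Proof.
move=> ab; have mI := measurable_seg a b.
rewrite (Rintegral_cst lam mI); congr (c * _).
exact: (congr1 fine (lam_seg ab)).
Qed.

End time_integrals.

Section leray_hopf_estimates.
Variable R : realType.
Local Notation lam := (@lebesgue_measure R).
Variables (Om : set (E3 R)) (nu : R) (g : vfield R).
Hypotheses (oOm : open Om) (bOm : bounded_set Om) (nu0 : 0 < nu) (Hg : spaceH Om g).
Let mOm : measurable (Om : set (VT R)) := open_measurable_vol oOm.
Let Lg : L2v Om g := spaceH_L2v Hg.

Section one_solution.
Variable u : R -> vfield R.
Hypothesis LH : leray_hopf Om nu g u.
Local Notation nH := (fun t => normH Om (u t)).
Local Notation N2 := (fun t => normV Om 1 (u t) ^+ 2).
Local Notation bil := (fun t => bilinA Om (u t) (u t)).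
Local Notation gu := (fun t => inner Om g (u t)).

Lemma lh_L2v t : 0 <= t -> L2v Om (u t).
Proof. by move=> t0; exact: spaceH_L2v (lh_H LH t0). Qed.

Lemma lh_continuous v t : spaceH Om v -> 0 < t -> {for t, continuous (fun t => inner Om (u t) v)}.
Proof.
move=> Hv t0.
have : {within `]0, +oo[, continuous (fun t => inner Om (u t) v)}.
  apply: (continuous_subspaceW _ (lh_wcont LH Hv)).
  by move=> s /=; rewrite !in_itv /= !andbT => /ltW.
rewrite continuous_open_subspace; last exact: interval_open.
by apply; rewrite inE /= in_itv /= t0.
Qed.

Lemma measurable_inner v a b : spaceH Om v -> 0 < a ->
  measurable_fun (seg a b) (fun t => inner Om (u t) v).
Proof.
move=> Hv a0; apply: subspace_continuous_measurable_fun; first exact: measurable_seg.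
apply: (continuous_subspaceW _ (lh_wcont LH Hv)).
by move=> s /=; rewrite !in_itv /= andbT => /andP[/(lt_le_trans a0)/ltW].
Qed.

(** By weak continuity, the norm is lower semicontinuous along [u]: if [c < |u(t)|],
    then pairing [u(s)] with [u(t)] shows that [c < |u(s)|] for [s] close to [t]. *)
Lemma measurable_normH a b : 0 < a -> measurable_fun (seg a b) nH.
Proof.
move=> a0.
suff mH : measurable_fun ([set` `]0, +oo[] : set (measurableTypeR R)) nH.
  apply: measurable_funS mH; first exact: measurable_itv.
  by move=> s /=; rewrite !in_itv /= andbT => /andP[/(lt_le_trans a0)].
move=> mD; apply: (measurability _ (RGenOInfty.measurableE R)) => //.
move=> /= _ [_ [c ->] <-]; apply: open_measurable; rewrite openE => t.
move=> [/=]; rewrite !in_itv /= !andbT => t0 ct.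
have Lt := lh_L2v (ltW t0).
have [c0|c0] := ltP c 0.
  rewrite /interior; near=> s; split; first by rewrite /= in_itv /= andbT; near: s; exact: lt_nbhsr.
  by rewrite /= in_itv /= andbT; apply: lt_le_trans c0 (normH_ge0 _ _).
have nt0 : 0 < normH Om (u t) by exact: le_lt_trans ct.
have Et : c * normH Om (u t) < inner Om (u t) (u t).
  by rewrite -(normH_sqr mOm Lt) expr2 ltr_pM2r.
have ct' := lh_continuous (lh_H LH (ltW t0)) t0.
have nr : \forall s \near t, c * normH Om (u t) < inner Om (u s) (u t).
  exact: (ct' _ (lt_nbhsr Et)).
rewrite /interior; near=> s.
have s0 : 0 < s by near: s; exact: lt_nbhsr.
split; first by rewrite /= in_itv /= andbT.
rewrite /= in_itv /= andbT -(ltr_pM2r nt0).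
have hs : c * normH Om (u t) < inner Om (u s) (u t) by near: s.
apply: lt_le_trans hs _; apply: le_trans (ler_norm _) _.
exact: (inner_CS mOm (lh_L2v (ltW s0)) Lt).
Unshelve. all: by end_near. Qed.

Lemma integrable_N2 a b : 0 < a -> a <= b -> lam.-integrable (seg a b) (EFin \o N2).
Proof.
move=> a0 ab; have b1 : 0 < b + 1 by rewrite addr_gt0 // (lt_le_trans a0).
have [_ _ iN] := lh_L2V LH b1.
apply: (integrableS _ _ _ iN); [exact: measurable_itv|exact: measurable_seg|].
move=> t; rewrite /seg /= !in_itv /= => /andP[at_ tb].
by rewrite (lt_le_trans a0 at_) (le_lt_trans tb) // ltrDl.
Qed.

Lemma ae_spaceV a b : 0 < a -> a <= b ->
  {ae lam, forall t, seg a b t -> spaceV Om (u t)}.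
Proof.
move=> a0 ab; have b1 : 0 < b + 1 by rewrite addr_gt0 // (lt_le_trans a0).
have [[N [mN N0 sub]] _ _] := lh_L2V LH b1; exists N; split => // t /= nt.
apply: sub => /= ht; apply: nt.
rewrite /seg /= in_itv /= => /andP[at_ tb]; apply: ht.
by rewrite (lt_le_trans a0 at_) (le_lt_trans tb) // ltrDl.
Qed.

Lemma N2E t : 0 <= t -> N2 t = nH t ^+ 2 + bil t.
Proof. by move=> t0; exact: (normV1_sqr oOm (lh_L2v t0)). Qed.

Section bounded.
Variables (r a b : R).
Hypotheses (a0 : 0 < a) (ab : a < b) (ur : forall t, seg a b t -> normH Om (u t) <= r).

Let ta t : seg a b t -> 0 < t.
Proof. by rewrite /seg /= in_itv /= => /andP[/(lt_le_trans a0)]. Qed.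

Let r0 : 0 <= r.
Proof.
apply: le_trans (ur (t := a) _); first exact: normH_ge0.
by rewrite /seg /= in_itv /= lexx ltW.
Qed.

Lemma integrable_sq (f : R -> R) C : measurable_fun (seg a b) f ->
  (forall t, seg a b t -> `|f t| <= C) ->
  lam.-integrable (seg a b) (EFin \o (fun t => nH t ^+ 2 * f t)).
Proof.
move=> mf fC; apply: (@seg_integrable _ _ _ _ (r ^+ 2 * C)).
  by apply: measurable_funM => //; apply: measurable_funX; exact: measurable_normH.
move=> t It; rewrite normrM; apply: ler_pM => //; last exact: fC.
by rewrite (ger0_norm (sqr_ge0 _)) lerXn2r ?nnegrE ?normH_ge0 ?ur.
Qed.

Lemma integrable_bil : lam.-integrable (seg a b) (EFin \o bil).
Proof.
have i1 := integrable_N2 a0 (ltW ab).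
have mc : measurable_fun (seg a b) (cst 1 : R -> R) by exact: measurable_cst.
have n1 t : seg a b t -> `|(cst 1 : R -> R) t| <= 1 by move=> _; rewrite normr1.
have i2 := integrable_sq mc n1.
have := integrableB (measurable_seg a b) i1 i2; apply: eq_integrable.
  exact: measurable_seg.
move=> t /set_mem It /=; rewrite N2E ?(ltW (ta It)) // mulr1 -EFinB addrAC subrr add0r.
by [].
Qed.

Lemma gu_le t : seg a b t -> `|gu t| <= normH Om g * r.
Proof.
move=> It; apply: le_trans (inner_CS mOm Lg (lh_L2v (ltW (ta It)))) _.
by rewrite ler_wpM2l ?normH_ge0 // ur.
Qed.

Lemma measurable_gu : measurable_fun (seg a b) gu.
Proof.
have := @measurable_inner g a b Hg a0; apply: eq_measurable_fun => t /set_mem It.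
by apply: (innerC mOm) => //; exact: lh_L2v (ltW (ta It)).
Qed.

Section weight.
Variables (h k : R).
Hypotheses (h0 : 0 < h) (k0 : 0 < k).
Local Notation psi := (bump a h b k).

Lemma energy_bump :
  - (1 / 2) * \int[lam]_(t in seg a b) (nH t ^+ 2 * psi^`()%classic t)
  + nu * \int[lam]_(t in seg a b) (bil t * psi t) <=
  \int[lam]_(t in seg a b) (gu t * psi t).
Proof.
have b0 : 0 < b by exact: lt_trans ab.
have b1 : 0 < b + 1 by rewrite addr_gt0.
have bb : b < b + 1 by rewrite ltrDl.
have := lh_energy LH b1 (bump_test_time a0 bb h0 k0) (bump_ge0 a h b k).
have sub : seg a b `<=` [set` `]0, b + 1[].
  move=> t It; have t0 := ta It; move: It; rewrite /seg /= !in_itv /= t0 => /andP[_ tb].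
  exact: le_lt_trans bb.
have out t : ~ seg a b t -> ~ (a < t < b).
  by move=> nI /andP[at_ tb]; apply: nI; rewrite /seg /= in_itv /= !ltW.
have z1 t : ~ seg a b t -> nH t ^+ 2 * psi^`()%classic t = 0.
  move=> /out /negP; rewrite negb_and -!leNgt bump_derive1 => /orP[t1|t1].
    rewrite [ramp ((t - a) / h)]ramp_out; last by rewrite pmulr_lle0 ?invr_gt0 // subr_le0.
    rewrite [dramp ((t - a) / h)]dramp_out; last by rewrite pmulr_lle0 ?invr_gt0 // subr_le0.
    by rewrite !mul0r subr0 mulr0.
  rewrite [ramp ((b - t) / k)]ramp_out; last by rewrite pmulr_lle0 ?invr_gt0 // subr_le0.
  rewrite [dramp ((b - t) / k)]dramp_out; last by rewrite pmulr_lle0 ?invr_gt0 // subr_le0.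
  by rewrite mul0r !mulr0 subr0 mulr0.
have z2 t : ~ seg a b t -> bil t * psi t = 0.
  by move=> /out nt; rewrite bump_out // mulr0.
have z3 t : ~ seg a b t -> gu t * psi t = 0.
  by move=> /out nt; rewrite bump_out // mulr0.
by rewrite (Rintegral_support sub z1) (Rintegral_support sub z2) (Rintegral_support sub z3).
Qed.

Lemma measurable_up p : measurable_fun (seg a b) (fun t : R => flat p ((t - a) / h)).
Proof. by apply: measurable_funTS; apply: continuous_measurable_fun; exact: continuous_up. Qed.

Lemma measurable_down p : measurable_fun (seg a b) (fun t : R => flat p ((b - t) / k)).
Proof. by apply: measurable_funTS; apply: continuous_measurable_fun; exact: continuous_down. Qed.

Lemma measurable_psi : measurable_fun (seg a b) psi.
Proof. by apply: measurable_funM; [exact: measurable_up|exact: measurable_down]. Qed.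

Lemma gu_psi_le : \int[lam]_(t in seg a b) (gu t * psi t) <= normH Om g * r * (b - a).
Proof.
rewrite -(Rintegral_seg_cst _ (ltW ab)); apply: le_Rintegral.
- exact: measurable_seg.
- apply: (@seg_integrable _ _ _ _ (normH Om g * r)).
    by apply: measurable_funM; [exact: measurable_gu|exact: measurable_psi].
  move=> t It; rewrite normrM (ger0_norm (bump_ge0 _ _ _ _ _)) -[leRHS]mulr1.
  by apply: ler_pM; rewrite ?bump_ge0 ?bump_le1 ?gu_le.
- by apply: (@seg_integrable _ _ _ _ `|normH Om g * r|).
- move=> t It; apply: le_trans (ler_norm _) _.
  rewrite normrM (ger0_norm (bump_ge0 _ _ _ _ _)) -[leRHS]mulr1.
  by apply: ler_pM; rewrite ?bump_ge0 ?bump_le1 ?gu_le.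
Qed.

End weight.
End bounded.
End one_solution.
End leray_hopf_estimates.

(** * Two consequences of the energy inequality *)

Lemma integrableZ_EFin d (T : measurableType d) (R : realType)
    (mu : {measure set T -> \bar R}) (D : set T) (c : R) (f : T -> R) : measurable D ->
  mu.-integrable D (EFin \o f) -> mu.-integrable D (EFin \o (fun x => c * f x)).
Proof.
move=> mD fi; have := integrableZl mD c fi.
by congr (_.-integrable _ _); apply/funext => x /=; rewrite EFinM.
Qed.

Section arithmetic.
Variable R : realFieldType.
Implicit Types x y z e : R.

Fact energy_arith x y z c n : - (1 / 2) * x + n <= y -> x <= 24 * z -> y <= c * 3 ->
  n <= 12 * z + 3 * c.
Proof. by move=> *; lra. Qed.

Fact endpoint_arith x y z n A B c : x = y - z -> - (1 / 2) * x + n <= A -> A <= c -> 0 <= n ->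
  y <= B -> z <= B + 2 * c.
Proof. by move=> *; lra. Qed.

Fact endpoint_contra X Y e : (Y - e) * (1 - e) <= X -> e * (1 + Y) <= (Y - X) / 2 -> X < Y -> False.
Proof. by move=> h1 h2 h3; have := sqr_ge0 e; nra. Qed.

Fact sub_half_ge0 Y e : 0 < Y -> e <= Y / 2 -> 0 <= Y - e.
Proof. by move=> *; lra. Qed.

Fact polar_arith x y z : 0 <= x - y - (y - z) -> 2 * y - z <= x.
Proof. by move=> *; lra. Qed.
End arithmetic.

Section energy_consequences.
Variable R : realType.
Local Notation lam := (@lebesgue_measure R).
Variables (Om : set (E3 R)) (nu : R) (g : vfield R).
Hypotheses (oOm : open Om) (bOm : bounded_set Om) (nu0 : 0 < nu) (Hg : spaceH Om g).
Let mOm : measurable (Om : set (VT R)) := open_measurable_vol oOm.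
Let Lg : L2v Om g := spaceH_L2v Hg.

Definition dissipation_bound (r : R) : R :=
  r ^+ 2 + (12 * r ^+ 2 + 3 * (normH Om g * r)) / (nu * ramp (1 : R) ^+ 2).

Section one_solution.
Variable u : R -> vfield R.
Hypothesis LH : leray_hopf Om nu g u.
Local Notation nH := (fun t => normH Om (u t)).
Local Notation N2 := (fun t => normV Om 1 (u t) ^+ 2).
Local Notation bil := (fun t => bilinA Om (u t) (u t)).

(** The energy inequality is used with a bump on [[T - 2, T + 1]], which is bounded from
    below by [ramp 1 ^+ 2] on [[T - 1, T]]. *)
Lemma integral_N2_le r T : 2 < T ->
  (forall t, seg (T - 2) (T + 1) t -> normH Om (u t) <= r) ->
  \int[lam]_(t in seg (T - 1) T) N2 t <= dissipation_bound r.
Proof.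
move=> T2 ur; set a := T - 2; set b := T + 1.
have a0 : 0 < a by rewrite subr_gt0.
have ab : a < b by rewrite /a /b; lra.
have h0 : (0 : R) < 1 by [].
have r0 : 0 <= r.
  apply: le_trans (ur T _); first exact: normH_ge0.
  by rewrite /seg /= in_itv /=; apply/andP; split; lra.
set psi := bump a 1 b 1.
have sub : seg (T - 1) T `<=` seg a b.
  by move=> t; rewrite /seg /= !in_itv /= => /andP[t1 t2]; rewrite /a /b; apply/andP; split; lra.
have mI := measurable_seg a b; have mJ := measurable_seg (T - 1) T.
have ba : b - a = 3 by rewrite /a /b; ring.
have TT : T - 1 <= T by lra.
have T10 : 0 < T - 1 by lra.
have range t : seg (T - 1) T t -> 1 <= t - a /\ 1 <= b - t.
  by rewrite /seg /= in_itv /= /a /b => /andP[t1 t2]; split; lra.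
have e := energy_bump LH a0 ab h0 h0; rewrite -/psi in e.
have ig := gu_psi_le oOm Hg LH a0 ab ur 1 1; rewrite -/psi ba in ig.
have dpsi t : `|psi^`()%classic t| <= 8.
  rewrite /psi bump_derive1 !divr1; apply: le_trans (ler_normB _ _) _.
  have := dramp_le (t - a); have := dramp_ge0 (t - a); have := ramp_ge0 (b - t); have := ramp_le1 (b - t).
  have := dramp_le (b - t); have := dramp_ge0 (b - t); have := ramp_ge0 (t - a); have := ramp_le1 (t - a).
  move: (dramp _) (dramp _) (ramp _) (ramp _) => d1 d2 r1 r2; clear => *.
  by rewrite !ger0_norm ?mulr_ge0 //; nra.
have mdpsi : measurable_fun (seg a b) psi^`()%classic.
  rewrite (_ : psi^`()%classic = fun t => flat 'X^2 ((t - a) / 1) / 1 * flat 1 ((b - t) / 1) -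
     flat 1 ((t - a) / 1) * (flat 'X^2 ((b - t) / 1) / 1)); last first.
    by apply/funext => t; rewrite /psi bump_derive1 /ramp /dramp.
  apply: measurable_funB; apply: measurable_funM.
  - by apply: measurable_funM => //; exact: measurable_up.
  - exact: measurable_down.
  - exact: measurable_up.
  - by apply: measurable_funM => //; exact: measurable_down.
have i1 := integrable_sq oOm LH a0 ab ur mdpsi (fun t _ => dpsi t).
have le1 : \int[lam]_(t in seg a b) (nH t ^+ 2 * psi^`()%classic t) <= 24 * r ^+ 2.
  have -> : 24 * r ^+ 2 = 8 * r ^+ 2 * (b - a) by rewrite ba; ring.
  rewrite -(Rintegral_seg_cst _ (ltW ab)); apply: le_Rintegral => //.
    by apply: (@seg_integrable _ _ _ _ `|8 * r ^+ 2|).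
  move=> t It; apply: le_trans (ler_norm _) _; rewrite normrM mulrC.
  apply: ler_pM => //; rewrite ger0_norm ?sqr_ge0 // lerXn2r ?nnegrE ?normH_ge0 //.
  exact: ur.
have bil0 t : 0 <= bil t by exact: bilinA_ge0.
have ibil := integrable_bil oOm LH a0 ab ur.
have ibp : lam.-integrable (seg a b) (EFin \o (fun t => bil t * psi t)).
  apply: (le_integrable mI _ _ ibil).
    apply/measurable_EFinP; apply: measurable_funM; last exact: measurable_psi.
    by apply/measurable_EFinP; exact: measurable_int ibil.
  move=> t _; rewrite /= lee_fin normrM (ger0_norm (bump_ge0 _ _ _ _ _)).
  by rewrite ler_piMr // bump_le1.
set c := ramp (1 : R) ^+ 2.
have c0 : 0 < c by rewrite exprn_gt0 // ramp_gt0.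
have ibJ := integrableS mI mJ sub ibil.
have le2 : c * \int[lam]_(t in seg (T - 1) T) bil t <= \int[lam]_(t in seg a b) (bil t * psi t).
  rewrite -(RintegralZl c mJ ibJ).
  apply: le_trans (Rintegral_subset mI mJ sub ibp _); last first.
    by move=> t _; rewrite mulr_ge0 // bump_ge0.
  apply: le_Rintegral => //.
  - exact: integrableZ_EFin.
  - exact: integrableS ibp.
  - move=> t It; rewrite mulrC ler_wpM2l // /psi /bump !divr1 /c expr2.
    have [t1 t2] := range t It.
    by apply: ler_pM; rewrite ?ramp_ge0 //; exact: ramp_le.
have iN := integrable_N2 LH (a := T - 1) (b := T).
have {}iN := iN T10 TT.
have n1 : \int[lam]_(t in seg (T - 1) T) N2 t <=
    r ^+ 2 + \int[lam]_(t in seg (T - 1) T) bil t.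
  have -> : r ^+ 2 = \int[lam]_(t in seg (T - 1) T) (r ^+ 2).
    by rewrite Rintegral_seg_cst //; ring.
  have ir : lam.-integrable (seg (T - 1) T) (EFin \o (fun=> r ^+ 2)).
    by apply: (@seg_integrable _ _ _ _ `|r ^+ 2|).
  rewrite -RintegralD //; apply: le_Rintegral => //.
    by have := integrableD mJ ir ibJ; exact.
  move=> t It; have It' := sub t It.
  have t0 : 0 <= t.
    by move: It; rewrite /seg /= in_itv /= => /andP[t1 _]; apply: le_trans t1; exact: ltW.
  rewrite (N2E oOm LH t0) lerD2r lerXn2r ?nnegrE ?normH_ge0 //; exact: ur.
apply: le_trans n1 _; rewrite /dissipation_bound lerD2l.
rewrite ler_pdivlMr; last by rewrite mulr_gt0.
rewrite mulrC -mulrA; apply: le_trans (ler_wpM2l (ltW nu0) le2) _.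
exact: energy_arith e le1 ig.
Qed.

(** In the energy inequality with a bump on [[T - h, T]], let the decay of the bump at
    [T] become infinitely steep. Its derivative then concentrates at [T], and by weak
    lower semicontinuity of the norm, at least the energy at [T] remains of it. What
    the rising part contributes is an average of the energy over [[T - h, T]], up to
    the factor [ramp 1]. *)
Lemma energy_at_endpoint r T h : 0 < h -> h < T ->
  (forall t, seg (T - h) T t -> normH Om (u t) <= r) ->
  normH Om (u T) ^+ 2 * ramp (1 : R) <=
    \int[lam]_(t in seg (T - h) T) (nH t ^+ 2 * (dramp ((t - (T - h)) / h) / h))
      + 2 * (normH Om g * r * h).
Proof.
move=> h0 hT ur; set a := T - h; set X := (leRHS).
have a0 : 0 < a by rewrite subr_gt0.
have ab : a < T by rewrite /a; lra.
have T0 : 0 < T by exact: lt_trans ab.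
have TaT : T - a = h by rewrite /a; ring.
have IT : seg a T T by rewrite /seg /= in_itv /= lexx ltW.
have r0 : 0 <= r by apply: le_trans (ur T IT); exact: normH_ge0.
have mI := measurable_seg a T.
have mup p : measurable_fun (seg a T) (fun t : R => flat p ((t - a) / h)) by exact: measurable_up.
have mdown k p : measurable_fun (seg a T) (fun t : R => flat p ((T - t) / k)) by exact: measurable_down.
have iup : lam.-integrable (seg a T) (EFin \o (fun t => nH t ^+ 2 * (dramp ((t - a) / h) / h))).
  apply: (integrable_sq oOm LH a0 ab ur (C := 4 / h)).
    by apply: measurable_funM => //; exact: mup.
  move=> t _; rewrite ger0_norm ?divr_ge0 ?dramp_ge0 ?(ltW h0) //.
  by rewrite ler_pM2r ?invr_gt0 // dramp_le.
have X0 : 0 <= X.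
  apply: addr_ge0; first by apply: Rintegral_ge0 => t _; rewrite mulr_ge0 ?sqr_ge0 // divr_ge0 ?dramp_ge0 // ltW.
  by rewrite !mulr_ge0 ?normH_ge0 // ltW.
have one k : 0 < k ->
    \int[lam]_(t in seg a T) (nH t ^+ 2 * (ramp ((t - a) / h) * (dramp ((T - t) / k) / k))) <= X /\
    lam.-integrable (seg a T) (EFin \o (fun t => nH t ^+ 2 * (ramp ((t - a) / h) * (dramp ((T - t) / k) / k)))).
  move=> k0; set psi := bump a h T k.
  have i2 : lam.-integrable (seg a T) (EFin \o (fun t => nH t ^+ 2 * (ramp ((t - a) / h) * (dramp ((T - t) / k) / k)))).
    apply: (integrable_sq oOm LH a0 ab ur (C := 1 * (4 / k))).
      by apply: measurable_funM; [exact: mup|apply: measurable_funM => //; exact: mdown].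
    move=> t _; rewrite normrM ger0_norm ?ramp_ge0 //.
    rewrite ger0_norm ?divr_ge0 ?dramp_ge0 ?(ltW k0) //.
    apply: ler_pM; rewrite ?ramp_ge0 ?ramp_le1 ?divr_ge0 ?dramp_ge0 ?(ltW k0) //.
    by rewrite ler_pM2r ?invr_gt0 // dramp_le.
  split => //.
  have i1 : lam.-integrable (seg a T) (EFin \o (fun t => nH t ^+ 2 * ((dramp ((t - a) / h) / h) * ramp ((T - t) / k)))).
    apply: (integrable_sq oOm LH a0 ab ur (C := (4 / h) * 1)).
      by apply: measurable_funM; [apply: measurable_funM => //; exact: mup|exact: mdown].
    move=> t _; rewrite normrM [X in X * _]ger0_norm ?divr_ge0 ?dramp_ge0 ?(ltW h0) //.
    rewrite ger0_norm ?ramp_ge0 //.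
    apply: ler_pM; rewrite ?ramp_ge0 ?ramp_le1 ?divr_ge0 ?dramp_ge0 ?(ltW h0) //.
    by rewrite ler_pM2r ?invr_gt0 // dramp_le.
  have e := energy_bump LH a0 ab h0 k0; rewrite -/psi in e.
  have ig := gu_psi_le oOm Hg LH a0 ab ur h k; rewrite -/psi TaT in ig.
  have bp0 : 0 <= \int[lam]_(t in seg a T) (bilinA Om (u t) (u t) * psi t).
    by apply: Rintegral_ge0 => t _; rewrite mulr_ge0 ?bump_ge0 ?bilinA_ge0.
  have de : \int[lam]_(t in seg a T) (nH t ^+ 2 * psi^`()%classic t) =
    \int[lam]_(t in seg a T) (nH t ^+ 2 * ((dramp ((t - a) / h) / h) * ramp ((T - t) / k))) -
    \int[lam]_(t in seg a T) (nH t ^+ 2 * (ramp ((t - a) / h) * (dramp ((T - t) / k) / k))).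
    rewrite -RintegralB //; apply: eq_Rintegral => t _.
    by rewrite /psi bump_derive1 mulrBr.
  have le1 : \int[lam]_(t in seg a T) (nH t ^+ 2 * ((dramp ((t - a) / h) / h) * ramp ((T - t) / k))) <=
      \int[lam]_(t in seg a T) (nH t ^+ 2 * (dramp ((t - a) / h) / h)).
    apply: le_Rintegral => // t _; rewrite mulrA ler_piMr ?ramp_le1 //.
    by rewrite mulr_ge0 ?sqr_ge0 // divr_ge0 ?dramp_ge0 // ltW.
  exact: endpoint_arith de e ig (mulr_ge0 (ltW nu0) bp0) le1.
set Y := normH Om (u T) ^+ 2 * ramp 1.
have [//|XY] := leP Y X.
have Y0 : 0 < Y by exact: le_lt_trans XY.
exfalso.
pose eps := Num.min (1 / 2) (Num.min (Y / 2) ((Y - X) / (2 * (1 + Y)))).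
have Y1 : 0 < 1 + Y by rewrite ltr_pwDl // ltW.
have p1 : 0 < 1 / 2 :> R by rewrite divr_gt0.
have p2 : 0 < Y / 2 by rewrite divr_gt0.
have p3 : 0 < (Y - X) / (2 * (1 + Y)) by rewrite divr_gt0 ?subr_gt0 // mulr_gt0.
have eps0 : 0 < eps by rewrite !lt_min p1 p2 p3.
have e1 : eps <= 1 / 2 by rewrite ge_min lexx.
have e2 : eps <= Y / 2 by rewrite !ge_min lexx orbT.
have e3 : eps * (1 + Y) <= (Y - X) / 2.
  have : eps <= (Y - X) / (2 * (1 + Y)) by rewrite !ge_min lexx !orbT.
  rewrite -(ler_pM2r Y1) => /le_trans; apply; rewrite le_eqVlt; apply/orP; left.
  by apply/eqP; field; rewrite gt_eqF.
(* a continuous minorant of the weighted energy which is sharp at T *)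
pose q t := (2 * inner Om (u t) (u T) - normH Om (u T) ^+ 2) * ramp ((t - a) / h).
have LT := lh_L2v LH (ltW T0).
have qT : q T = Y.
  by rewrite /q TaT divff ?gt_eqF // -normH_sqr // /Y; ring.
have qle t : seg a T t -> q t <= nH t ^+ 2 * ramp ((t - a) / h).
  rewrite /seg /= in_itv /= => /andP[at_ _].
  have t0 : 0 <= t by apply: le_trans at_; exact: ltW.
  have Lt := lh_L2v LH t0.
  rewrite ler_wpM2r ?ramp_ge0 //.
  have := inner_ge0 mOm (L2vB mOm Lt LT).
  rewrite innerBl ?innerBr //; try exact: L2vB.
  rewrite (innerC mOm LT Lt) !normH_sqr //; exact: polar_arith.
have cq : {for T, continuous q}.
  apply: cvgM; last exact: (continuous_up (p := 1)).
  apply: cvgB; last exact: cvg_cst.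
  by apply: cvgMr; exact: (lh_continuous LH (lh_H LH (ltW T0)) T0).
have [d /= d0 hd] : \forall t \near T, Y - eps < q t.
  apply: (cq [set y | Y - eps < y]); apply: lt_nbhsr; rewrite qT.
  by rewrite ltrBlDr ltrDl.
pose rho := Num.min (d / 2) h.
have rho0 : 0 < rho by rewrite lt_min divr_gt0.
have rhoh : rho <= h by rewrite ge_min lexx orbT.
have rhod : rho < d.
  apply: (@le_lt_trans _ _ (d / 2)); first by rewrite ge_min lexx.
  by rewrite ltr_pdivrMr // ltr_pMr // ltr1n.
have qrho t : seg (T - rho) T t -> Y - eps <= q t.
  rewrite /seg /= in_itv /= => /andP[t1 t2]; apply: ltW; apply: hd.
  rewrite /= ger0_norm ?subr_ge0 //; apply: le_lt_trans rhod.
  by rewrite lerBlDr -lerBlDl.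
have sub : seg (T - rho) T `<=` seg a T.
  move=> t; rewrite /seg /= !in_itv /= => /andP[t1 ->]; rewrite andbT /a.
  by apply: le_trans t1; rewrite lerD2l lerN2.
have mJ := measurable_seg (T - rho) T.
pose k := rho * eps.
have k0 : 0 < k by rewrite mulr_gt0.
have [oneX onei] := one k k0.
have low : (Y - eps) * (1 - eps) <= X.
  apply: le_trans oneX.
  apply: le_trans (Rintegral_subset mI mJ sub onei _); last first.
    move=> t _; apply: mulr_ge0; first exact: sqr_ge0.
    by apply: mulr_ge0; [exact: ramp_ge0|rewrite divr_ge0 ?dramp_ge0 // ltW].
  have Ye : 0 <= Y - eps by exact: sub_half_ge0.
  have TT : T - rho <= T by rewrite gerBl ltW.
  have idown : lam.-integrable (seg (T - rho) T) (EFin \o (fun t => dramp ((T - t) / k) / k)).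
    apply: (@seg_integrable _ _ _ _ (4 / k)).
      apply: measurable_funM => //; exact: measurable_down.
    move=> t _; rewrite ger0_norm ?divr_ge0 ?dramp_ge0 ?(ltW k0) //.
    by rewrite ler_pM2r ?invr_gt0 // dramp_le.
  apply: (@le_trans _ _ (\int[lam]_(t in seg (T - rho) T) ((Y - eps) * (dramp ((T - t) / k) / k)))).
    rewrite (RintegralZl _ mJ idown) ler_wpM2l //.
    rewrite (integral_dramp_down T k TT) subrr mul0r [ramp 0]ramp_out // subr0.
    have -> : (T - (T - rho)) / k = eps^-1.
      by rewrite /k; field; rewrite !gt_eqF.
    by rewrite -{1}[eps]invrK; apply: ramp_ge; rewrite invr_gt0.
  apply: le_Rintegral => //.
  - exact: integrableZ_EFin.
  - exact: integrableS onei.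
  - move=> t It; rewrite [leRHS]mulrA ler_wpM2r ?divr_ge0 ?dramp_ge0 ?(ltW k0) //.
    by apply: le_trans (qrho t It) _; apply: qle; exact: sub.
exact: endpoint_contra low e3 XY.
Qed.

End one_solution.
End energy_consequences.

(** * Weakly near the attractor implies strongly near it *)

Section arithmetic2.
Variable R : realFieldType.
Implicit Types x y z e : R.

(** In place of Cauchy-Schwarz in time; [th] is to be chosen after [D] and before the
    length of the time interval in [equicontinuity]. *)
Fact young x th : 0 < th -> x <= th * x ^+ 2 + th^-1.
Proof.
move=> t0; have ti : 0 < th^-1 by rewrite invr_gt0.
have [x0|x0] := leP x 0.
  by apply: (le_trans x0); rewrite addr_ge0 ?(mulr_ge0 (ltW t0)) ?sqr_ge0 ?(ltW ti).
have e : th * x ^+ 2 + th^-1 - 2 * x = th * (x - th^-1) ^+ 2 by field; rewrite gt_eqF.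
have := mulr_ge0 (ltW t0) (sqr_ge0 (x - th^-1)); rewrite -e; lra.
Qed.

Fact increment_id (x y a b c : R) : x + b + c = y + a -> x - y = a - b - c.
Proof. by lra. Qed.

Fact sum3_le (a b c x y : R) : 0 <= a -> 0 <= b -> 0 <= c -> 0 <= x -> 0 <= y ->
  c * x + a * y + b * y <= (a + b + c) * (x + y).
Proof.
move=> a0 b0 c0 x0 y0.
have -> : (a + b + c) * (x + y) = c * x + a * y + b * y + ((a + b) * x + c * y) by ring.
by rewrite lerDl addr_ge0 ?mulr_ge0 ?addr_ge0.
Qed.

Fact window_arith (T h t : R) : h <= 1 -> T - h <= t -> t <= T ->
  [/\ T - 2 <= t, t <= T + 1 & T - 1 <= t].
Proof. by move=> *; split; lra. Qed.

Fact late_arith (T h : R) : 2 < T -> h <= 1 -> [/\ 0 < T, h < T, 0 < T - 1 & T - 1 <= T].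
Proof. by move=> *; split; lra. Qed.

Fact norm3_le (a b c A B C : R) : `|a| <= A -> `|b| <= B -> `|c| <= C -> `|a - b - c| <= A + B + C.
Proof. by rewrite !ler_norml => /andP[? ?] /andP[? ?] /andP[? ?]; apply/andP; split; lra. Qed.

Fact pointwise_arith (us2 k2 ks2 i1 i2 i3 i4 N r d gam eta : R) :
  us2 = i1 + (i2 + ks2) -> ks2 = k2 + (i3 + i4) ->
  `|i1| <= 2 * (N + 1) * gam + 2 * r * (eta * (N + 1)) ->
  `|i2| <= gam + 2 * r * d -> `|i3| <= gam + d + gam + 2 * r * d ->
  `|i4| <= gam + d + gam + 2 * r * d -> gam <= d ->
  us2 <= k2 + (7 + 6 * r) * d + (2 * gam + 2 * r * eta) * (N + 1).
Proof.
move=> -> ->; rewrite !ler_norml => /andP[_ h1] /andP[_ h2] /andP[_ h3] /andP[_ h4] gd.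
have -> : (2 * gam + 2 * r * eta) * (N + 1) = 2 * (N + 1) * gam + 2 * r * (eta * (N + 1)) by ring.
lra.
Qed.

Fact endpoint_sqr_arith (uT e A c E X k2 d r gam uk Y : R) : 0 < e ->
  uT * e <= E -> E <= A * e + c + X ->
  A = k2 + (7 + 6 * r) * d + Y -> `|uk| <= gam + 2 * r * d -> gam <= d ->
  uT - k2 - 2 * uk <= (9 + 10 * r) * d + Y + c / e + X / e.
Proof.
move=> e0 h1 h2 hA; rewrite ler_norml => /andP[h3 _] gd.
have : uT <= A + c / e + X / e.
  by rewrite -(ler_pM2r e0) !mulrDl !divfK ?gt_eqF // (le_trans h1).
rewrite hA; lra.
Qed.

Fact succ_le_sqr (N : R) : N + 1 <= N ^+ 2 + 2.
Proof. by have := sqr_ge0 (N - 2^-1); nra. Qed.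
End arithmetic2.

Section core.
Variable R : realType.
Local Notation lam := (@lebesgue_measure R).
Variables (Om : set (E3 R)) (nu : R) (g : vfield R).
Hypotheses (oOm : open Om) (bOm : bounded_set Om) (nu0 : 0 < nu) (Hg : spaceH Om g).
Let mOm : measurable (Om : set (VT R)) := open_measurable_vol oOm.
Let Lg : L2v Om g := spaceH_L2v Hg.

(** The equation is tested with [w]. The constant does not depend on the
    solution, nor on the time interval. *)
Lemma equicontinuity w r : solenoidal Om w -> 0 <= r -> exists2 D, 0 <= D &
  forall u s T th, leray_hopf Om nu g u -> 0 < s -> s <= T -> 0 < th ->
    (forall t, seg s T t -> normH Om (u t) <= r) ->
    `|inner Om (u T) w - inner Om (u s) w| <=
      D * ((T - s) + (th * \int[lam]_(t in seg s T) (normV Om 1 (u t) ^+ 2) + (T - s) / th)).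
Proof.
move=> sw r0; have [C C0 hC] := trilinB_le oOm bOm sw.
have Vw := solenoidal_V oOm bOm sw.
set c1 := nu * normT Om (grad Om w); set c2 := C * r; set c3 := `|inner Om g w|.
have c10 : 0 <= c1 by rewrite mulr_ge0 ?normT_ge0 // ltW.
have c20 : 0 <= c2 by exact: mulr_ge0.
have c30 : 0 <= c3 by exact: normr_ge0.
exists (c1 + c2 + c3); first by rewrite !addr_ge0.
move=> u s T th LH s0 sT th0 ur.
have mI := measurable_seg s T.
have iN := integrable_N2 LH s0 sT.
set J := \int[lam]_(t in seg s T) _.
have J0 : 0 <= J by apply: Rintegral_ge0 => t _; exact: sqr_ge0.
set F := th * J + (T - s) / th.
have Ts : 0 <= T - s by rewrite subr_ge0.
have F0 : 0 <= F.
  by apply: addr_ge0; [exact: mulr_ge0 (ltW th0) J0 | exact: divr_ge0 Ts (ltW th0)].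
have icst c : lam.-integrable (seg s T) (EFin \o (fun=> c : R)).
  by apply: (@seg_integrable _ _ _ _ `|c|).
have iF : lam.-integrable (seg s T) (EFin \o (fun t => th * normV Om 1 (u t) ^+ 2 + th^-1)).
  by have := integrableD mI (integrableZ_EFin th mI iN) (icst th^-1); exact.
have FE c : \int[lam]_(t in seg s T) (c * (th * normV Om 1 (u t) ^+ 2 + th^-1)) = c * F.
  rewrite (RintegralZl _ mI iF) (RintegralD mI (integrableZ_EFin th mI iN) (icst th^-1)).
  by rewrite (RintegralZl _ mI iN) Rintegral_seg_cst // (mulrC th^-1).
have tpos t : seg s T t -> 0 <= t.
  by rewrite /seg /= in_itv /= => /andP[st _]; apply: le_trans st; exact: ltW.
have b1 : `|nu * \int[lam]_(t in seg s T) bilinA Om (u t) w| <= c1 * F.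
  rewrite normrM (ger0_norm (ltW nu0)) /c1 -mulrA ler_pM2l // -FE.
  apply: Rintegral_dominated => //; first exact: integrableZ_EFin.
  move=> t It; apply: le_trans (bilinA_le oOm w (lh_L2v LH (tpos t It))) _.
  by rewrite ler_wpM2l ?normT_ge0 // young.
have b2 : `|\int[lam]_(t in seg s T) trilinB Om (u t) (u t) w| <= c2 * F.
  rewrite -FE; apply: Rintegral_dominated => //; first exact: integrableZ_EFin.
  move=> t It; apply: le_trans (hC _ (lh_L2v LH (tpos t It))) _.
  apply: ler_pM; rewrite ?mulr_ge0 ?normH_ge0 ?sqrtr_ge0 ?young //.
  by rewrite ler_wpM2l // ur.
have b3 : `|\int[lam]_(t in seg s T) inner Om g w| <= c3 * (T - s).
  by rewrite Rintegral_seg_cst // normrM (ger0_norm Ts).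
have e := lh_weak LH (ltW s0) sT Vw.
have -> : inner Om (u T) w - inner Om (u s) w = \int[lam]_(t in seg s T) inner Om g w
    - nu * \int[lam]_(t in seg s T) bilinA Om (u t) w
    - \int[lam]_(t in seg s T) trilinB Om (u t) (u t) w.
  exact: increment_id e.
apply: le_trans (norm3_le b3 b1 b2) _.
exact: sum3_le.
Qed.

Section approximation.
Variables (K : set (vfield R)) (I J : finType) (w : I -> vfield R) (z : J -> vfield R).
Variables (r d eta gam : R).
Hypotheses (Kr : K `<=` ballH Om r) (sw : forall i, solenoidal Om (w i))
  (sz : forall j, solenoidal Om (z j)).
Hypothesis hw : forall k, K k -> exists i, normH Om (k - w i) <= d.
Hypothesis hz : forall v, spaceV Om v -> exists j,
  normH Om (v - scalev (2 * (normV Om 1 v + 1)) (z j)) <= eta * (normV Om 1 v + 1).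
Hypotheses (r0 : 0 <= r) (d0 : 0 <= d) (eta0 : 0 <= eta) (gam0 : 0 <= gam) (gd : gam <= d).

Definition weakly_near v k :=
  (forall i, `|inner Om v (w i) - inner Om k (w i)| <= gam) /\
  (forall j, `|inner Om v (z j) - inner Om k (z j)| <= gam).

Let Lw i : L2v Om (w i) := solenoidal_L2v oOm bOm (sw i).
Let Lz j : L2v Om (z j) := solenoidal_L2v oOm bOm (sz j).

Lemma normH_diff_le v v' : L2v Om v -> L2v Om v' -> normH Om v <= r -> normH Om v' <= r ->
  normH Om (v - v') <= 2 * r.
Proof.
move=> Lv Lv' vr vr'.
have L0 := L2vZ mOm 0 Lv.
apply: le_trans (normH_triangle mOm Lv L0 Lv') _.
have -> : v - scalev 0 v = v.
  by apply/funext => i; apply/funext => x; rewrite /scalev !fctE /= mul0r subr0.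
have -> : scalev 0 v - v' = scalev (-1) v'.
  by apply/funext => i; apply/funext => x; rewrite /scalev !fctE /= mul0r sub0r mulN1r.
by rewrite normHZ // normrN normr1 mul1r mulr_natl mulr2n lerD.
Qed.

(** What is small against the net of [K] is small against [K]. *)
Lemma inner_net_le v k x : L2v Om v -> normH Om v <= 2 * r -> K k ->
  (forall i, `|inner Om v (w i)| <= x) -> `|inner Om v k| <= x + 2 * r * d.
Proof.
move=> Lv vr Kk hx; have [i hi] := hw Kk; have [Hk _] := Kr Kk.
apply: le_trans (inner_near oOm Lv (spaceH_L2v Hk) (Lw i) hi (hx i)) _.
by rewrite lerD2l ler_wpM2r.
Qed.

(** Let [us] and [uT] be the values of the solution at times [s] and [T]. Split the square
    of the norm of [us] into the pairing of [us - ks] with [us], that of [us - ks] with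
    [ks], and the square of the norm of [ks]. The first is small by the net of V, in
    proportion to the [H^1] norm of [us], and the second is small by the net of [K]. By
    the equicontinuity of the solution, [ks] and [k] are weakly close, and as both
    belong to [K], the squares of their norms are close. *)
Lemma norm_sqr_pointwise us uT ks k : spaceV Om us -> spaceH Om uT ->
  normH Om us <= r -> normH Om uT <= r -> K ks -> K k ->
  weakly_near us ks -> weakly_near uT k ->
  (forall i, `|inner Om uT (w i) - inner Om us (w i)| <= d) ->
  normH Om us ^+ 2 <= normH Om k ^+ 2 + (7 + 6 * r) * d
    + (2 * gam + 2 * r * eta) * (normV Om 1 us + 1).
Proof.
move=> Vs HT rs rT Kks Kk [nw nz] [nwT _] eq.
have Ls := spaceH_L2v (spaceV_H oOm bOm Vs); have LT := spaceH_L2v HT.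
have [Hks rks] := Kr Kks; have [Hk rk] := Kr Kk.
have Lks := spaceH_L2v Hks; have Lk := spaceH_L2v Hk.
have Ld := L2vB mOm Ls Lks; have rd := normH_diff_le Ls Lks rs rks.
have Ldk := L2vB mOm Lks Lk; have rdk := normH_diff_le Lks Lk rks rk.
set N := normV Om 1 us.
have N1 : 0 <= N + 1 by rewrite addr_ge0 // sqrtr_ge0.
(* ks is close to us, us to uT, and uT to k, all weakly *)
have hdk i : `|inner Om (ks - k) (w i)| <= gam + d + gam.
  rewrite innerBl // (_ : _ - _ = - (inner Om us (w i) - inner Om ks (w i))
    - (inner Om uT (w i) - inner Om us (w i)) - (inner Om k (w i) - inner Om uT (w i))); last by ring.
  by apply: norm3_le; rewrite ?normrN // distrC.
apply: (@pointwise_arith _ _ _ (normH Om ks ^+ 2) (inner Om (us - ks) us) (inner Om (us - ks) ks)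
  (inner Om (ks - k) ks) (inner Om (ks - k) k) N r d gam eta).
- by rewrite !normH_sqr // !innerBl // (innerC mOm Ls Lks); ring.
- by rewrite !normH_sqr // !innerBl // (innerC mOm Lk Lks); ring.
- have [j hj] := hz Vs; rewrite -/N in hj.
  have Lcz := L2vZ mOm (2 * (N + 1)) (Lz j).
  have hc : `|inner Om (us - ks) (scalev (2 * (N + 1)) (z j))| <= 2 * (N + 1) * gam.
    rewrite innerZr // normrM ger0_norm; last exact: mulr_ge0.
    by rewrite ler_wpM2l ?mulr_ge0 // innerBl // nz.
  apply: le_trans (inner_near oOm Ld Ls Lcz hj hc) _.
  by rewrite lerD2l ler_wpM2r // mulr_ge0.
- by apply: inner_net_le => // i; rewrite innerBl.
- exact: inner_net_le.
- exact: inner_net_le.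
- by [].
Qed.

Variables (u : R -> vfield R) (T h : R) (kk : R -> vfield R).
Hypotheses (LH : leray_hopf Om nu g u) (T2 : 2 < T) (h0 : 0 < h) (h1 : h <= 1).
Hypothesis ur : forall t, seg (T - 2) (T + 1) t -> normH Om (u t) <= r.
Hypothesis Kkk : forall t, seg (T - h) T t -> K (kk t).
Hypothesis near_kk : forall t, seg (T - h) T t -> weakly_near (u t) (kk t).
Hypothesis equi : forall t i, seg (T - h) T t ->
  `|inner Om (u T) (w i) - inner Om (u t) (w i)| <= d.

(** The square of the norm of [u T - k] is that of [u T], minus that of [k], minus twice
    the pairing of [u T - k] with [k], which is small by the net of [K]. So all that is
    needed is a bound for the energy at [T] from above. [energy_at_endpoint] bounds it
    by an average over [[T - h, T]], to which [norm_sqr_pointwise] applies for almost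
    all times; the [H^1] norm in the error is integrable by [integral_N2_le]. *)
Lemma endpoint_close :
  normH Om (u T - kk T) ^+ 2 <= (9 + 10 * r) * d + (2 * gam + 2 * r * eta) * (2 +
      4 / h * dissipation_bound Om nu g r / ramp (1 : R))
    + 2 * (normH Om g * r * h) / ramp (1 : R).
Proof.
set e := ramp (1 : R); set sig := 2 * gam + 2 * r * eta.
have e0 : 0 < e by exact: ramp_gt0.
have sig0 : 0 <= sig by rewrite addr_ge0 ?mulr_ge0.
have [T0 hT T10 T11] := late_arith T2 h1.
have a0 : 0 < T - h by rewrite subr_gt0.
have ab : T - h < T by rewrite gtrBl.
have IT : seg (T - h) T T by rewrite /seg /= in_itv /= lexx ltW.
have sub : seg (T - h) T `<=` seg (T - 2) (T + 1).
  move=> t; rewrite /seg /= !in_itv /= => /andP[t1 t2].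
  by have [-> -> _] := window_arith h1 t1 t2.
have sub1 : seg (T - h) T `<=` seg (T - 1) T.
  move=> t; rewrite /seg /= !in_itv /= => /andP[t1 t2].
  by have [_ _ ->] := window_arith h1 t1 t2; rewrite t2.
have mI := measurable_seg (T - h) T; have mJ := measurable_seg (T - 1) T.
have ur' t : seg (T - h) T t -> normH Om (u t) <= r by move=> /sub; exact: ur.
have HT : spaceH Om (u T) by exact: (lh_H LH (ltW T0)).
have LT := spaceH_L2v HT.
have Kk := Kkk IT; have [Hk rk] := Kr Kk; have Lk := spaceH_L2v Hk.
set k := kk T in Kk Hk rk Lk *.
have en := energy_at_endpoint oOm nu0 Hg LH h0 hT ur'; rewrite -/e in en.
set phi := fun t => dramp ((t - (T - h)) / h) / h.
have phi0 t : 0 <= phi t by rewrite divr_ge0 ?dramp_ge0 // ltW.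
have phi4 t : phi t <= 4 / h by rewrite ler_pM2r ?invr_gt0 // dramp_le.
have mphi : measurable_fun (seg (T - h) T) phi.
  by apply: measurable_funM => //; exact: measurable_up.
have iphi : lam.-integrable (seg (T - h) T) (EFin \o phi).
  by apply: (@seg_integrable _ _ _ _ (4 / h)) => // t _; rewrite ger0_norm.
have phiE : \int[lam]_(t in seg (T - h) T) phi t = e.
  rewrite (integral_dramp_up (T - h) h (ltW ab)) subrr mul0r [ramp 0]ramp_out // subr0.
  by rewrite /e (_ : (T - (T - h)) / h = 1) //; field; rewrite gt_eqF.
have iN := integrable_N2 LH a0 (ltW ab).
have iN1 := integrable_N2 LH T10 T11.
set N2 := fun t => normV Om 1 (u t) ^+ 2 in iN iN1.
set B := dissipation_bound Om nu g r.
have N2B : \int[lam]_(t in seg (T - h) T) N2 t <= B.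
  apply: le_trans (integral_N2_le oOm nu0 Hg LH T2 ur).
  by apply: Rintegral_subset => // t _; exact: sqr_ge0.
set A := normH Om k ^+ 2 + (7 + 6 * r) * d + 2 * sig.
have s4 : 0 <= sig * (4 / h) by apply: mulr_ge0 => //; exact: divr_ge0 (ltW h0).
have A0 : 0 <= A by rewrite !addr_ge0 ?sqr_ge0 ?mulr_ge0 // addr_ge0 ?mulr_ge0.
have avg : \int[lam]_(t in seg (T - h) T) (normH Om (u t) ^+ 2 * phi t) <=
    A * e + (sig * (4 / h)) * B.
  apply: (@le_trans _ _ (\int[lam]_(t in seg (T - h) T) (A * phi t + (sig * (4 / h)) * N2 t))); last first.
    rewrite (RintegralD mI (integrableZ_EFin A mI iphi) (integrableZ_EFin _ mI iN)).
    rewrite (RintegralZl _ mI iphi) (RintegralZl _ mI iN) phiE lerD2l.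
    exact: ler_wpM2l.
  have i1 := integrable_sq oOm LH a0 ab ur' mphi (C := 4 / h) _.
  have {}i1 : lam.-integrable (seg (T - h) T) (EFin \o (fun t => normH Om (u t) ^+ 2 * phi t)).
    by apply: i1 => t _; rewrite ger0_norm.
  have i2 : lam.-integrable (seg (T - h) T) (EFin \o (fun t => A * phi t + (sig * (4 / h)) * N2 t)).
    by have := integrableD mI (integrableZ_EFin A mI iphi) (integrableZ_EFin (sig * (4 / h)) mI iN); exact.
  rewrite /Rintegral fine_le //; [exact: integrable_fin_num|exact: integrable_fin_num|].
  apply: ae_ge0_le_integral => //.
  - by move=> t _; rewrite lee_fin mulr_ge0 // sqr_ge0.
  - exact: measurable_int i1.
  - move=> t _; rewrite lee_fin.
    by apply: addr_ge0; [exact: mulr_ge0 | exact: mulr_ge0 s4 (sqr_ge0 _)].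
  - exact: measurable_int i2.
  have [M [mM M0 subM]] := ae_spaceV LH a0 (ltW ab).
  exists M; split => // t /= nt; apply: subM => /= hV; apply: nt => It.
  rewrite lee_fin; have Vt := hV It.
  have pw := norm_sqr_pointwise Vt HT (ur' t It) (ur' T IT) (Kkk It) Kk (near_kk It) (near_kk IT)
    (fun i => equi i It).
  have pw2 : normH Om (u t) ^+ 2 <= A + sig * N2 t.
    apply: le_trans pw _; rewrite -/sig /A -[leRHS]addrA lerD2l.
    rewrite (_ : 2 * sig + _ = sig * (N2 t + 2)); last by ring.
    by rewrite ler_wpM2l // succ_le_sqr.
  apply: le_trans (ler_wpM2r (phi0 t) pw2) _.
  rewrite mulrDl lerD2l mulrAC; apply: ler_wpM2r; first exact: sqr_ge0.
  exact: ler_wpM2l.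
have Ld := L2vB mOm LT Lk.
have rT := ur' T IT.
have [nwT _] := near_kk IT.
have huk : `|inner Om (u T - k) k| <= gam + 2 * r * d.
  apply: inner_net_le => // [|i]; first exact: normH_diff_le.
  by rewrite innerBl // nwT.
have -> : normH Om (u T - k) ^+ 2 =
    normH Om (u T) ^+ 2 - normH Om k ^+ 2 - 2 * inner Om (u T - k) k.
  by rewrite !normH_sqr // innerBl // !innerBr // innerBl // (innerC mOm Lk LT); ring.
have := endpoint_sqr_arith e0 en (lerD avg (lexx _)) erefl huk gd.
by congr (_ <= _); rewrite -!/sig; ring.
Qed.
End approximation.
End core.

(** * Strong attraction *)

Section scales.
Variable R : realFieldType.

Fact equicontinuity_scale (D B d : R) : 0 <= D -> 0 <= B -> 0 < d ->
  exists2 th, 0 < th & exists2 h, 0 < h &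
    forall c t J, 0 <= c <= D -> 0 <= t <= h -> J <= B -> c * (t + (th * J + t / th)) <= d.
Proof.
move=> D0 B0 d0.
have DB : 0 < D * B + 1 by rewrite ltr_wpDl // mulr_ge0.
pose th := d / (2 * (D * B + 1)).
have th0 : 0 < th by rewrite divr_gt0 // mulr_gt0.
have c0 : 0 < 1 + th^-1 by rewrite addr_gt0 // invr_gt0.
have D1 : 0 < D + 1 by rewrite ltr_wpDl.
have M0 : 0 < 2 * (D + 1) * (1 + th^-1) by rewrite !mulr_gt0.
exists th => //; exists (d / (2 * (D + 1) * (1 + th^-1))); first by rewrite divr_gt0.
move=> c t J /andP[c1 cD] /andP[t0 th1] JB.
have -> : c * (t + (th * J + t / th)) = c * (t * (1 + th^-1)) + c * (th * J) by ring.
have h1 : c * (t * (1 + th^-1)) <= (D + 1) * (t * (1 + th^-1)).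
  by rewrite ler_wpM2r ?(mulr_ge0 t0 (ltW c0)) // (le_trans cD) // lerDl.
have h2 : (D + 1) * (t * (1 + th^-1)) <= d / 2.
  have : t * (2 * (D + 1) * (1 + th^-1)) <= d by rewrite -ler_pdivlMr.
  rewrite ler_pdivlMr //; lra.
have h3 : c * (th * J) <= D * B * th.
  rewrite mulrCA (mulrC (D * B)); apply: (ler_wpM2l (ltW th0)).
  by apply: (le_trans (ler_wpM2l c1 JB)); exact: ler_wpM2r.
have h4 : D * B * th <= d / 2.
  rewrite /th mulrA ler_pdivrMr ?mulr_gt0 //.
  have -> : d / 2 * (2 * (D * B + 1)) = (D * B + 1) * d by field.
  by rewrite ler_wpM2r ?(ltW d0) // lerDl.
lra.
Qed.

Fact endpoint_scale (e2 X r d gam eta Y : R) : 0 < X -> 1 <= r ->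
  d = e2 / (4 * (9 + 10 * r)) -> gam <= e2 / (4 * X) / 4 -> eta = e2 / (4 * X) / (4 * r) ->
  Y <= e2 / 4 -> 0 < e2 -> (9 + 10 * r) * d + (2 * gam + 2 * r * eta) * X + Y <= e2.
Proof.
move=> X0 r1 -> hg -> hY e0.
have r0 : 0 < r by exact: lt_le_trans r1.
have -> : (9 + 10 * r) * (e2 / (4 * (9 + 10 * r))) = e2 / 4.
  by field; rewrite gt_eqF // addr_gt0 ?mulr_gt0.
have -> : 2 * r * (e2 / (4 * X) / (4 * r)) = e2 / (4 * X) / 2 by field; rewrite !gt_eqF.
have : (2 * gam + e2 / (4 * X) / 2) * X <= e2 / 4.
  have -> : e2 / 4 = (2 * (e2 / (4 * X) / 4) + e2 / (4 * X) / 2) * X by field; rewrite gt_eqF.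
  by rewrite ler_pM2r // lerD2r ler_pM2l.
lra.
Qed.

Fact force_scale (G h e e2 : R) : 0 <= G -> 0 < e -> 0 <= h -> h <= e2 * e / (8 * (G + 1)) ->
  2 * (G * h) / e <= e2 / 4.
Proof.
move=> G0 e0 h0; rewrite ler_pdivlMr; last by rewrite mulr_gt0 // ltr_wpDl.
rewrite ler_pdivrMr //; nra.
Qed.
End scales.

Section attraction.
Variable R : realType.
Local Notation lam := (@lebesgue_measure R).
Variables (Om : set (E3 R)) (nu : R) (g : vfield R).
Hypotheses (oOm : open Om) (bOm : bounded_set Om) (nu0 : 0 < nu) (Hg : spaceH Om g).
Let mOm : measurable (Om : set (VT R)) := open_measurable_vol oOm.

Lemma dissipation_bound_ge0 r : 0 <= r -> 0 <= dissipation_bound Om nu g r.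
Proof.
move=> r0; apply: addr_ge0; first exact: sqr_ge0.
apply: divr_ge0; last by rewrite mulr_ge0 ?sqr_ge0 // ltW.
by rewrite addr_ge0 ?mulr_ge0 ?sqr_ge0 ?normH_ge0.
Qed.

(** The parameters of [endpoint_close] are chosen in the order [d], [h], [eta] and [gam]:
    the length [h] depends on the constants of equicontinuity of the [d]-net of [K],
    and [eta] and [gam] have to be small relative to [h], which occurs in a denominator.
    The resulting finite family [y] consists of both nets. *)
Lemma weakly_close_strongly_close r (K : set (vfield R)) eps : 1 <= r -> K `<=` ballH Om r ->
  solenoidal_net Om K -> 0 < eps ->
  exists (I : finType) (y : I -> vfield R) (gam : R),
  [/\ forall i, spaceH Om (y i), 0 < gam &
   forall u T kk, leray_hopf Om nu g u -> 2 < T ->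
    (forall t, seg (T - 2) (T + 1) t -> normH Om (u t) <= r) ->
    (forall t, seg (T - 1) T t -> K (kk t)) ->
    (forall t i, seg (T - 1) T t -> `|inner Om (u t) (y i) - inner Om (kk t) (y i)| <= gam) ->
    normH Om (u T - kk T) <= eps].
Proof.
move=> r1 Kr netK eps0.
have r0 : 0 < r by exact: lt_le_trans r1.
have e20 : 0 < eps ^+ 2 by rewrite exprn_gt0.
set e := ramp (1 : R); have e0 : 0 < e by exact: ramp_gt0.
set B := dissipation_bound Om nu g r; have B0 : 0 <= B by apply: dissipation_bound_ge0; exact: ltW.
pose d := eps ^+ 2 / (4 * (9 + 10 * r)).
have d0 : 0 < d by rewrite divr_gt0 // mulr_gt0 // addr_gt0 // mulr_gt0.
have [I [w [sw hw]]] := netK d d0.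
have /choice[D hD] : forall i, exists D, 0 <= D /\
  forall u s T th, leray_hopf Om nu g u -> 0 < s -> s <= T -> 0 < th ->
    (forall t, seg s T t -> normH Om (u t) <= r) ->
    `|inner Om (u T) (w i) - inner Om (u s) (w i)| <=
      D * ((T - s) + (th * \int[lam]_(t in seg s T) (normV Om 1 (u t) ^+ 2) + (T - s) / th)).
  by move=> i; have [D D0 h] := equicontinuity g oOm bOm nu0 (sw i) (ltW r0); exists D.
have DS i : 0 <= D i <= \sum_j D j.
  have [D0 _] := hD i; rewrite D0 (bigD1 i) //= lerDl sumr_ge0 // => j _.
  by have [] := hD j.
have DS0 : 0 <= \sum_j D j by apply: sumr_ge0 => j _; have [] := hD j.
have [th th0 [h1 h10 hth]] := equicontinuity_scale DS0 B0 d0.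
pose G := normH Om g * r; have G0 : 0 <= G by rewrite mulr_ge0 ?normH_ge0 // ltW.
pose h := Num.min 1 (Num.min h1 (eps ^+ 2 * e / (8 * (G + 1)))).
have h0 : 0 < h by rewrite !lt_min ltr01 h10 divr_gt0 ?mulr_gt0 // ltr_wpDl.
have [hle1 hleh1 hleG] : [/\ h <= 1, h <= h1 & h <= eps ^+ 2 * e / (8 * (G + 1))].
  by rewrite !ge_min !lexx !orbT.
pose X := 2 + 4 / h * B / e.
have X0 : 0 < X.
  rewrite ltr_pwDl //; apply: divr_ge0; last exact: ltW.
  by apply: mulr_ge0 => //; apply: divr_ge0 => //; exact: ltW.
pose s0 := eps ^+ 2 / (4 * X); have s00 : 0 < s0 by rewrite divr_gt0 // mulr_gt0.
pose eta := s0 / (4 * r); have eta0 : 0 < eta by rewrite divr_gt0 // mulr_gt0.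
pose gam := Num.min d (s0 / 4).
have gam0 : 0 < gam by rewrite lt_min d0 divr_gt0.
have [J [z [sz hz]]] := spaceV_net oOm bOm eta0.
exists (I + J)%type, (fun x => match x with inl i => w i | inr j => z j end), gam; split => //.
  by case=> i; exact: solenoidal_H.
move=> u T kk LH T2 ur Kkk nkk.
have T0 : 0 < T by apply: lt_trans T2.
have sub t : seg (T - h) T t -> seg (T - 1) T t.
  rewrite /seg /= !in_itv /= => /andP[t1 ->]; rewrite andbT.
  by apply: le_trans t1; rewrite lerD2l lerN2.
have sub2 t : seg (T - 1) T t -> seg (T - 2) (T + 1) t.
  rewrite /seg /= !in_itv /= => /andP[t1 t2].
  by have [-> -> _] := window_arith (lexx 1) t1 t2.
have close := @endpoint_close R Om nu g oOm bOm nu0 Hg K I J w z r d eta gam Kr sw sz hw hz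
  (ltW r0) (ltW d0) (ltW eta0) (ltW gam0) _ u T h kk LH T2 h0 hle1 ur.
have {}close : normH Om (u T - kk T) ^+ 2 <= eps ^+ 2.
  apply: le_trans (close _ _ _ _) _.
  - by rewrite ge_min lexx.
  - by move=> t /sub; exact: Kkk.
  - move=> t /sub It; split => [i|j]; [exact: (nkk t (inl i))|exact: (nkk t (inr j))].
  - move=> t i It; have It1 := sub t It.
    have t1 : T - 1 <= t by move: It1; rewrite /seg /= in_itv /= => /andP[].
    have [tT tT2] : t <= T /\ T - h <= t by move: It; rewrite /seg /= in_itv /= => /andP[].
    have t0 : 0 < t by apply: lt_le_trans t1; rewrite subr_gt0; apply: lt_trans T2; rewrite ltr1n.
    have subt s : seg t T s -> seg (T - 1) T s.
      rewrite /seg /= !in_itv /= => /andP[s1 ->]; rewrite andbT; exact: le_trans t1 s1.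
    have [_ hDi] := hD i.
    apply: le_trans (hDi u t T th LH t0 tT th0 _) _; first by move=> s /subt /sub2; exact: ur.
    apply: hth; first exact: DS.
      by rewrite subr_ge0 tT /=; apply: le_trans hleh1; rewrite lerBlDr addrC -lerBlDr.
    apply: le_trans (integral_N2_le oOm nu0 Hg LH T2 ur).
    have T10 : 0 < T - 1 by rewrite subr_gt0; apply: lt_trans T2; rewrite ltr1n.
    have T11 : T - 1 <= T by rewrite gerBl.
    apply: Rintegral_subset => //; [exact: measurable_seg|exact: measurable_seg| |].
      exact: (integrable_N2 LH T10 T11).
    by move=> s _; exact: sqr_ge0.
  apply: (@endpoint_scale _ (eps ^+ 2) X r d gam eta) => //.
    by rewrite ge_min lexx orbT.
  by apply: force_scale => //; exact: ltW.
by rewrite -(@ler_pXn2r _ 2) ?nnegrE ?normH_ge0 ?(ltW eps0).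
Qed.

(** Weak attraction yields, for each time [t] in a window that ends at a late time [T],
    a point of [K] near [u t] for [dw]; by [weak_metric_uniform] it is near when tested
    with the finite family of [weakly_close_strongly_close]. *)
Lemma strong_attraction r t0 (D : set (vfield R)) (dw : vfield R -> vfield R -> R)
    (K : set (vfield R)) : 1 <= r -> K `<=` ballH Om r ->
  weak_metric Om dw -> compact_for (weak_nbhs Om) K -> solenoidal_net Om K ->
  (forall t, t0 <= t -> ns_flow Om nu g t D `<=` ballH Om r) ->
  hdist dw (ns_flow Om nu g t D) K @[t --> +oo] --> 0%E ->
  hdist (distH Om) (ns_flow Om nu g t D) K @[t --> +oo] --> 0%E.
Proof.
move=> r1 Kr wm cK netK bd att; apply: cvge0_le => [t|eps eps0]; first exact: hdist_ge0.
have [I [y [gam [Hy gam0 close]]]] := weakly_close_strongly_close r1 Kr netK eps0.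
have [eta eta0 uni] := weak_metric_uniform wm Kr cK gam0 Hy.
have [t1 [_ ht1]] := cvge0_lt _ att eta0.
(* The bound and the attraction are needed from the time T - 2 on. *)
exists (Num.max (Num.max t0 t1 + 2) 2); split; first exact: num_real.
move=> T; rewrite gt_max => /andP[hT T2] /=.
apply: hdist_le => [|_ [u [LH Du ->]]]; first exact: ltW.
have [T0 T1] : t0 < T - 2 /\ t1 < T - 2 by apply/andP; rewrite -gt_max ltrBrDr.
have ub t : seg (T - 2) (T + 1) t -> ballH Om r (u t).
  rewrite /seg /= in_itv /= => /andP[h _].
  apply: (bd t); last exact: (ex_intro _ u (And3 LH Du erefl)).
  by apply: le_trans h; exact: ltW.
have sub2 t : seg (T - 1) T t -> seg (T - 2) (T + 1) t.
  rewrite /seg /= !in_itv /= => /andP[h1 h2].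
  by have [-> -> _] := window_arith (lexx 1) h1 h2.
have /choice[kk hkk] : forall t, exists k, seg (T - 1) T t -> K k /\ dw (u t) k < eta.
  move=> t; have [It|] := pselect (seg (T - 1) T t); last by exists 0.
  have dT : (hdist dw (ns_flow Om nu g t D) K < eta%:E)%E.
    apply: ht1; apply: lt_le_trans T1 _.
    by have := sub2 t It; rewrite /seg /= in_itv /= => /andP[].
  have [k Kk dk] := hdist_lt dT (ex_intro _ u (And3 LH Du erefl)).
  by exists k.
exists (kk T).
  by apply: (hkk T _).1; rewrite /seg /= in_itv /= lexx gerBl ler01.
apply: (close u T kk LH T2).
- by move=> t /ub[].
- by move=> t /hkk[].
- move=> t i It; have [Kk dk] := hkk t It.
  by apply: ltW; apply: uni => //; exact: ub (sub2 t It).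
Qed.

(** The compact set [A a] has a finite net, even in a stronger norm, and [K] is close to
    it; the elements of that net are approximated by solenoidal fields. *)
Lemma approximated_net (K : set (vfield R)) (A : R -> set (vfield R)) :
  K `<=` spaceH Om ->
  (forall a, 0 < a <= 1 -> A a `<=` spaceV Om /\
     compact_for (metric_nbhs (spaceV Om) (distV Om a)) (A a)) ->
  hdist (distH Om) K (A a) @[a --> 0^'+] --> 0%E ->
  solenoidal_net Om K.
Proof.
move=> KH hA cvg e e0.
have e3 : 0 < e / 3 by rewrite divr_gt0.
have [a a01 da] : exists2 a : R, 0 < a <= 1 & (hdist (distH Om) K (A a) < (e / 3)%:E)%E.
  near (0 : R)^'+ => a; exists a.
    by apply/andP; split; near: a; [exact: nbhs_right_gt | exact: nbhs_right_le].
  by near: a; exact: cvge0_lt.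
have [AV cA] := hA a a01.
have [I [v [Av hv]]] := compact_for_net e3 cA.
have Hv i : spaceH Om (v i) by apply: spaceV_H => //; exact: AV.
have /choice[w hw] : forall i, exists w, solenoidal Om w /\ normH Om (v i - w) < e / 3.
  by move=> i; have [_ /(_ _ e3)[w sw dw]] := Hv i; exists w.
exists I, w; split => [i|k Kk]; first by have [] := hw i.
have [b Ab dkb] := hdist_lt da Kk; have [i dvb] := hv b Ab; exists i.
have [sw dw] := hw i.
have Lk := spaceH_L2v (KH k Kk); have Lb := spaceH_L2v (spaceV_H oOm bOm (AV b Ab)).
have Lv := spaceH_L2v (Hv i); have Lw := solenoidal_L2v oOm bOm sw.
apply: le_trans (normH_triangle mOm Lk Lb Lw) _.
apply: le_trans (lerD (lexx _) (normH_triangle mOm Lb Lv Lw)) _.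
have -> : e = e / 3 + (e / 3 + e / 3) by field.
apply: lerD; first exact: ltW.
apply: lerD; last exact: ltW.
rewrite normHC //; apply: le_trans (ltW dvb).
by apply: normH_le_normV; exact: L2vB.
Unshelve. all: by end_near. Qed.

End attraction.

Theorem proposition6p13 (R : realType) (Om : set (E3 R)) (nu l1 : R)
    (f g : vfield R) (S : R -> R -> vfield R -> vfield R)
    (Aalpha : R -> set (vfield R)) (dw : vfield R -> vfield R -> R)
    (Aw : set (vfield R)) :
  bounded_C2_domain Om ->
  0 < nu ->
  0 < l1 -> first_stokes_eigenvalue Om l1 ->
  L2v Om f -> leray_proj Om f g ->
  (forall a, 0 < a <= 1 -> voigt_semigroup Om nu a g (S a)) ->
  (forall a, 0 < a <= 1 -> global_attractor Om a (S a) (Aalpha a)) ->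
  weak_metric Om dw ->
  weak_attractor Om nu l1 g dw Aw ->
  maxe (hdist (distH Om) (Aalpha a) Aw) (hdist (distH Om) Aw (Aalpha a))
    @[a --> 0^'+] --> 0%E ->
  strong_attractor Om nu l1 g Aw.
Proof.
move=> [oOm _ _ bOm _] nu0 _ _ _ [Hg _] _ gaA wm wa cvgA.
have [r0 [t0 bd]] := wa_bounded wa.
pose rB := Num.sqrt (2%:R * (1 + l1) * normH Om g ^+ 2 / (nu ^+ 2 * l1 ^+ 2)).
pose r := Num.max 1 (Num.max r0 rB).
have r1 : 1 <= r by rewrite le_max lexx.
have Kr : Aw `<=` ballH Om r.
  move=> k /(wa_sub wa)[Hk hk]; split => //.
  apply: (@le_trans _ _ rB); last by rewrite !le_max lexx !orbT.
  by have := ler_wsqrtr hk; rewrite sqrtr_sqr ger0_norm ?normH_ge0.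
have netK : solenoidal_net Om Aw.
  apply: (@approximated_net _ _ oOm bOm Aw Aalpha) => [k /Kr[]//|a a01|].
    by have G := gaA a a01; split; [exact: (ga_V G) | exact: (ga_compact G)].
  apply: cvge0_le => [a|e e0]; first exact: hdist_ge0.
  apply: filterS (cvge0_lt _ cvgA e0) => a h; apply: le_trans (ltW h).
  by rewrite le_max lexx orbT.
split; first exact: (strong_compact oOm bOm Kr (wa_compact wa) netK).
apply: (@strong_attraction _ _ nu g oOm bOm nu0 Hg r t0 _ dw) => //.
- exact: wa_compact wa.
- move=> t tt0 w /(bd t tt0)[Hw rw]; split => //.
  by apply: le_trans rw _; rewrite !le_max lexx !orbT.
- exact: wa_attracts wa.
Qed.
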